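(* Let $D$ be a metric space homeomorphic to the closed Euclidean disc, with boundary circle $\partial D$, and let $Q$ be a cw-decomposition of $D$ which is continuous and $\mathcal C$-smooth and which has two (distinct) non-trivial plaques contained in $\partial D$. Then $Q$ is a product structure.
   Context: A continuum is a compact connected metric space; a dendrite is a locally connected continuum containing no simple closed curve. A decomposition of a compact metric space $D$ is a map $Q$ assigning to each $x\in D$ a non-empty subcontinuum $Q(x)\subset D$ (a plaque) with $x\in Q(x)$, any two plaques equal or disjoint, and upper semicontinuous: for all $x$ and every open $V\supset Q(x)$ there is a neighborhood $W$ of $x$ with $Q(y)\subset V$ for all $y\in W$. It is continuous if $x_n\to x$ implies $Q(x_n)\to Q(x)$ in the Hausdorff metric. A plaque is non-trivial if it has more than one point. A continuum $C$ is unicoherent if $A\cap B$ is connected whenever $A,B$ are subcontinua with $A\cup B=C$; it is hereditarily unicoherent if every subcontinuum of it is unicoherent. In a hereditarily unicoherent continuum any two points lie in a unique minimal subcontinuum. $Q$ is a cw-decomposition of $D$ if the quotient space $D/Q$ (space of plaques with quotient topology) is a dendrite and every plaque is hereditarily unicoherent. $Q$ is $\mathcal C$-smooth if every plaque is hereditarily unicoherent and, denoting by $Q(x,y)$ the minimal subcontinuum of $Q(x)$ containing $x$ and $y\in Q(x)$, whenever $x_n\to x$, $y_n\in Q(x_n)$, $y_n\to y$ one has $Q(x_n,y_n)\to Q(x,y)$ in the Hausdorff metric. $Q$ is a product structure if there are a continuum $P$, a compact metric space $Z$ and a homeomorphism $h\colon D\to P\times Z$ such that for every $x\in D$, $h(Q(x))=P\times\{z\}$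 where $z$ is the second coordinate of $h(x)$. *)

(* Defs.v *)
From mathcomp Require Import all_boot all_order all_algebra.
From mathcomp Require Import generic_quotient.
From mathcomp Require Import all_classical all_reals all_analysis.
Set Implicit Arguments.
Unset Strict Implicit.
Unset Printing Implicit Defensive.
Import Order.TTheory GRing.Theory Num.Theory.
Import numFieldNormedType.Exports.
Local Open Scope classical_set_scope.
Local Open Scope quotient_scope.
Local Open Scope ring_scope.

Definition homeomorphism (T U : topologicalType) (f : T -> U) : Prop :=
  continuous f /\
  exists g : U -> T, [/\ continuous g, cancel f g & cancel g f].

Definition homeomorphic (T U : topologicalType) : Prop :=
  exists f : T -> U, homeomorphism f.

Definition unit_disc (R : realType) : set (R * R) :=
  [set p | p.1 ^+ 2 + p.2 ^+ 2 <= 1].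

Definition unit_circle (R : realType) : set (R * R) :=
  [set p | p.1 ^+ 2 + p.2 ^+ 2 = 1].

Arguments unit_disc R : clear implicits.
Arguments unit_circle R : clear implicits.

(* Subsets of a space are coerced to types carrying the subspace topology. *)
Definition disc_boundary (R : realType) (D : topologicalType)
    (phi : unit_disc R -> D) : set D :=
  phi @` [set p | unit_circle R (set_val p)].

Definition metrizable (R : realType) (T : topologicalType) : Prop :=
  exists M : metricType R, homeomorphic T M.

(* Meant for subsets of metrizable spaces; the empty set is not excluded, and
   non-emptiness is required separately wherever it matters. *)
Definition subcontinuum (T : topologicalType) (A : set T) : Prop :=
  compact A /\ connected A.

Definition continuum (T : topologicalType) : Prop := subcontinuum [set: T].

Definition locally_connected (T : topologicalType) : Prop :=
  forall (x : T) (U : set T), nbhs x U ->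
    exists V : set T, [/\ open V, connected V, V x & V `<=` U].

Definition simple_closed_curve (R : realType) (T : topologicalType)
    (S : set T) : Prop :=
  homeomorphic (unit_circle R) S.

Definition dendrite (R : realType) (T : topologicalType) : Prop :=
  [/\ metrizable R T, continuum T, locally_connected T &
      forall S : set T, ~ simple_closed_curve R S].

Definition unicoherent (T : topologicalType) (C : set T) : Prop :=
  forall A B : set T, subcontinuum A -> subcontinuum B -> A `|` B = C ->
    connected (A `&` B).

Definition hereditarily_unicoherent (T : topologicalType) (C : set T) : Prop :=
  forall K : set T, subcontinuum K -> K `<=` C -> unicoherent K.

(* Such a K exists for all x and y in a continuum C, and it is unique when C is
   hereditarily unicoherent. *)
Definition minimal_subcontinuum (T : topologicalType) (C : set T) (x y : T)
    (K : set T) : Prop :=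
  [/\ subcontinuum K, K `<=` C, K x, K y &
      forall L : set T, subcontinuum L -> L `<=` K -> L x -> L y -> L = K].

(* The Hausdorff metric; meaningful for non-empty compact sets only. *)
Definition hausdorff_dist (R : realType) (M : metricType R) (A B : set M) : R :=
  inf [set e : R | [/\ 0 < e, A `<=` \bigcup_(b in B) ball b e &
                       B `<=` \bigcup_(a in A) ball a e]].

Definition hausdorff_cvg (R : realType) (M : metricType R)
    (A_ : nat -> set M) (A : set M) : Prop :=
  hausdorff_dist (A_ n) A @[n --> \oo] --> (0 : R).

Section decompositions.
Context {R : realType} {D : metricType R}.
Implicit Types Q : D -> set D.

Definition decomposition Q : Prop :=
  [/\ forall x, Q x !=set0 /\ subcontinuum (Q x),
      forall x, Q x x,
      forall x y, Q x = Q y \/ Q x `&` Q y = set0 &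
      forall (x : D) (V : set D), open V -> Q x `<=` V ->
        \forall y \near x, Q y `<=` V].

Definition continuous_decomposition Q : Prop :=
  forall (x_ : nat -> D) (x : D), x_ @ \oo --> x ->
    hausdorff_cvg (fun n => Q (x_ n)) (Q x).

Definition nontrivial_plaque Q (x : D) : Prop :=
  exists y z : D, [/\ Q x y, Q x z & y <> z].

Definition same_plaque Q : rel D := fun x y => `[< Q x = Q y >].

Lemma same_plaque_refl Q : reflexive (same_plaque Q).
Proof. by move=> x; apply/asboolP. Qed.

Lemma same_plaque_sym Q : symmetric (same_plaque Q).
Proof. by move=> x y; apply/asboolP/asboolP => ->. Qed.

Lemma same_plaque_trans Q : transitive (same_plaque Q).
Proof. by move=> y x z /asboolP xy /asboolP yz; apply/asboolP; rewrite xy. Qed.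

Definition same_plaque_equiv Q : equiv_rel D :=
  EquivRel (same_plaque Q) (same_plaque_refl Q) (same_plaque_sym Q)
    (@same_plaque_trans Q).

Definition plaque_space Q : topologicalType :=
  quotient_topology {eq_quot (same_plaque_equiv Q)}.

Definition cw_decomposition Q : Prop :=
  [/\ decomposition Q, dendrite R (plaque_space Q) &
      forall x, hereditarily_unicoherent (Q x)].

Definition C_smooth Q : Prop :=
  (forall x, hereditarily_unicoherent (Q x)) /\
  forall (x_ y_ : nat -> D) (x y : D) (K_ : nat -> set D) (K : set D),
    (forall n, Q (x_ n) (y_ n)) -> Q x y ->
    (forall n, minimal_subcontinuum (Q (x_ n)) (x_ n) (y_ n) (K_ n)) ->
    minimal_subcontinuum (Q x) x y K ->
    x_ @ \oo --> x -> y_ @ \oo --> y ->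
    hausdorff_cvg K_ K.

Definition product_structure Q : Prop :=
  exists (P Z : metricType R) (h : D -> (P * Z)%type),
    [/\ continuum P, compact [set: Z], homeomorphism h &
        forall x, h @` Q x = [set: P] `*` [set (h x).2]].

End decompositions.

(* Main.v *)
Require Import Defs.
From mathcomp Require Import all_boot all_order all_algebra.
From mathcomp Require Import generic_quotient.
From mathcomp Require Import all_classical all_reals all_analysis.
From mathcomp Require Import ring lra.
Set Implicit Arguments.
Unset Strict Implicit.
Unset Printing Implicit Defensive.
Import Order.TTheory GRing.Theory Num.Theory.
Import numFieldNormedType.Exports.
Local Open Scope classical_set_scope.
Local Open Scope quotient_scope.
Local Open Scope ring_scope.

(* Let a and b lie on the two given boundary plaques, and let C1 and C2 be the
   arcs into which a and b divide the circle. The image of a path from a to b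
   contains an arc in the dendrite of plaques, and every interior point of it
   separates the ends, for otherwise the dendrite would contain a simple closed
   curve. Hence the plaque K over such a point separates a from b in the disc
   and meets C1 and C2. The projection is open, so both sides of K accumulate
   at every point of K; as a subcontinuum of K meeting C1 and C2 already
   separates a from b (two paths of the disc with linked ends on the circle
   meet), K is irreducible between any point of C1 and any point of C2.
   Smoothness makes irreducible plaques arcs. If some plaque were off the arc of
   plaques, a component of the complement of some K would miss the circle, and
   collapsing it onto K would give a forbidden retraction. Thus all plaques are
   irreducible between C1 and C2, the end plaques by passing to the limit; their
   endpoints vary continuously, and the normalized size of the minimal continuum
   from the endpoint in C1 to x is the coordinate of x along its plaque. The
   space of plaques, being an arc, serves as both factors of the product. *)

(** * General topology and paths *)

(** The plane enters only through Poincare-Miranda, which yields both the crossing of linked paths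
    and the absence of retractions; no Jordan curve theorem is invoked. The obstacle is that a
    plaque is at first just a continuum, perhaps without any path in it. Separation is therefore
    expressed by paths in open complements, and order along a plaque by inclusion of minimal
    continua, which a monotone real-valued size turns into a coordinate. The two boundary plaques
    are used twice. As they lie on the circle, radial segments avoid them and their complements stay
    path connected; so a path coming from outside the arc of plaques cannot first arrive at an end
    of it. As they are non-trivial, the two endpoints of every plaque are distinct, even in the
    limit, and the normalizing factor of the coordinate does not vanish. *)

Section general_topology.
Implicit Types T U V W : topologicalType.

Lemma continuous_image_compact T U (f : T -> U) (A : set T) :
  continuous f -> compact A -> compact (f @` A).
Proof.
by move=> cf cA; apply: continuous_compact => //; exact: continuous_subspaceT.
Qed.

Lemma continuous_image_connected T U (f : T -> U) (A : set T) :
  continuous f -> connected A -> connected (f @` A).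
Proof.
move=> cf cA; apply: connected_continuous_connected => //.
exact: continuous_subspaceT.
Qed.

Lemma continuous_paste T U (A B : set T) (f g h : T -> U) :
  closed A -> closed B -> (forall x, A x \/ B x) ->
  continuous g -> continuous h ->
  (forall x, A x -> f x = g x) -> (forall x, B x -> f x = h x) -> continuous f.
Proof.
move=> clA clB AB /continuous_closedP cg /continuous_closedP ch fg fh.
apply/continuous_closedP => C clC.
have -> : f @^-1` C = (A `&` g @^-1` C) `|` (B `&` h @^-1` C).
  apply/seteqP; split => x /=.
    by case: (AB x) => [Ax|Bx]; [rewrite (fg _ Ax)|rewrite (fh _ Bx)]; tauto.
  by move=> [[Ax]|[Bx]]; [rewrite (fg _ Ax)|rewrite (fh _ Bx)].
by apply: closedU; apply: closedI => //; [exact: cg|exact: ch].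
Qed.

Lemma compact_space_closed_map T U (f : T -> U) (A : set T) :
  compact [set: T] -> hausdorff_space U -> continuous f -> closed A ->
  closed (f @` A).
Proof.
move=> cT hU cf clA; apply: compact_closed => //.
apply: continuous_image_compact => //.
by apply: (subclosed_compact clA cT).
Qed.

(** On compact [A] the map [f] is closed, so [k], which [g] determines through [f x = r y], pulls
    closed sets back to closed sets. Functions picked by [choice], such as inverses and retractions,
    are shown continuous in this way. *)
Lemma continuous_factor T U V W (A : set T) (f : T -> U) (g : T -> V)
    (r : W -> U) (k : W -> V) :
  compact A -> hausdorff_space U -> continuous f -> continuous g ->
  continuous r -> (forall y, exists2 x, A x & f x = r y) ->
  (forall x y, A x -> f x = r y -> k y = g x) -> continuous k.
Proof.
move=> cA hU cf /continuous_closedP cg /continuous_closedP cr fs kfg.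
apply/continuous_closedP => C clC.
have -> : k @^-1` C = r @^-1` (f @` (A `&` g @^-1` C)).
  apply/seteqP; split => [y /= Cy|y /= [x [Ax Cx] xy]]; last by rewrite (kfg x).
  by have [x Ax xy] := fs y; exists x => //; split => //=; rewrite -(kfg _ y).
apply: cr; apply: compact_closed => //; apply: continuous_image_compact => //.
by apply: compact_closedI => //; exact: cg.
Qed.

Lemma connected_closed_disjoint T (K M N : set T) :
  connected K -> closed M -> closed N -> K `<=` M `|` N ->
  (forall x, K x -> M x -> N x -> False) -> (K `&` M !=set0) -> K `<=` M.
Proof.
move=> cK clM clN KMN dMN KM x Kx.
suff KM' : K `&` M = K by move: Kx; rewrite -{1}KM' => -[].
apply: cK => //; last by exists M.
exists (~` N); first exact: closed_openC.
apply/seteqP; split=> y [Ky Hy]; split => //; first by move=> Ny; exact: dMN Hy Ny.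
by case: (KMN y Ky) => // /Hy.
Qed.

Lemma disconnected_closed T (K : set T) : closed K -> ~ connected K ->
  exists M N : set T, [/\ closed M, closed N, M !=set0, N !=set0 &
    K = M `|` N /\ M `&` N = set0].
Proof.
move=> clK /connectedPn[E [E0 KE [sep1 sep2]]].
have clE b : closed (E b).
  have cE : closure (E b) `<=` K.
    by rewrite (closure_id K).1//; apply: closureS; rewrite KE; case: b;
      [apply: subsetUr|apply: subsetUl].
  rewrite closure_id; apply/seteqP; split; first exact: subset_closure.
  move=> x Ex; have := cE x Ex; rewrite KE; case: b Ex {cE} => Ex [] // Ex'.
    by have : (E false `&` closure (E true)) x by []; rewrite sep2.
  by have : (closure (E false) `&` E true) x by []; rewrite sep1.
exists (E false), (E true); split => //; split => //.
rewrite -subset0 -sep1; apply: setSI; exact: subset_closure.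
Qed.

Lemma directed_compact_bigcap T (F : set (set T)) : hausdorff_space T ->
  F !=set0 -> (forall A, F A -> compact A /\ A !=set0) ->
  (forall A B, F A -> F B -> exists2 C, F C & C `<=` A `&` B) ->
  exists x, forall A, F A -> A x.
Proof.
move=> hT [A0 FA0] FP Fdir.
have FF : ProperFilter (filter_from F id).
  apply: filter_from_proper; last by move=> A /FP[].
  by apply: filter_from_filter; [exists A0|].
have mF A : F A -> filter_from F id A by move=> FA; exists A.
have [p [A0p clp]] := (FP _ FA0).1 (filter_from F id) FF (mF _ FA0).
exists p => A FA; have clA := compact_closed hT (FP _ FA).1.
by apply: clA => B Bp; exact: clp (mF _ FA) Bp.
Qed.

(** If the intersection split, normality would separate its parts by disjoint open sets [U] and [V].
    Every connected member of [F] has a point outside [U] and [V], and by compactness so has the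
    intersection. *)
Lemma directed_connected_bigcap (R : realType) (T : metricType R)
    (F : set (set T)) :
  F !=set0 -> (forall A, F A -> compact A /\ connected A) ->
  (forall A B, F A -> F B -> exists2 C, F C & C `<=` A `&` B) ->
  compact (\bigcap_(A in F) A) /\ connected (\bigcap_(A in F) A).
Proof.
have hT := @metric_hausdorff _ T; move=> [A0 FA0] FP Fdir.
have clF A : F A -> closed A by move=> /FP[/(compact_closed hT)].
have clI : closed (\bigcap_(A in F) A) by apply: closed_bigI => A /clF.
have subI : \bigcap_(A in F) A `<=` A0 by move=> x; exact.
split; first exact: subclosed_compact clI (FP _ FA0).1 subI.
apply: contrapT => /(disconnected_closed clI)[M [N [clM clN M0 N0 [IMN MN0]]]].
have [U [V [oU oV MU NV UV0]]] : exists U V : set T, [/\ open U, open V, M `<=` U, N `<=` V & U `&` V = set0].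
  exact: ((@normal_openP R T).1 pseudometric_normal).
pose F' := [set A `\` (U `|` V) | A in F].
have [|||x Fx] := @directed_compact_bigcap T F' hT.
- by exists (A0 `\` (U `|` V)), A0.
- move=> _ [A FA <-]; split.
    apply: compact_closedI; first exact: (FP _ FA).1.
    by apply: open_closedC; exact: openU.
  apply: contrapT => A0'.
  have AUV x : A x -> (~` V) x \/ (~` U) x.
    move=> Ax; have [Ux|] := pselect (U x); last by right.
    by left => Vx; have : (U `&` V) x by []; rewrite UV0.
  have AUV' x : A x -> (U `|` V) x.
    by move=> Ax; apply: contrapT => nx; apply: A0'; exists x.
  have [m Mm] := M0; have [n Nn] := N0.
  have Am : A m by have : (M `|` N) m by [left]; rewrite -IMN; exact.
  have An : A n by have : (M `|` N) n by [right]; rewrite -IMN; exact.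
  have : A `<=` ~` V.
    apply: (@connected_closed_disjoint _ A (~` V) (~` U)) => //.
    - exact: (FP _ FA).2.
    - exact: open_closedC.
    - exact: open_closedC.
    - by move=> x Ax nV nU; case: (AUV' x Ax).
    - exists m; split => // Vm; have : (U `&` V) m by split => //; exact: MU.
      by rewrite UV0.
  by move=> /(_ n An); apply; exact: NV.
- move=> _ _ [A FA <-] [B FB <-]; have [C FC CAB] := Fdir _ _ FA FB.
  exists (C `\` (U `|` V)); first by exists C.
  by move=> x [/CAB[Ax Bx] nx]; split; split.
have Ix : (\bigcap_(A in F) A) x.
  by move=> A FA; have [] : (A `\` (U `|` V)) x by apply: Fx; exists A.
have [] := Fx (A0 `\` (U `|` V)) (ex_intro2 _ _ A0 FA0 erefl).
by move: Ix; rewrite IMN => -[/MU|/NV] ? _ []; [left|right].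
Qed.

End general_topology.

(** * Paths inside a set *)

Section paths.
Context {R : realType}.
Implicit Types T : topologicalType.

(** Paths are maps of the whole line, constrained on [[0, 1]] only; this avoids subspace
    topologies. *)
Definition joined T (U : set T) (x y : T) : Prop :=
  exists g : R -> T, [/\ continuous g, g 0 = x, g 1 = y &
    forall s, 0 <= s <= 1 -> U (g s)].

Lemma joined_refl T (U : set T) x : U x -> joined U x x.
Proof. by move=> Ux; exists (fun=> x); split => // ?; exact: cvg_cst. Qed.

Lemma continuous_affine (a b : R) : continuous (fun s : R => a + s * b).
Proof. by move=> s; apply: cvgD; [exact: cvg_cst|apply: cvgMr_tmp; exact: cvg_id]. Qed.

Lemma joined_sym T (U : set T) x y : joined U x y -> joined U y x.
Proof.
move=> [g [cg g0 g1 gU]]; exists (fun s => g (1 + s * -1)); split.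
- by move=> s; apply: continuous_comp; [exact: continuous_affine|exact: cg].
- by rewrite mul0r addr0.
- by rewrite mul1r subrr.
- by move=> s s01; apply: gU; lra.
Qed.

Lemma joined_trans T (U : set T) y x z :
  joined U x y -> joined U y z -> joined U x z.
Proof.
move=> [g [cg g0 g1 gU]] [h [ch h0 h1 hU]].
exists (fun s => if s <= 2^-1 then g (0 + s * 2) else h (-1 + s * 2)); split.
- refine (@continuous_paste R T [set s | s <= 2^-1] [set s | s >= 2^-1] _
    (fun s => g (0 + s * 2)) (fun s => h (-1 + s * 2)) _ _ _ _ _ _ _).
  + exact: closed_le.
  + exact: closed_ge.
  + by move=> s; apply/orP; exact: le_total.
  + by move=> s; apply: continuous_comp; [exact: continuous_affine|exact: cg].
  + by move=> s; apply: continuous_comp; [exact: continuous_affine|exact: ch].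
  + by move=> s /= ->.
  + move=> s /= s2; case: ifPn => // s2'; have -> : s = 2^-1 by lra.
    by rewrite add0r mulVf// addNr g1 h0.
- by rewrite ifT ?mul0r ?addr0//; lra.
- by rewrite ifF ?mul1r -?h1; [congr h|apply/negbTE]; lra.
- by move=> s s01; case: ifPn => s2; [apply: gU|apply: hU]; lra.
Qed.

Lemma joined_sub T (U V : set T) x y : U `<=` V -> joined U x y -> joined V x y.
Proof. by move=> UV [g [cg g0 g1 gU]]; exists g; split => // s /gU/UV. Qed.

Lemma joined_mem T (U : set T) x y : joined U x y -> U x /\ U y.
Proof.
by move=> [g [cg <- <- gU]]; split; apply: gU; rewrite ?lexx ?ler01.
Qed.

Lemma joined_image T T' (f : T -> T') (U : set T) (V : set T') x y :
  continuous f -> (forall z, U z -> V (f z)) -> joined U x y ->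
  joined V (f x) (f y).
Proof.
move=> cf UV [g [cg <- <- gU]]; exists (f \o g); split => //.
  by move=> s; apply: continuous_comp; [exact: cg|exact: cf].
by move=> s s01; apply: UV; exact: gU.
Qed.

(** The points joined to [x] form an open and closed part of [K]. Thus a connected set that may
    contain no path can be replaced by a path close to it. *)
Lemma joined_connected T (U K : set T) x y :
  (forall z, U z -> \forall z' \near z, joined U z z') ->
  connected K -> K `<=` U -> K x -> K y -> joined U x y.
Proof.
move=> Uloc cK KU Kx Ky.
suff : K `&` [set z | joined U x z] = K by move=> /seteqP[_ /(_ y Ky)[]].
apply: cK.
- by exists x; split => //; apply: joined_refl; exact: KU.
- exists [set z | joined U x z] => //; rewrite openE => z /= xz.
  apply: filterS (Uloc z (joined_mem xz).2) => z' zz'; exact: joined_trans zz'.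
- exists (closure [set z | joined U x z]); first exact: closed_closure.
  apply/seteqP; split => z [Kz xz]; split => //; first exact: subset_closure.
  have [z' [/= xz' zz']] := xz _ (Uloc z (KU z Kz)).
  by apply: joined_trans xz' _; exact: joined_sym.
Qed.

End paths.

(** * The Poincare-Miranda theorem and planar crossings *)

Section poincare_miranda.
Context {R : realType}.

(* Colours number the quadrants counterclockwise; the value 0 between opposite
   quadrants is junk. *)
Definition quarter_turn (c d : nat) : int :=
  match c, d with
  | 0%N, 1%N | 1%N, 2%N | 2%N, 3%N | 3%N, 0%N => 1
  | 1%N, 0%N | 2%N, 1%N | 3%N, 2%N | 0%N, 3%N => -1
  | _, _ => 0
  end.

(** A small cell is mapped into one of four open half planes, where only two consecutive quadrants
    occur; opposite colours never meet in a cell. *)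
Definition close_colour (k c : nat) : bool := (c == k) || (c == k.+1 %% 4)%N.

Lemma quarter_turn_cell k c1 c2 c3 c4 : (k < 4)%N ->
  close_colour k c1 -> close_colour k c2 -> close_colour k c3 ->
  close_colour k c4 ->
  quarter_turn c1 c2 + quarter_turn c2 c3 =
  quarter_turn c1 c4 + quarter_turn c4 c3.
Proof.
by case: k => [|[|[|[|//]]]] _; do 4![move=> /orP[]/eqP->].
Qed.

(** Cutting the cycle of colours at the avoided colour [m] lifts it to the integers from [m + 1] to
    [m + 3], and turns become differences. *)
Lemma quarter_turn_lift k m c d : (k < 4)%N -> (m < 4)%N -> close_colour k c ->
  close_colour k d -> c != m -> d != m ->
  quarter_turn c d = (d + 4 * (d < m))%N%:Z - (c + 4 * (c < m))%N%:Z.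
Proof.
by case: k => [|[|[|[|//]]]] _; case: m => [|[|[|[|//]]]] _;
  do 2![move=> /orP[]/eqP->].
Qed.

Lemma discrete_green (H V : nat -> nat -> int) m n :
  (forall i j, (i < m)%N -> (j < n)%N ->
    H i j + V i.+1 j = V i j + H i j.+1) ->
  \sum_(0 <= i < m) H i 0%N + \sum_(0 <= j < n) V m j =
  \sum_(0 <= j < n) V 0%N j + \sum_(0 <= i < m) H i n.
Proof.
elim: m => [|m IH] cell.
  by rewrite [X in X + _]big_geq// [X in _ = _ + X]big_geq// add0r addr0.
have strip k : (k <= n)%N -> H m 0%N + \sum_(0 <= j < k) V m.+1 j =
    \sum_(0 <= j < k) V m j + H m k.
  elim: k => [|k IHk] kn; first by rewrite !big_geq// add0r addr0.
  rewrite !big_nat_recr//= addrA IHk; last exact: ltnW.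
  by rewrite -addrA cell// addrA.
rewrite !big_nat_recr//= addrA -IH; last by move=> i j im; apply: cell; exact: ltnW.
by rewrite -addrA strip// addrA.
Qed.

Lemma telescope_lift (h : nat -> int) (L : nat -> int) n :
  (forall i, (i < n)%N -> h i = L i.+1 - L i) ->
  \sum_(0 <= i < n) h i = L n - L 0%N.
Proof.
elim: n => [|n IH] hL; first by rewrite big_geq// subrr.
rewrite big_nat_recr//= IH ?hL//; last by move=> i ?; apply: hL; exact: ltnW.
by rewrite addrC addrA subrK.
Qed.

(** Without a common zero, the points of a fine grid can be coloured by the quadrant of [(f, g)].
    Turns around each cell cancel, so both routes along the boundary between opposite corners turn
    equally. But each side avoids one colour, and the four lifts show that the routes differ by a
    full turn, that is, by 4. *)
Lemma poincare_miranda (f g : R * R -> R) : continuous f -> continuous g ->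
  (forall t : R, 0 <= t <= 1 -> f (0, t) <= 0 <= f (1, t)) ->
  (forall s : R, 0 <= s <= 1 -> g (s, 0) <= 0 <= g (s, 1)) ->
  exists s t : R, [/\ 0 <= s <= 1, 0 <= t <= 1, f (s, t) = 0 & g (s, t) = 0].
Proof.
move=> cf cg fb gb; apply: contrapT => nz.
pose S : set (R * R) := `[0, 1]%classic `*` `[0, 1]%classic.
have cS : compact S by apply: compact_setX; exact: segment_compact.
have nzS p : S p -> (f p != 0) || (g p != 0).
  move: p => [s t] [/=]; rewrite !in_itv/= => s01 t01.
  by rewrite -negb_and; apply/negP => /andP[/eqP fp /eqP gp]; apply: nz; exists s, t.
pose O (k : nat) : set (R * R) := match k with
  | 3%N => [set p | 0 < f p] | 0%N => [set p | 0 < g p]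
  | 1%N => [set p | f p < 0] | _ => [set p | g p < 0] end.
have oO k : open (O k).
  have oP (h : R * R -> R) : continuous h -> open [set p | 0 < h p].
    move=> /continuousP ch; exact: (ch _ (@open_gt R 0)).
  have oN (h : R * R -> R) : continuous h -> open [set p | h p < 0].
    move=> /continuousP ch; exact: (ch _ (@open_lt R 0)).
  by case: k => [|[|[|[|k]]]] /=; [apply: oP|apply: oN|apply: oN|apply: oP|apply: oN].
have covS p : S p -> exists2 k, (k < 4)%N & O k p.
  move=> /nzS/orP[] /lt_total/orP[] ?; [by exists 1%N|by exists 3%N| |].
    by exists 2%N.
  by exists 0%N.
(* A Lebesgue number for the cover of the square by the half planes [O k]. *)
have [n Hn] : exists n : nat, S `<=` [set p | exists2 k, (k < 4)%N &
    ball p n.+1%:R^-1 `<=` O k].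
  have := (compact_near_coveringP S).1 cS nat \oo
    (fun n p => exists2 k, (k < 4)%N & ball p n.+1%:R^-1 `<=` O k) _.
  case.
    move=> p /covS[k k4 Okp].
    have /nbhs_ballP[e /= e0 be] : nbhs p (O k) by exact: open_nbhs_nbhs.
    have e20 : 0 < e / 2 by rewrite divr_gt0.
    exists (ball p (e / 2), [set n | n.+1%:R^-1 < e / 2]).
      split; first exact: nbhsx_ballx.
      exact: near_infty_natSinv_lt (PosNum e20).
    move=> [q m] [/= pq me]; exists k => // r qr; apply: be.
    rewrite [e]splitr; apply: ball_triangle pq _; exact: le_ball (ltW me) _ qr.
  by move=> N _ /(_ N (leqnn N)) HN; exists N.
(* The mesh is strictly below the Lebesgue number, so each closed cell lies in the ball around its
   lower left corner. *)
pose v (i j : nat) : R * R := (i%:R / n.+2%:R, j%:R / n.+2%:R).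
have n20 : 0 < n.+2%:R :> R by [].
have vS i j : (i <= n.+2)%N -> (j <= n.+2)%N -> S (v i j).
  by move=> ic jc; split; rewrite /= in_itv/= divr_ge0//= ler_pdivrMr// mul1r ler_nat.
(* The half-axes are assigned so that the weak inequalities on the left, right and bottom sides
   exclude one colour outright; on the top side, colour 3 could only come from a common zero. *)
pose col (p : R * R) : nat := if (0 < f p) && (0 <= g p) then 0%N
  else if 0 < g p then 1%N else if f p < 0 then 2%N else 3%N.
pose c i j := col (v i j).
have colO k p : O k p -> (k < 4)%N -> S p -> close_colour k (col p).
  move=> + + /nzS; rewrite /col; case: k => [|[|[|[|//]]]] /= Okp _ nz0.
  - by rewrite (ltW Okp) andbT Okp; case: ifP.
  - by rewrite ltNge (ltW Okp)/= Okp; case: ifP.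
  - by rewrite (leNgt 0 (g p)) Okp andbF ltNge (ltW Okp)/=; case: ifP.
  - rewrite Okp /=; case: (ltgtP 0 (g p)) => //= _; by rewrite ltNge (ltW Okp).
have cell i j : (i < n.+2)%N -> (j < n.+2)%N -> exists2 k, (k < 4)%N &
    [/\ close_colour k (c i j), close_colour k (c i.+1 j),
        close_colour k (c i j.+1) & close_colour k (c i.+1 j.+1)].
  move=> ic jc; have [k k4 Ok] := Hn _ (vS i j (ltnW ic) (ltnW jc)).
  have near (a b : nat) (h : bool) : (a = b \/ a = b.+1)%N ->
      ball (b%:R / n.+2%:R : R) n.+1%:R^-1 (a%:R / n.+2%:R).
    move=> ab; rewrite /ball/= -mulrBl normrM (ger0_norm (x := n.+2%:R^-1))//.
    case: ab => ->; first by rewrite subrr normr0 mul0r.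
    by rewrite -natr1 opprD addrA subrr add0r normrN1 mul1r ltf_pV2 ?posrE// ltr_nat.
  exists k => //; split; apply: colO => //; try (by apply: vS => //; exact: ltnW);
   apply: Ok; split; apply: near => //; first [by left|by right].
have cellH i j : (i < n.+2)%N -> (j <= n.+2)%N -> exists2 k, (k < 4)%N &
    close_colour k (c i j) /\ close_colour k (c i.+1 j).
  move=> ic; rewrite leq_eqVlt => /orP[/eqP->|jc].
    by have [k ? []] := cell i n.+1 ic (ltnSn _); exists k.
  by have [k ? []] := cell i j ic jc; exists k.
have cellV i j : (i <= n.+2)%N -> (j < n.+2)%N -> exists2 k, (k < 4)%N &
    close_colour k (c i j) /\ close_colour k (c i j.+1).
  move=> + jc; rewrite leq_eqVlt => /orP[/eqP->|ic].
    by have [k ? []] := cell n.+1 j (ltnSn _) jc; exists k.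
  by have [k ? []] := cell i j ic jc; exists k.
have v0 : 0%:R / n.+2%:R = 0 :> R by rewrite mul0r.
have v1 : n.+2%:R / n.+2%:R = 1 :> R by rewrite divff.
have in01 i : (i <= n.+2)%N -> 0 <= (i%:R / n.+2%:R : R) <= 1.
  by move=> ic; rewrite divr_ge0//= ler_pdivrMr// mul1r ler_nat.
have cL j : (j <= n.+2)%N -> c 0%N j != 0%N.
  move=> /in01/fb/andP[h _]; rewrite /c /v v0 /col ltNge h /=.
  by case: ifP => //; case: ifP.
have cR j : (j <= n.+2)%N -> c n.+2 j != 2%N.
  move=> /in01/fb/andP[_ h]; rewrite /c /v v1 /col (ltNge _ 0) h /=.
  by case: ifP => //; case: ifP.
have cB i : (i <= n.+2)%N -> c i 0%N != 1%N.
  move=> /in01/gb/andP[h _]; rewrite /c /v v0 /col (ltNge 0 (g _)) h /=.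
  by case: ifP => //; case: ifP.
have cT i : (i <= n.+2)%N -> c i n.+2 != 3%N.
  move=> ii; have /gb/andP[_ h] := in01 _ ii.
  have := nzS _ (vS i n.+2 ii (leqnn _)).
  rewrite /c /v v1 /col h andbT.
  move: (f _) (g _) h => x y y0; case: (ltgtP 0 x) => // [_|x0].
    by case: ifP.
  by rewrite lt_neqAle y0 andbT (eq_sym 0) /= => ->.
have := @discrete_green (fun i j => quarter_turn (c i j) (c i.+1 j))
  (fun i j => quarter_turn (c i j) (c i j.+1)) n.+2 n.+2.
move=> /(_ _)/wrap[i j ic jc|].
  by have [k k4 [? ? ? ?]] := cell i j ic jc; exact: (@quarter_turn_cell k).
rewrite (@telescope_lift _ (fun i => (c i 0%N + 4 * (c i 0%N < 1)%N)%N%:Z)); last first.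
  move=> i ic; have [k k4 [? ?]] := cellH i 0%N ic (leq0n _).
  by apply: (@quarter_turn_lift k 1) => //; apply: cB => //; exact: ltnW.
rewrite (@telescope_lift _ (fun i => (c n.+2 i + 4 * (c n.+2 i < 2)%N)%N%:Z)); last first.
  move=> i ic; have [k k4 [? ?]] := cellV n.+2 i (leqnn _) ic.
  by apply: (@quarter_turn_lift k 2) => //; apply: cR => //; exact: ltnW.
rewrite (@telescope_lift _ (fun i => (c 0%N i + 4 * (c 0%N i < 0)%N)%N%:Z)); last first.
  move=> i ic; have [k k4 [? ?]] := cellV 0%N i (leq0n _) ic.
  by apply: (@quarter_turn_lift k 0) => //; apply: cL => //; exact: ltnW.
rewrite (@telescope_lift _ (fun i => (c i n.+2 + 4 * (c i n.+2 < 3)%N)%N%:Z)); last first.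
  move=> i ic; have [k k4 [? ?]] := cellH i n.+2 ic (leqnn _).
  by apply: (@quarter_turn_lift k 3) => //; apply: cT => //; exact: ltnW.
have := cL 0%N (leq0n _); have := cB 0%N (leq0n _).
have := cL n.+2 (leqnn _); have := cT 0%N (leq0n _).
have := cR 0%N (leq0n _); have := cB n.+2 (leqnn _).
have := cR n.+2 (leqnn _); have := cT n.+2 (leqnn _).
have c4 i j : (c i j < 4)%N by rewrite /c /col; do 3?[case: ifP].
have := c4 0%N 0%N; have := c4 0%N n.+2; have := c4 n.+2 0%N; have := c4 n.+2 n.+2.
case: (c 0%N 0%N) => [|[|[|[|//]]]]; case: (c 0%N n.+2) => [|[|[|[|//]]]];
case: (c n.+2 0%N) => [|[|[|[|//]]]]; case: (c n.+2 n.+2) => [|[|[|[|//]]]] //.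
Qed.

End poincare_miranda.

Section continuity.
Context {R : realType} {T : topologicalType}.
Implicit Types f g : T -> R.

Lemma cont_cst {U : topologicalType} (u : U) : continuous (fun _ : T => u).
Proof. by move=> x; exact: cvg_cst. Qed.

Lemma contD f g : continuous f -> continuous g -> continuous (fun x => f x + g x).
Proof. by move=> cf cg x; apply: cvgD; [exact: cf|exact: cg]. Qed.

Lemma contN f : continuous f -> continuous (fun x => - f x).
Proof. by move=> cf x; apply: cvgN; exact: cf. Qed.

Lemma contM f g : continuous f -> continuous g -> continuous (fun x => f x * g x).
Proof. by move=> cf cg x; apply: cvgM; [exact: cf|exact: cg]. Qed.

Lemma cont_norm f : continuous f -> continuous (fun x => `|f x|).
Proof. by move=> cf x; apply: cvg_norm; exact: cf. Qed.

Lemma cont_pair {U V : topologicalType} (f : T -> U) (g : T -> V) :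
  continuous f -> continuous g -> continuous (fun x => (f x, g x)).
Proof. by move=> cf cg x; apply: cvg_pair; [exact: cf|exact: cg]. Qed.

Lemma cont_fst {U V : topologicalType} (f : T -> U * V) :
  continuous f -> continuous (fun x => (f x).1).
Proof. by move=> cf x; apply: cvg_comp; [exact: cf|exact: cvg_fst]. Qed.

Lemma cont_snd {U V : topologicalType} (f : T -> U * V) :
  continuous f -> continuous (fun x => (f x).2).
Proof. by move=> cf x; apply: cvg_comp; [exact: cf|exact: cvg_snd]. Qed.

Lemma cont_id : continuous (fun x : T => x).
Proof. by move=> x; exact: cvg_id. Qed.

Lemma cont_comp {U V : topologicalType} (f : T -> U) (g : U -> V) :
  continuous f -> continuous g -> continuous (fun x => g (f x)).
Proof. by move=> cf cg x; apply: continuous_comp; [exact: cf|exact: cg]. Qed.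

End continuity.

(* [continuous f] is a notation for a product in which Ltac cannot match [f]. *)
Definition cont {T U : topologicalType} (f : T -> U) := continuous f.

Lemma contP {T U : topologicalType} (f : T -> U) : cont f -> continuous f.
Proof. by []. Qed.

Ltac cts_step :=
  lazymatch goal with |- cont ?h =>
  lazymatch h with
  | (fun _ => ?c) => exact: cont_cst
  | (fun x => x) => exact: cont_id
  | (fun x => @Algebra.add _ (@?f x) (@?g x)) =>
      apply: (@contD _ _ f g); apply: contP
  | (fun x => @GRing.mul _ (@?f x) (@?g x)) =>
      apply: (@contM _ _ f g); apply: contP
  | (fun x => @Algebra.opp _ (@?f x)) => apply: (@contN _ _ f); apply: contP
  | (fun x => @Num.norm _ _ (@?f x)) => apply: (@cont_norm _ _ f); apply: contP
  | (fun x => (@?f x, @?g x)) => apply: (@cont_pair _ _ _ f g); apply: contP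
  | (fun x => fst (@?f x)) => apply: (@cont_fst _ _ _ f); apply: contP
  | (fun x => snd (@?f x)) => apply: (@cont_snd _ _ _ f); apply: contP
  | (fun x => ?g (@?f x)) => apply: (@cont_comp _ _ _ f g); apply: contP
  | _ => assumption
  end end.
Ltac cts := apply: contP; repeat cts_step; try assumption.

(** * Retractions and crossing paths in the unit disc *)

Section plane.
Context {R : realType}.
Implicit Types p q : R * R.

Definition sqn p : R := p.1 ^+ 2 + p.2 ^+ 2.

Lemma continuous_sqn : continuous sqn.
Proof. rewrite /sqn; under eq_fun do rewrite 2!expr2; cts. Qed.

Lemma sqn_ge0 p : 0 <= sqn p.
Proof. by rewrite addr_ge0// sqr_ge0. Qed.

Lemma sqn_le1 p : sqn p <= 1 -> [/\ -1 <= p.1, p.1 <= 1, -1 <= p.2 & p.2 <= 1].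
Proof.
have H (x y : R) : x ^+ 2 + y ^+ 2 <= 1 -> -1 <= x <= 1.
  move=> xy; rewrite -ler_norml -(@expr_le1 _ 2)// real_normK ?num_real//.
  by apply: le_trans xy; rewrite lerDl sqr_ge0.
by move=> h; have /andP[] := H _ _ h; rewrite /sqn addrC in h; have /andP[] := H _ _ h.
Qed.

Lemma plane_eq p q : p.1 = q.1 -> p.2 = q.2 -> p = q.
Proof. by case: p q => [a b] [c d] /= -> ->. Qed.

(* An extension by the identity to the square makes Poincare-Miranda apply. *)
Lemma disc_no_retraction (F : R * R -> R * R) : continuous F ->
  (forall p, sqn p = 1 -> F p = p) ->
  forall x, sqn x <= 1 -> exists2 p, sqn p <= 1 & F p = x.
Proof.
move=> cF Fid x x1.
pose G p := if sqn p <= 1 then F p else p.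
have Gout p : 1 <= sqn p -> G p = p.
  by rewrite /G => p1; case: ifP => // p1'; apply: Fid; apply/le_anti/andP.
have cG : continuous G.
  apply: (@continuous_paste (R * R)%type (R * R)%type
      (sqn @^-1` [set s | s <= 1]) (sqn @^-1` [set s | 1 <= s]) G F id).
  - exact: (continuous_closedP _).1 continuous_sqn _ (@closed_le _ 1).
  - exact: (continuous_closedP _).1 continuous_sqn _ (@closed_ge _ 1).
  - by move=> p; apply/orP; exact: le_total.
  - exact: cF.
  - exact: cont_id.
  - by move=> p /= p1; rewrite /G p1.
  - by move=> p /= /Gout.
pose e (p : R * R) : R * R := (-1 + p.1 * 2, -1 + p.2 * 2).
have ce : continuous e by rewrite /e; cts.
have cGe : continuous (fun p => G (e p)) by exact: cont_comp.
have [s [t [s01 t01 /= f0 g0]]] : exists s t : R, [/\ 0 <= s <= 1, 0 <= t <= 1,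
    (G (e (s, t))).1 - x.1 = 0 & (G (e (s, t))).2 - x.2 = 0].
  apply: (@poincare_miranda R (fun p => (G (e p)).1 - x.1)
    (fun p => (G (e p)).2 - x.2)); [by cts|by cts| |].
  - move=> t t01; have [? ? ? ?] := sqn_le1 x1; have := sqr_ge0 (-1 + t * 2).
    by move=> ?; rewrite !Gout /e /sqn /=; [apply/andP; split; lra|lra|lra].
  - move=> t t01; have [? ? ? ?] := sqn_le1 x1; have := sqr_ge0 (-1 + t * 2).
    by move=> ?; rewrite !Gout /e /sqn /=; [apply/andP; split; lra|lra|lra].
have Gx : G (e (s, t)) = x by apply: plane_eq; apply/eqP; rewrite -subr_eq0 ?f0 ?g0.
have [e1|e1] := leP (sqn (e (s, t))) 1; first by exists (e (s, t)) => //; rewrite -Gx /G e1.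
by move: (e1); rewrite -(Gout _ (ltW e1)) Gx ltNge x1.
Qed.

(** The projection of the line onto [[0, 1]], in a form whose continuity is immediate. *)
Definition clamp (s : R) : R := (1 + `|s| - `|s - 1|) / 2.

Lemma clampP (s : R) : [\/ s < 0 /\ clamp s = 0, 0 <= s <= 1 /\ clamp s = s |
  1 < s /\ clamp s = 1].
Proof.
rewrite /clamp; have [s0|s0] := ltP s 0.
  by constructor 1; split => //; rewrite !ltr0_norm//; lra.
have [s1|s1] := leP s 1.
  constructor 2; split => //; rewrite ger0_norm// ler0_norm; last by lra.
  by lra.
by constructor 3; split => //; rewrite !ger0_norm//; lra.
Qed.

Lemma continuous_clamp : continuous clamp.
Proof. by rewrite /clamp; cts. Qed.

Lemma clamp_in s : 0 <= clamp s <= 1.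
Proof. by case: (clampP s) => [] [? ->]; lra. Qed.

(** Coordinate differences lie in [[-2, 2]]. The crude bound 8 is the constant used in
    [disc_crossing]. *)
Lemma disc_det_bound (u v w z : R * R) :
  sqn u <= 1 -> sqn v <= 1 -> sqn w <= 1 -> sqn z <= 1 ->
  -8 <= (u.1 - v.1) * (w.2 - z.2) - (u.2 - v.2) * (w.1 - z.1) <= 8.
Proof.
move=> /sqn_le1[? ? ? ?] /sqn_le1[? ? ? ?] /sqn_le1[? ? ? ?] /sqn_le1[? ? ? ?].
have H (x y : R) : -2 <= x <= 2 -> -2 <= y <= 2 -> -4 <= x * y <= 4.
  by move=> xb yb; apply/andP; split; nra.
have /andP[] : -4 <= (u.1 - v.1) * (w.2 - z.2) <= 4 by apply: H; lra.
have /andP[] : -4 <= (u.2 - v.2) * (w.1 - z.1) <= 4 by apply: H; lra.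
lra.
Qed.

(** On a line [sqn] is strictly convex, so it exceeds 1 beyond two points where it equals 1. *)
Lemma sqn_beyond_chord (p q : R * R) (a : R) : sqn p = 1 -> sqn q = 1 ->
  p != q -> 0 < a -> 1 < sqn (q.1 + a * (q.1 - p.1), q.2 + a * (q.2 - p.2)).
Proof.
move=> p1 q1 pq a0.
have N0 : 0 < sqn (q.1 - p.1, q.2 - p.2).
  rewrite lt_neqAle sqn_ge0 andbT; apply: contraNneq pq => /esym/eqP.
  rewrite /sqn /= paddr_eq0 ?sqr_ge0// !sqrf_eq0 !subr_eq0 => /andP[/eqP h1 /eqP h2].
  by apply/eqP/plane_eq.
have -> : sqn (q.1 + a * (q.1 - p.1), q.2 + a * (q.2 - p.2)) =
    sqn q + a * (sqn q - sqn p + (1 + a) * sqn (q.1 - p.1, q.2 - p.2)).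
  by rewrite /sqn /=; ring.
by rewrite p1 q1 subrr add0r ltrDl mulr_gt0// mulr_gt0//; lra.
Qed.

(** The determinant of [p - q1] and [q2 - q1]; its sign tells the sides of the line through [q1] and
    [q2] apart. *)
Definition side (q1 q2 p : R * R) : R :=
  (p.1 - q1.1) * (q2.2 - q1.2) - (p.2 - q1.2) * (q2.1 - q1.1).

Lemma continuous_side q1 q2 : continuous (side q1 q2).
Proof. by rewrite /side; cts. Qed.

(* Prolong both paths by rays parallel to the chords of their endpoints: on the
   boundary of the enlarged parameter square the difference of the prolonged
   paths has the signs required by Poincare-Miranda, and the rays create no
   further intersection. *)
Lemma disc_crossing (g d : R -> R * R) : continuous g -> continuous d ->
  (forall s : R, 0 <= s <= 1 -> sqn (g s) <= 1) ->
  (forall s : R, 0 <= s <= 1 -> sqn (d s) <= 1) ->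
  sqn (g 0) = 1 -> sqn (g 1) = 1 -> sqn (d 0) = 1 -> sqn (d 1) = 1 ->
  0 < side (d 0) (d 1) (g 0) -> side (d 0) (d 1) (g 1) < 0 ->
  exists s t, [/\ 0 <= s <= 1, 0 <= t <= 1 & g s = d t].
Proof.
move=> cg cd gD dD g01 g11 d01 d11 s0 s1.
pose q1 := d 0; pose q2 := d 1; pose p1 := g 0; pose p2 := g 1.
pose Dl := side q1 q2 p2 - side q1 q2 p1.
have Dl0 : Dl < 0 by rewrite /Dl; rewrite -/p1 -/p2 -/q1 -/q2 in s0 s1; lra.
(* With [k * Dl = - 8], a ray followed for one unit of parameter outweighs any determinant bounded
   by [disc_det_bound]; this fixes the signs on the boundary of the parameter square [[-1, 2]^2]. *)
pose k := - 8 / Dl.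
have kD : k * Dl = - 8 by rewrite /k divfK// lt_eqF.
have k0 : 0 < k by nra.
pose e : R * R := (p2.1 - p1.1, p2.2 - p1.2).
pose c : R * R := (q2.1 - q1.1, q2.2 - q1.2).
pose W1 s t := (g (clamp s)).1 + k * (s - clamp s) * e.1
   - (d (clamp t)).1 - k * (t - clamp t) * c.1.
pose W2 s t := (g (clamp s)).2 + k * (s - clamp s) * e.2
   - (d (clamp t)).2 - k * (t - clamp t) * c.2.
(* [(W1, W2)] is the difference of the prolonged paths. Its determinant with [c] is blind to the ray
   of [d], the one with [e] to the ray of [g]; as [c] and [e] are independent, [f = h = 0] forces
   [W1 = W2 = 0]. *)
pose f s t := - (W1 s t * c.2 - W2 s t * c.1).
pose h s t := - (W1 s t * e.2 - W2 s t * e.1).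
have DlE : Dl = e.1 * c.2 - e.2 * c.1 by rewrite /Dl /side /e /c /=; ring.
have cl0 : clamp (-1) = 0 by case: (clampP (-1)) => -[]; lra.
have cl1 : clamp 2 = 1 by case: (clampP 2) => -[]; lra.


have fE s t : f s t = side q1 q2 (d (clamp t)) - side q1 q2 (g (clamp s))
    - k * (s - clamp s) * Dl.
  by rewrite /f /W1 /W2 DlE /side /e /c /=; ring.
pose S2 p := p.1 * e.2 - p.2 * e.1.
have hE s t : h s t = S2 (d (clamp t)) - S2 (g (clamp s)) - k * (t - clamp t) * Dl.
  by rewrite /h /W1 /W2 DlE /S2 /e /c /=; ring.
have s2E t s : S2 t - S2 s = (t.1 - s.1) * (p2.2 - p1.2) - (t.2 - s.2) * (p2.1 - p1.1).
  by rewrite /S2 /e /=; ring.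
have sdE t s : side q1 q2 t - side q1 q2 s = (t.1 - s.1) * (q2.2 - q1.2) - (t.2 - s.2) * (q2.1 - q1.1).
  by rewrite /side; ring.
have gc s : sqn (g (clamp s)) <= 1 by apply: gD; exact: clamp_in.
have dc s : sqn (d (clamp s)) <= 1 by apply: dD; exact: clamp_in.
have [gl gr] : sqn p1 <= 1 /\ sqn p2 <= 1 by rewrite /p1 /p2 g01 g11 lexx.
have [dl dr] : sqn q1 <= 1 /\ sqn q2 <= 1 by rewrite /q1 /q2 d01 d11 lexx.
have cc : continuous clamp := continuous_clamp.
have cW1 : continuous (fun p : R * R => W1 (-1 + 3 * p.1) (-1 + 3 * p.2)).
  by rewrite /W1; cts.
have cW2 : continuous (fun p : R * R => W2 (-1 + 3 * p.1) (-1 + 3 * p.2)).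
  by rewrite /W2; cts.
have cf : continuous (fun p : R * R => f (-1 + 3 * p.1) (-1 + 3 * p.2)).
  apply: contN; apply: contD; last apply: contN; apply: contM => //; exact: cont_cst.
have ch : continuous (fun p : R * R => h (-1 + 3 * p.1) (-1 + 3 * p.2)).
  apply: contN; apply: contD; last apply: contN; apply: contM => //; exact: cont_cst.
have eN : -1 + 3 * 0 = -1 :> R by rewrite mulr0 addr0.
have eP : -1 + 3 * 1 = 2 :> R by rewrite mulr1; lra.
have [|t _|x [y [x01 y01]]] := poincare_miranda cf ch.
- move=> t _ /=; rewrite eN eP !fE cl0 cl1 !sdE -/p1 -/p2.
  have := disc_det_bound (dc (-1 + 3 * t)) gl dr dl.
  have := disc_det_bound (dc (-1 + 3 * t)) gr dr dl.
  by move: kD; clearbody k Dl; lra.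
- rewrite /= eN eP !hE cl0 cl1 !s2E -/q1 -/q2.
  have := disc_det_bound dl (gc (-1 + 3 * t)) gr gl.
  have := disc_det_bound dr (gc (-1 + 3 * t)) gr gl.
  by move: kD; clearbody k Dl; lra.
rewrite /=; set s := -1 + 3 * x; set t := -1 + 3 * y => f0 h0.
have Dln0 : Dl != 0 by rewrite lt_eqF.
have W10 : W1 s t = 0.
  apply: (mulIf Dln0); rewrite mul0r DlE.
  have -> : W1 s t * (e.1 * c.2 - e.2 * c.1) = - e.1 * f s t + c.1 * h s t.
    by rewrite /f /h; ring.
  by rewrite f0 h0; ring.
have W20 : W2 s t = 0.
  apply: (mulIf Dln0); rewrite mul0r DlE.
  have -> : W2 s t * (e.1 * c.2 - e.2 * c.1) = - e.2 * f s t + c.2 * h s t.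
    by rewrite /f /h; ring.
  by rewrite f0 h0; ring.
have p12 : p1 != p2 by apply/eqP => pp; move: Dl0; rewrite /Dl pp subrr ltxx.
have q12 : q1 != q2.
  by apply/eqP => qq; move: Dl0; rewrite DlE /c qq /= !subrr !mulr0 subrr ltxx.
have out (p q w : R * R) a : sqn p = 1 -> sqn q = 1 -> p != q -> 0 < a -> sqn w <= 1 ->
    w = (q.1 + a * (q.1 - p.1), q.2 + a * (q.2 - p.2)) -> False.
  by move=> ? ? ? ? + wE; rewrite wE leNgt sqn_beyond_chord.
have pos a : 0 < a -> 0 < k * a * - Dl.
  by move=> a0; apply: mulr_gt0; [exact: mulr_gt0|rewrite oppr_gt0].
have kpos a : 0 < a -> 0 < k * a by move=> a0; exact: mulr_gt0.
(* Two rays cannot meet because of the sign of [f], and a ray cannot meet a path because it is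
   outside the disc; only the central case is a crossing. *)
have [[u0 cu]|[u01 cu]|[u1 cu]] := clampP s; have [[v0 cv]|[v01 cv]|[v1 cv]] := clampP t.
- exfalso; move: f0; rewrite fE cu cv -/q1 -/p1 {1}/side !subrr !mul0r subrr => E.
  have := pos (0 - s) ltac:(by rewrite subr_gt0).
  by rewrite -/p1 -/q1 -/q2 in s0; lra.
- have E := dD _ v01; exfalso; apply: (@out p2 p1 (d t) (k * (0 - s))) => //.
  + by rewrite eq_sym.
  + by apply: kpos; rewrite subr_gt0.
  + move: W10 W20; rewrite /W1 /W2 cu cv -/p1 /e /= => E1 E2.
    by apply: plane_eq => /=; clear -E1 E2; lra.
- exfalso; move: f0; rewrite fE cu cv -/q2 -/p1 => E.
  have := pos (0 - s) ltac:(by rewrite subr_gt0).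
  have : side q1 q2 q2 = 0 by rewrite /side; ring.
  by rewrite -/p1 -/q1 -/q2 in s0; lra.
- have E := gD _ u01; exfalso; apply: (@out q2 q1 (g s) (k * (0 - t))) => //.
  + by rewrite eq_sym.
  + by apply: kpos; rewrite subr_gt0.
  + move: W10 W20; rewrite /W1 /W2 cu cv -/q1 /c /= => E1 E2.
    by apply: plane_eq => /=; clear -E1 E2; lra.
- exists s, t; split => //; move: W10 W20; rewrite /W1 /W2 cu cv => E1 E2.
  by apply: plane_eq; clear -E1 E2; lra.
- have E := gD _ u01; exfalso; apply: (@out q1 q2 (g s) (k * (t - 1))) => //.
  + by apply: kpos; rewrite subr_gt0.
  + move: W10 W20; rewrite /W1 /W2 cu cv -/q2 /c /= => E1 E2.
    by apply: plane_eq => /=; clear -E1 E2; lra.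
- exfalso; move: f0; rewrite fE cu cv -/q1 -/p2 {1}/side !subrr !mul0r subrr => E.
  have := pos (s - 1) ltac:(by rewrite subr_gt0).
  by rewrite -/p2 -/q1 -/q2 in s1; lra.
- have E := dD _ v01; exfalso; apply: (@out p1 p2 (d t) (k * (s - 1))) => //.
  + by apply: kpos; rewrite subr_gt0.
  + move: W10 W20; rewrite /W1 /W2 cu cv -/p2 /e /= => E1 E2.
    by apply: plane_eq => /=; clear -E1 E2; lra.
- exfalso; move: f0; rewrite fE cu cv -/q2 -/p2 => E.
  have := pos (s - 1) ltac:(by rewrite subr_gt0).
  have : side q1 q2 q2 = 0 by rewrite /side; ring.
  by rewrite -/p2 -/q1 -/q2 in s1; lra.
Qed.

End plane.

(** * Set sizes and arcs in metric spaces *)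

Section weighted_sum.
Context {R : realType}.
Implicit Types u v : nat -> R.

(** The weights add up to 1, so a uniform error of the terms passes unchanged to the sum. *)
Definition weighted_series u : nat -> R :=
  series (fun k => u k / (2 ^ (k + 1))%:R).

Definition weighted_sum u : R := limn (weighted_series u).

Lemma weighted_cvg u : (forall n, 0 <= u n <= 1) ->
  weighted_series u @ \oo --> weighted_sum u.
Proof.
move=> u01; suff : cvgn (weighted_series u) by [].
apply: (@series_le_cvg _ _ (fun k => 1 / (2 ^ (k + 1))%:R)).
- by move=> n; have /andP[? ?] := u01 n; rewrite divr_ge0.
- by move=> n; rewrite divr_ge0.
- by move=> n; have /andP[? ?] := u01 n; rewrite ler_pM2r// invr_gt0 ltr0n expn_gt0.
- by apply/cvg_ex; exists (1 / 2 ^+ 0); exact: cvg_geometric_series_half.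
Qed.

Lemma weighted_sum_le u v e : (forall n, 0 <= u n <= 1) ->
  (forall n, 0 <= v n <= 1) -> (forall n, u n <= v n + e) ->
  weighted_sum u <= weighted_sum v + e.
Proof.
move=> /weighted_cvg cu /weighted_cvg cv uv.
have ce := @cvg_geometric_series_half R e 0.
rewrite expr0 divr1 in ce.
set c := series _ in ce.
have cs : (fun n => weighted_series v n + c n) @ \oo --> weighted_sum v + e.
  exact: cvgD.
have := cvg_lim (@Rhausdorff R) cs; have := cvg_lim (@Rhausdorff R) cu => <- <-.
apply: ler_lim; [by apply/cvg_ex; exists (weighted_sum u)|
  by apply/cvg_ex; exists (weighted_sum v + e)|].
apply: nearW => n; rewrite /c /weighted_series /series /= -big_split /=.
apply: ler_sum => i _; by rewrite -mulrDl ler_pM2r.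
Qed.

Lemma weighted_sum_lt u v : (forall n, 0 <= u n <= 1) ->
  (forall n, 0 <= v n <= 1) -> (forall n, u n <= v n) ->
  (exists n, u n < v n) -> weighted_sum u < weighted_sum v.
Proof.
move=> /weighted_cvg cu /weighted_cvg cv uv [n uvn].
have c0 k : 0 < ((2 ^ (k + 1))%:R : R)^-1 by rewrite invr_gt0 ltr0n expn_gt0.
have cvu : (fun n => weighted_series v n - weighted_series u n) @ \oo -->
    weighted_sum v - weighted_sum u by exact: cvgB.
have sE : (fun n => weighted_series v n - weighted_series u n) =
    weighted_series (fun k => v k - u k).
  apply/funext => m; rewrite /weighted_series /series /= -sumrN -big_split/=.
  by apply: eq_bigr => i _; rewrite mulrBl.
rewrite sE in cvu; rewrite -subr_gt0 -(cvg_lim (@Rhausdorff R) cvu).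
have mono : {homo weighted_series (fun k => v k - u k) : p q / (p <= q)%N >-> p <= q}.
  apply: nondecreasing_series => k _ _.
  by rewrite mulr_ge0// ?subr_ge0// ltW.
have := nondecreasing_cvgn_le mono; move=> /(_ _ n.+1)/wrap[|].
  by apply/cvg_ex; exists (weighted_sum v - weighted_sum u).
apply: lt_le_trans; rewrite /weighted_series /series /= big_nat_recr//= ltr_wpDl//.
  by apply: sumr_ge0 => k _; rewrite mulr_ge0// ?subr_ge0// ltW.
by rewrite mulr_gt0// subr_gt0.
Qed.

End weighted_sum.

Section size_function.
Context {R : realType} {T : metricType R}.
Implicit Types (A B : set T) (p : T) (xs : nat -> T).

Definition near_set (e : R) A : set T := \bigcup_(a in A) ball a e.

(** The truncation at 1 keeps the terms of the weighted sum in [[0, 1]]. *)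
Definition trunc_dist p A : R := inf [set Num.min 1 (mdist p a) | a in A].

Lemma trunc_dist_le p A a : A a -> trunc_dist p A <= Num.min 1 (mdist p a).
Proof.
move=> Aa; apply: ge_inf; last by exists a.
by exists 0 => _ [b _ <-]; rewrite le_min ler01 mdist_ge0.
Qed.

Lemma trunc_dist_ge p A c : A !=set0 ->
  (forall a, A a -> c <= Num.min 1 (mdist p a)) -> c <= trunc_dist p A.
Proof.
move=> [a Aa] cA; apply: lb_le_inf; first by exists (Num.min 1 (mdist p a)), a.
by move=> _ [b Ab <-]; exact: cA.
Qed.

Lemma trunc_dist01 p A : A !=set0 -> 0 <= trunc_dist p A <= 1.
Proof.
move=> A0; rewrite trunc_dist_ge//=; last first.
  by move=> a _; rewrite le_min ler01 mdist_ge0.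
by have [a /trunc_dist_le/le_trans->//] := A0; rewrite ge_min lexx.
Qed.

Lemma trunc_dist_near p A B e : 0 < e -> B !=set0 -> B `<=` near_set e A ->
  trunc_dist p A <= trunc_dist p B + e.
Proof.
move=> e0 B0 BA; rewrite -lerBlDr; apply: trunc_dist_ge => // b Bb.
have [a Aa] := BA b Bb; rewrite ballEmdist /= => ab.
rewrite lerBlDr; apply: le_trans (trunc_dist_le p Aa) _.
have := metric_triangle p b a; rewrite (metric_sym b a) => tri.
rewrite ge_min; have [|] := leP 1 (mdist p b) => pb; apply/orP; [left|right]; lra.
Qed.

Definition dense_seq xs := forall p (e : R), 0 < e -> exists n, ball p e (xs n).

(* A substitute for a Whitney map. *)
Definition set_size xs A : R := weighted_sum (fun n => 1 - trunc_dist (xs n) A).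

Let size_bound xs A n : A !=set0 -> 0 <= 1 - trunc_dist (xs n) A <= 1.
Proof. by move=> /(trunc_dist01 (xs n)); lra. Qed.

Lemma set_size_near xs A B e : 0 < e -> A !=set0 -> B !=set0 ->
  A `<=` near_set e B -> set_size xs A <= set_size xs B + e.
Proof.
move=> e0 A0 B0 AB; apply: weighted_sum_le => n; [exact: size_bound|exact: size_bound|].
by have := trunc_dist_near (xs n) e0 A0 AB; lra.
Qed.

Lemma set_size_le xs A B : A !=set0 -> A `<=` B -> set_size xs A <= set_size xs B.
Proof.
move=> A0 AB; have B0 : B !=set0 by have [a /AB] := A0; exists a.
rewrite -[leRHS]addr0; apply: weighted_sum_le => n; [exact: size_bound|exact: size_bound|].
rewrite addr0 lerB//; apply: trunc_dist_ge => // a /AB; exact: trunc_dist_le.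
Qed.

(** A point of the dense sequence close to some [b] in [B] but not in [A] is strictly nearer to [B]
    than to [A]. The margin [m] is at most 1 to survive the truncation. *)
Lemma set_size_lt xs A B : dense_seq xs -> A !=set0 -> closed A -> A `<=` B ->
  ~ (B `<=` A) -> set_size xs A < set_size xs B.
Proof.
move=> dx A0 clA AB nBA; have B0 : B !=set0 by have [a /AB] := A0; exists a.
apply: weighted_sum_lt => [n|n|n|]; [exact: size_bound|exact: size_bound| |].
  rewrite lerB//; apply: trunc_dist_ge => // a /AB; exact: trunc_dist_le.
have [b Bb nAb] : exists2 b, B b & ~ A b.
  by apply: contrapT => H; apply: nBA => b Bb; apply: contrapT => nb; apply: H; exists b.
have /nbhs_ballP[e /= e0 be] : nbhs b (~` A).
  by apply: open_nbhs_nbhs; split => //; exact: closed_openC.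
pose m := Num.min 1 (e / 2); have m0 : 0 < m by rewrite lt_min ltr01 divr_gt0.
have [m1 me] : m <= 1 /\ m <= e / 2 by rewrite /m !ge_min !lexx orbT.
have [n] := dx b (m / 2) ltac:(lra); rewrite ballEmdist /= => bn.
exists n; rewrite ltrD2l ltrN2.
have h1 : trunc_dist (xs n) B <= m / 2.
  apply: le_trans (trunc_dist_le _ Bb) _; rewrite ge_min metric_sym (ltW bn).
  by rewrite orbT.
suff : m <= trunc_dist (xs n) A by lra.
apply: trunc_dist_ge => // a Aa; rewrite le_min m1 /=.
have : ~ ball b e a by move=> /be.
rewrite ballEmdist /= => /negP; rewrite -leNgt => ea.
have := metric_triangle b (xs n) a; lra.
Qed.

Lemma dense_seq_image (f : R * R -> T) : continuous f ->
  (forall p, exists q, f q = p) -> exists xs, dense_seq xs.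
Proof.
move=> cf fs; pose q n : rat * rat := odflt (0, 0) (unpickle n).
exists (fun n => f (ratr (q n).1, ratr (q n).2)) => p e e0.
have [[a b] fab] := fs p.
have /nbhs_ballP[d /= d0 dab] : nbhs (a, b) (f @^-1` ball p e).
  by apply: cf; rewrite fab; exact: nbhsx_ballx.
have rball (z : R) : exists r : rat, ball z d (ratr r).
  have [r] := @rat_in_itvoo R (z - d) (z + d) ltac:(lra).
  by rewrite in_itv /= => /andP[? ?]; exists r; rewrite /ball/= ltr_norml; lra.
have [r1 h1] := rball a; have [r2 h2] := rball b.
exists (pickle (r1, r2)); rewrite /q pickleK /=; exact: (dab (_, _)).
Qed.

End size_function.

Section closed_real_sets.
Context {R : realType}.

Lemma closed_max (F : set R) (x y : R) : closed F -> F x -> x <= y ->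
  exists m, [/\ F m, m <= y & forall z, F z -> z <= y -> z <= m].
Proof.
move=> clF Fx xy.
have [||| m] := @compact_EVT_max R R id (`[x, y]%classic `&` F).
- by exists x; split => //; rewrite /= in_itv/= lexx.
- by apply: compact_closedI => //; exact: segment_compact.
- by apply: continuous_subspaceT => z; exact: cvg_id.
rewrite inE /= in_itv /= => -[/andP[xm my] Fm] mmax.
exists m; split => // z Fz zy; have [zx|/ltW xz] := leP z x; first exact: le_trans xm.
by apply: mmax; rewrite inE; split => //=; rewrite in_itv /= xz.
Qed.

Lemma closed_min (F : set R) (x y : R) : closed F -> F x -> y <= x ->
  exists m, [/\ F m, y <= m & forall z, F z -> y <= z -> m <= z].
Proof.
move=> clF Fx xy.
have [||| m] := @compact_EVT_min R R id (`[y, x]%classic `&` F).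
- by exists x; split => //; rewrite /= in_itv/= lexx andbT.
- by apply: compact_closedI => //; exact: segment_compact.
- by apply: continuous_subspaceT => z; exact: cvg_id.
rewrite inE /= in_itv /= => -[/andP[xm my] Fm] mmin.
exists m; split => // z Fz zy; have [zx|/ltW xz] := leP z x; last exact: le_trans xz.
by apply: mmin; rewrite inE; split => //=; rewrite in_itv /= zy.
Qed.

End closed_real_sets.

(** * Erasing the loops of a path *)

Section loop_erasure.
Context {R : realType} {T : metricType R} (g : R -> T).
Hypothesis cg : continuous g.

(* Jumping over the complementary intervals of F erases loops of g. *)
Definition loop_gaps (F : set R) := [/\ closed F, F `<=` `[0, 1]%classic, F 0, F 1 &
  forall a b, a < b -> F a -> F b -> (forall c, a < c < b -> ~ F c) -> g a = g b].

Let continuity (x e : R) : 0 < e ->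
  exists2 d : R, 0 < d & forall y, `|x - y| < d -> ball (g x) e (g y).
Proof.
move=> e0; have /nbhs_ballP[d /= d0 db] : nbhs x (g @^-1` ball (g x) e).
  by apply: cg; exact: nbhsx_ballx.
by exists d.
Qed.

(** Complements are used because Zorn's lemma is applied to unions. If [(a, b)] is a gap of the
    intersection, compactness of [[a + d, b - d]] gives one member of the chain without points
    there; that member has a gap with ends [a'] and [b'] near [a] and [b], and [g a' = g b'] yields
    [g a = g b] by continuity. *)
Let loop_gaps_chain (C : set (set R)) : C !=set0 ->
  (forall U, C U -> loop_gaps (`[0, 1]%classic `\` U)) -> total_on C subset ->
  loop_gaps (`[0, 1]%classic `\` \bigcup_(U in C) U).
Proof.
move=> [U0 CU0] CP Ctot.
have FE : `[0, 1]%classic `\` \bigcup_(U in C) U =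
    \bigcap_(U in C) (`[0, 1]%classic `\` U).
  apply/seteqP; split => [x [x01 nx] U CU|x xI]; first by split => // Ux; apply: nx; exists U.
  by split; [have [] := xI _ CU0|move=> [U CU Ux]; have [] := xI _ CU].
rewrite FE; split.
- by apply: closed_bigI => U /CP[].
- by move=> x /(_ _ CU0)[].
- by move=> U /CP[].
- by move=> U /CP[].
move=> a b ab Fa Fb nF; apply: contrapT => gab.
pose e := mdist (g a) (g b) / 2.
have e0 : 0 < e by rewrite divr_gt0// mdist_gt0; apply/eqP.
have [d1 d10 h1] := continuity a e0; have [d2 d20 h2] := continuity b e0.
pose d := Num.min (Num.min (d1 / 2) (d2 / 2)) ((b - a) / 4).
have [d0 dd1 dd2 dd] : [/\ 0 < d, d <= d1 / 2, d <= d2 / 2 & d <= (b - a) / 4].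
  by split; rewrite /d ?lt_min ?ge_min ?lexx ?orbT// !divr_gt0//; lra.
have [U CU FU] : exists2 U, C U & forall c, a + d <= c <= b - d ->
    ~ (`[0, 1]%classic `\` U) c.
  apply: contrapT => nU.
  have [|||x xI] := @directed_compact_bigcap R
      [set (`[a + d, b - d]%classic `&` (`[0, 1]%classic `\` U)) | U in C]
      (@Rhausdorff R).
  - by eexists; exists U0.
  - move=> _ [U CU <-]; split.
      by apply: compact_closedI; [exact: segment_compact|have [] := CP _ CU].
    apply: contrapT => n0; apply: nU; exists U => // c cab Fc; apply: n0.
    by exists c; split => //=; rewrite in_itv.
  - move=> _ _ [U CU <-] [V CV <-]; have [UV|VU] := Ctot _ _ CU CV.
      exists (`[a + d, b - d]%classic `&` (`[0, 1]%classic `\` V)); first by exists V.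
      by move=> x [? [? nV]]; do 2!split => //; split => // /UV.
    exists (`[a + d, b - d]%classic `&` (`[0, 1]%classic `\` U)); first by exists U.
    by move=> x [? [? nV]]; do 2!split => //; split => // /VU.
  have /= [] := xI _ (ex_intro2 _ _ U0 CU0 erefl); rewrite in_itv /= => xab _.
  by apply: (nF x); [lra|move=> U CU; have [] := xI _ (ex_intro2 _ _ U CU erefl)].
have [clU _ _ _ gapU] := CP _ CU.
have [a' [Fa' a'd a'max]] := @closed_max R _ a (a + d) clU (Fa _ CU) ltac:(lra).
have [b' [Fb' b'd b'min]] := @closed_min R _ b (b - d) clU (Fb _ CU) ltac:(lra).
have aa' := a'max _ (Fa _ CU) ltac:(lra).
have bb' := b'min _ (Fb _ CU) ltac:(lra).
have gE : g a' = g b'.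
  apply: gapU => //; first by lra.
  move=> c cab Fc; have [ca|ca] := leP c (a + d); first by have := a'max _ Fc ca; lra.
  have [cb|cb] := leP (b - d) c; first by have := b'min _ Fc cb; lra.
  by apply: (FU c) => //; lra.
have := h1 a' ltac:(rewrite ltr_norml; lra).
have := h2 b' ltac:(rewrite ltr_norml; lra).
rewrite gE !ballEmdist /= => hb ha.
by have := metric_triangle (g a) (g b') (g b); rewrite (metric_sym (g b')) /e in hb ha *; lra.
Qed.

Let loop_gaps_min : exists2 F, loop_gaps F & forall F', loop_gaps F' -> F' `<=` F -> F `<=` F'.
Proof.
have [|U [PU Umax]] := @Zorn_bigcup R [set U | loop_gaps (`[0, 1]%classic `\` U)].
  move=> C CP Ctot /=; have [[U CU]|C0] := pselect (C !=set0).
    by apply: loop_gaps_chain => //; exists U.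
  have -> : \bigcup_(X in C) X = set0.
    by rewrite -subset0 => x [U CU _]; apply: C0; exists U.
  rewrite setD0; split => //.
  - exact: interval_closed.
  - by rewrite /= in_itv /= lexx ler01.
  - by rewrite /= in_itv /= lexx ler01.
  move=> a b ab; rewrite /= !in_itv /= => a01 b01 /(_ ((a + b) / 2)) H.
  by exfalso; apply: H; rewrite ?in_itv /=; lra.
exists (`[0, 1]%classic `\` U) => // F' gF' F'F.
have [_ F'01 _ _ _] := gF'.
have FE : `[0, 1]%classic `\` ~` F' = F'.
  apply/seteqP; split => [x [_ /contrapT]//|x F'x].
  by split; [exact: F'01|exact].
move=> x [x01 nUx]; apply: contrapT => nF'x; apply: (Umax (~` F')); last by rewrite /= FE.
by split; [move=> y Uy /F'F[]|move=> /(_ x nF'x)].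
Qed.

(** Let [k] follow [g] on a minimal [F] and stay constant across its gaps. If [k] repeated a value,
    the part of [F] between the two occurrences could be deleted; by minimality there is none, so
    the fibres of [k] are intervals. *)
Lemma monotone_light_path : exists k : R -> T, [/\ continuous k, k 0 = g 0, k 1 = g 1,
  (forall x, 0 <= x <= 1 -> exists2 y, 0 <= y <= 1 & k x = g y) &
  (forall x y z, 0 <= x -> x <= z -> z <= y -> y <= 1 -> k x = k y -> k z = k x)].
Proof.
have [F [clF F01 F0 F1 gapF] Fmin] := loop_gaps_min.
(* The points of [F] nearest to [x] on either side. The pair [(0, 0)] outside [[0, 1]] is a default,
   never reached since [k] clamps its argument. *)
have /choice[lh lhP] : forall x : R, exists lh : R * R, 0 <= x <= 1 ->
    [/\ F lh.1, F lh.2, lh.1 <= x <= lh.2 & forall z, F z ->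
      (z <= x -> z <= lh.1) /\ (x <= z -> lh.2 <= z)].
  move=> x; have [x01|nx] := pselect (0 <= x <= 1); last by exists (0, 0).
  have /andP[x0 x1] := x01.
  have [l [Fl lx lmax]] := closed_max clF F0 x0.
  have [h [Fh hx hmin]] := closed_min clF F1 x1.
  by exists (l, h) => _; split => //=; [rewrite lx hx|move=> z Fz; split; [exact: lmax|exact: hmin]].
pose lo x := (lh x).1; pose hi x := (lh x).2.
have glh x : 0 <= x <= 1 -> g (lo x) = g (hi x).
  move=> /lhP[Fl Fh /andP[lx xh] lhm].
  have [e|ne] := eqVneq (lo x) (hi x); first by rewrite e.
  apply: gapF => //; first by rewrite lt_neqAle ne (le_trans lx).
  move=> c clh Fc; rewrite -/(lo x) -/(hi x) in lhm.
  have [c1 c2] := lhm _ Fc; have [/c1|/ltW/c2] := leP c x; lra.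
have fixF x : F x -> lo x = x.
  move=> Fx; have /= := F01 _ Fx; rewrite in_itv /= => /lhP[_ _ /andP[lx _] lhm].
  by apply/le_anti; rewrite lx (lhm _ Fx).1.
pose k x := g (lo (clamp x)).
have k01 x : 0 <= x <= 1 -> k x = g (lo x).
  by move=> x01; rewrite /k; case: (clampP x) => [[? _]|[_ ->//]|[? _]]; exfalso; lra.
exists k; split.
- move=> x0; apply/cvg_ballP => e e0.
  pose y0 := clamp x0; have y01 : 0 <= y0 <= 1 := clamp_in x0.
  suff [d d0 dP] : exists2 d, 0 < d & forall y, 0 <= y <= 1 -> `|y0 - y| < d ->
      ball (g (lo y0)) e (g (lo y)).
    have /nbhs_ballP[d' /= d'0 db] : nbhs x0 (clamp @^-1` ball (clamp x0) d).
      by apply: continuous_clamp; exact: nbhsx_ballx.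
    by apply/nbhs_ballP; exists d' => //= x /db /= h; apply: dP => //; exact: clamp_in.
  have [Fy|nFy] := pselect (F y0).
    rewrite (fixF _ Fy); have [d d0 dP] := continuity y0 e0.
    exists d => // y y'01; rewrite ltr_norml => yd.
    have [_ _ /andP[ly hy] lhm] := lhP _ y'01; have [l1 l2] := lhm _ Fy.
    have [yy|/ltW yy] := leP y0 y.
      by apply: dP; rewrite ltr_norml; have := l1 yy; rewrite -/(lo y) in ly *; lra.
    by rewrite (glh _ y'01); apply: dP; rewrite ltr_norml; have := l2 yy; rewrite /hi; lra.
  have [Fl Fh /andP[lx xh] lhm] := lhP _ y01; rewrite -/(lo y0) -/(hi y0) in Fl Fh lx xh lhm.
  have lx' : lo y0 < y0 by rewrite lt_neqAle lx andbT; apply/eqP => E; rewrite E in Fl.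
  have xh' : y0 < hi y0 by rewrite lt_neqAle xh andbT; apply/eqP => E; rewrite -E in Fh.
  exists (Num.min (y0 - lo y0) (hi y0 - y0)); first by rewrite lt_min !subr_gt0 lx'.
  move=> y y'01; rewrite lt_min !ltr_norml => yd.
  suff -> : lo y = lo y0 by apply: ballxx.
  have [Fly _ /andP[ly hy] lhm'] := lhP _ y'01; rewrite -/(lo y) in Fly ly hy lhm'.
  apply/le_anti; rewrite (lhm' _ Fl).1; last by lra.
  have [c1 c2] := lhm _ Fly; have [/c1->//|/ltW/c2] := leP (lo y) y0; lra.
- by rewrite k01 ?fixF// lexx ler01.
- by rewrite k01 ?fixF// lexx ler01.
- move=> x x01; exists (lo x); last exact: k01.
  by have [/F01] := lhP _ x01; rewrite /= in_itv.
move=> x y z x0 xz zy y1; rewrite !k01; [|lra..].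
have [x01 y01 z01] : [/\ 0 <= x <= 1, 0 <= y <= 1 & 0 <= z <= 1] by split; lra.
have [Fx _ /andP[xl xh] xm] := lhP _ x01.
have [Fy _ /andP[yl yh] ym] := lhP _ y01.
have [Fz _ /andP[zl zh] zm] := lhP _ z01.
rewrite -/(lo x) -/(lo y) -/(lo z) in Fx xl xm Fy yl ym Fz zl zm *.
set a := lo x; set b := lo y => gab.
have Fab : F `<=` F `\` [set c | a < c < b].
  apply: Fmin; last by move=> ? [].
  have /= := F01 _ Fx; have /= := F01 _ Fy; rewrite !in_itv /= => b01 a01.
  split.
  - have -> : [set c | a < c < b] = `]a, b[%classic.
      by apply/seteqP; split => c /=; rewrite in_itv.
    by apply: closedI => //; apply: open_closedC; exact: interval_open.
  - by move=> c [/F01].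
  - by split => //=; rewrite /a /b; lra.
  - by split => //=; rewrite /a /b; lra.
  (* A gap of the smaller set is either a gap of [F] or [(a, b)] itself. *)
  move=> c d cd [Fc nc] [Fd nd] ncd.
  have [[f fcd Ff]|nf] := pselect (exists2 f, c < f < d & F f); last first.
    by apply: gapF => // f fcd Ff; apply: nf; exists f.
  have fab : a < f < b.
    by apply: contrapT => nfab; apply: (ncd f fcd); split.
  have Fa' : (F `\` [set c | a < c < b]) a by split => //=; lra.
  have Fb' : (F `\` [set c | a < c < b]) b by split => //=; lra.
  have ac : a <= c by rewrite leNgt; apply/negP => ?; apply: (ncd a) => //; lra.
  have bd : d <= b by rewrite leNgt; apply/negP => ?; apply: (ncd b) => //; lra.
  have ca : c <= a by rewrite leNgt; apply/negP => ?; apply: nc => /=; lra.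
  have db : b <= d by rewrite leNgt; apply/negP => ?; apply: nd => /=; lra.
  by have -> : c = a; [lra|have -> : d = b by lra].
have az : a <= lo z by apply: (zm _ Fx).1; lra.
have zb : lo z <= b by apply: (ym _ Fz).1; lra.
have [_ /= nz] := Fab _ Fz.
have [->//|az'] := eqVneq (lo z) a; have [->//|bz'] := eqVneq (lo z) b.
by exfalso; apply: nz; rewrite !lt_neqAle az zb bz' eq_sym az'.
Qed.

End loop_erasure.

Section arc.
Context {R : realType} {T : metricType R} (xs : nat -> T).
Hypothesis dxs : dense_seq xs.

(* Arcwise connectedness: erase loops, then reparametrize by the size of the
   initial segments of the resulting monotone path. *)
Lemma injective_path (g : R -> T) : continuous g -> g 0 <> g 1 ->
  exists h : R -> T, [/\ continuous h, h 0 = g 0, h 1 = g 1,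
    (forall x, 0 <= x <= 1 -> exists2 y, 0 <= y <= 1 & h x = g y) &
    (forall x y, 0 <= x <= 1 -> 0 <= y <= 1 -> h x = h y -> x = y)].
Proof.
move=> cg g01; have [k [ck k0 k1 kg kmono]] := monotone_light_path cg.
pose S x := k @` `[0, x]%classic.
have S0 x : 0 <= x -> S x !=set0.
  by move=> x0; exists (k 0), 0 => //=; rewrite in_itv /= lexx.
have Sle x y : x <= y -> S x `<=` S y.
  by move=> xy _ [z + <-]; rewrite /= in_itv /= => zx; exists z => //=; rewrite in_itv /=; lra.
have clS x : closed (S x).
  apply: compact_closed; first exact: metric_hausdorff.
  by apply: continuous_image_compact => //; exact: segment_compact.
pose c x := set_size xs (S x).
have cle x y : 0 <= x -> x <= y -> c x <= c y.
  by move=> x0 xy; apply: set_size_le; [exact: S0|exact: Sle].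
have clt x y : 0 <= x -> x <= y -> y <= 1 -> k x <> k y -> c x < c y.
  move=> x0 xy y1 kxy; apply: set_size_lt => //; [exact: S0|exact: Sle|].
  move=> /(_ (k y))[|z]; first by exists y => //=; rewrite in_itv /=; lra.
  rewrite /= in_itv /= => z01 kzy; apply: kxy.
  by rewrite -kzy; apply: (kmono z y x) => //; lra.
have ceq x y : 0 <= x -> x <= y -> y <= 1 -> k x = k y -> c x = c y.
  move=> x0 xy y1 kxy; congr set_size; apply/seteqP; split; first exact: Sle.
  move=> _ [z + <-]; rewrite /= in_itv /= => z01.
  have [zx|/ltW xz] := leP z x; first by exists z => //=; rewrite in_itv /=; lra.
  by exists x; [rewrite /= in_itv /=; lra|rewrite (kmono x y z)//; lra].
have cc : continuous (fun x => c (clamp x)).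
  move=> x0; apply/cvg_ballP => e e0.
  pose y0 := clamp x0; have y01 : 0 <= y0 <= 1 := clamp_in x0.
  have /nbhs_ballP[d /= d0 dk] : nbhs y0 (k @^-1` ball (k y0) (e / 4)).
    by apply: ck; apply: nbhsx_ballx; rewrite divr_gt0.
  have /nbhs_ballP[d' /= d'0 dc] : nbhs x0 (clamp @^-1` ball y0 d).
    by apply: continuous_clamp; exact: nbhsx_ballx.
  apply/nbhs_ballP; exists d' => //= x /dc /=; have := clamp_in x.
  rewrite -/y0; move: (clamp x) => y y'01 yd.
  have near (u v : R) : 0 <= u -> 0 <= v -> ball y0 d u -> ball y0 d v ->
      c u <= c v + e / 2.
    move=> u0 v0 ud vd; apply: set_size_near; [lra|exact: S0|exact: S0|].
    move=> _ [z + <-]; rewrite /= in_itv /= => zu.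
    have [zv|vz] := leP z v.
      by exists (k z); [exists z => //=; rewrite in_itv /=; lra|apply: ballxx; lra].
    exists (k v); first by exists v => //=; rewrite in_itv /=; lra.
    have zd : ball y0 d z by move: ud vd; rewrite /ball /= !ltr_norml; lra.
    have -> : e / 2 = e / 4 + e / 4 by lra.
    by apply: ball_triangle (dk _ zd); apply/ball_sym; exact: dk.
  have h1 := near y y0 ltac:(lra) ltac:(lra) yd (ballxx _ d0).
  have h2 := near y0 y ltac:(lra) ltac:(lra) (ballxx _ d0) yd.
  by rewrite /ball /= ltr_norml; lra.
have c01 : c 0 < c 1 by apply: clt => //; rewrite k0 k1.
pose D := c 1 - c 0; have D0 : 0 < D by rewrite /D; lra.
have in01 (x : R) : 0 <= x <= 1 -> clamp x = x.
  by case: (clampP x) => [[? _]|[_ ->//]|[? _]]; lra.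
have surj u : 0 <= u <= 1 -> exists2 x, 0 <= x <= 1 & c x = c 0 + u * D.
  move=> u01; have [|||x] := @IVT R (fun x => c (clamp x)) 0 1 (c 0 + u * D).
  - exact: ler01.
  - exact: continuous_subspaceT.
  - rewrite !in01 ?lexx ?ler01//.
    by rewrite (min_idPl (ltW c01)) (max_idPr (ltW c01)) /D; nra.
  by rewrite in_itv /= => x01; rewrite in01// => cx; exists x.
(* [f u] is any parameter at which the size has grown by the proportion [u]; [k (f u)] does not
   depend on the choice, because [c] is constant only where [k] is. *)
have /choice[f fP] : forall u : R, exists x, 0 <= x <= 1 /\ c x = c 0 + clamp u * D.
  by move=> u; have [x] := surj _ (clamp_in u); exists x.
have kf x u : 0 <= x <= 1 -> c x = c 0 + clamp u * D -> k (f u) = k x.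
  move=> x01 cx; have [f01 cf] := fP u.
  have E : c x = c (f u) by rewrite cx cf.
  have [/andP[x0 x1] /andP[f0 f1]] := (x01, f01).
  apply: contrapT => nk; have [xf|/ltW fx] := leP x (f u).
    by have := clt _ _ x0 xf f1 (nesym nk); rewrite E ltxx.
  by have := clt _ _ f0 fx x1 nk; rewrite E ltxx.
exists (fun u => k (f u)); split.
- apply: (@continuous_factor R R T R `[0, 1]%classic (fun x => c (clamp x)) k
    (fun u => c 0 + clamp u * D)) => //.
  + exact: segment_compact.
  + by have cl := @continuous_clamp R; cts.
  + move=> u; have [x x01 cx] := surj _ (clamp_in u).
    by exists x; rewrite /= ?in_itv //= in01.
  + by move=> x u; rewrite /= in_itv /= => x01; rewrite in01//; exact: kf.
- by rewrite -k0; apply: kf; rewrite ?in01 ?lexx ?ler01// mul0r addr0.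
- by rewrite -k1; apply: kf; rewrite ?in01 ?lexx ?ler01// mul1r /D; lra.
- by move=> u _; apply: kg; have [] := fP u.
- move=> u v u01 v01 kuv; have [fu cu] := fP u; have [fv cv] := fP v.
  rewrite !in01// in cu cv.
  suff : c (f u) = c (f v).
    rewrite cu cv => /addrI E; apply: (mulIf _ E); exact: lt0r_neq0.
  have [/andP[u0 u1] /andP[v0 v1]] := (fu, fv).
  have [uv|/ltW vu] := leP (f u) (f v); first exact: ceq.
  by apply/esym; exact: ceq.
Qed.

End arc.

Section arcs_without_circles.
Context {R : realType} {T : metricType R} (xs : nat -> T).
Hypothesis dxs : dense_seq xs.
Hypothesis no_circle : forall f : unit_circle R -> T,
  continuous f -> injective f -> False.

(** Make a path avoiding [h t] injective, and let [c] and [d] be the last parameter before [t] and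
    the first one after [t] at which [h] meets it. The part of [h] from [c] to [d] and the part of
    the path between the same points share only their ends and form a simple closed curve. *)
Lemma arc_separates (h : R -> T) (t : R) : continuous h ->
  (forall x y, 0 <= x <= 1 -> 0 <= y <= 1 -> h x = h y -> x = y) ->
  0 < t < 1 -> ~ joined (R := R) [set p | p <> h t] (h 0) (h 1).
Proof.
move=> ch hinj t01 [g0 [cg0 g00 g01 g0t]].
have h01 : h 0 <> h 1 by move=> /hinj; lra.
have [g [cg]] : exists g : R -> T, [/\ continuous g, g 0 = g0 0, g 1 = g0 1,
    (forall x, 0 <= x <= 1 -> exists2 y, 0 <= y <= 1 & g x = g0 y) &
    (forall x y, 0 <= x <= 1 -> 0 <= y <= 1 -> g x = g y -> x = y)].
  by apply: (injective_path dxs) => //; rewrite g00 g01.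
rewrite g00 g01 => gh0 gh1 gimg ginj.
pose I := h @^-1` (g @` `[0, 1]%classic).
have clI : closed I.
  apply: (continuous_closedP _).1 ch _ _; apply: compact_closed; first exact: metric_hausdorff.
  by apply: continuous_image_compact => //; exact: segment_compact.
have I0 : I 0 by exists 0; rewrite //= in_itv /= lexx ler01.
have I1 : I 1 by exists 1; rewrite //= in_itv /= lexx ler01.
have nIt : ~ I t.
  by move=> [s]; rewrite /= in_itv /= => /gimg[y /g0t + ->]; exact.
have [c [Ic ct cmax]] := @closed_max _ I 0 t clI I0 ltac:(lra).
have [d [Id td dmin]] := @closed_min _ I 1 t clI I1 ltac:(lra).
have c0 : 0 <= c by apply: cmax => //; lra.
have d1 : d <= 1 by apply: dmin => //; lra.
have ct' : c < t by rewrite lt_neqAle ct andbT; apply/eqP => E; rewrite E in Ic.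
have td' : t < d by rewrite lt_neqAle td andbT; apply/eqP => E; rewrite -E in Id.
have gap s : I s -> c <= s <= d -> s = c \/ s = d.
  move=> Is /andP[cs sd]; have [st|/ltW ts] := leP s t.
    by left; apply/le_anti; rewrite cs (cmax _ Is st).
  by right; apply/le_anti; rewrite sd (dmin _ Is ts).
have [u] := Ic; have [v] := Id; rewrite /= !in_itv /= => v01 gv u01 gu.
have uv : u <> v by move=> E; move: gu; rewrite E gv => /hinj; lra.
clear I0 I1 nIt cmax dmin clI ct td g0t gimg cg0 g00 g01 h01 g0 Ic Id gh0 gh1.
(* [A] maps each half circle onto [[0, 1]]. The upper half runs through [h] from [c] to [d], the
   lower half through [g] from [u] to [v], where [v < u] is allowed. *)
pose A (p : unit_circle R) : R := ((set_val p).1 + 1) / 2.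
have pE (p : unit_circle R) : (set_val p).1 ^+ 2 + (set_val p).2 ^+ 2 = 1.
  by have := set_valP p.
have Ab p : 0 <= A p <= 1.
  have [|? ? _ _] := @sqn_le1 R (set_val p); first by rewrite /sqn pE.
  by rewrite /A; apply/andP; split; lra.
have cval : continuous (fun p : unit_circle R => set_val p : R * R).
  exact: initial_continuous.
pose e p := c + (d - c) * A p; pose z p := u + (v - u) * A p.
have eb p : c <= e p <= d by have := Ab p; rewrite /e; nra.
have zb p : 0 <= z p <= 1 by have := Ab p; rewrite /z; nra.
pose f p := if 0 <= (set_val p).2 then h (e p) else g (z p).
have A01 p : A p = 0 \/ A p = 1 -> (set_val p).2 = 0.
  move=> Ap; apply/eqP; rewrite -sqrf_eq0; apply/eqP; have := pE p.
  have -> : (set_val p).1 ^+ 2 = 1.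
    by apply/eqP; rewrite sqrf_eq1; move: Ap; rewrite /A => -[E|E]; apply/orP;
      [right|left]; apply/eqP; lra.
  lra.
have A01' p : (set_val p).2 = 0 -> A p = 0 \/ A p = 1.
  move=> E; have := pE p; rewrite E expr0n /= addr0 => /eqP.
  by rewrite sqrf_eq1 /A => /orP[]/eqP->; [right|left]; lra.
have AE p q : A p = A q -> 0 <= (set_val p).2 * (set_val q).2 -> p = q.
  move=> Apq pq0; have E1 : (set_val p).1 = (set_val q).1 by move: Apq; rewrite /A; lra.
  have : (set_val p).2 ^+ 2 = (set_val q).2 ^+ 2.
    by have := pE p; have := pE q; rewrite E1; lra.
  move=> /eqP; rewrite eqf_sqr => E2; apply: val_inj; apply: plane_eq => //.
  move: E2 => /orP[]/eqP// E2; move: pq0; rewrite E2 mulNr oppr_ge0 => q0.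
  have : (set_val q).2 = 0.
    by apply/eqP; rewrite -sqrf_eq0; apply/eqP/le_anti; rewrite sqr_ge0 expr2 q0.
  by move=> ->; rewrite oppr0.
have fE p : (set_val p).2 <= 0 -> f p = g (z p).
  move=> p0; rewrite /f; case: ifP => // p0'.
  have : (set_val p).2 = 0 by apply/le_anti; rewrite p0.
  by move=> /A01'[] Ap; rewrite /e /z Ap ?mulr0 ?addr0 ?gu// !mulr1 !subrKC gv.
apply: (no_circle (f := f)).
- apply: (@continuous_paste _ _ [set p : unit_circle R | 0 <= (set_val p).2]
    [set p : unit_circle R | (set_val p).2 <= 0] f (fun p => h (e p)) (fun p => g (z p))).
  + exact: ((continuous_closedP _).1 (cont_snd cval) _ (@closed_ge _ 0)).
  + exact: ((continuous_closedP _).1 (cont_snd cval) _ (@closed_le _ 0)).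
  + by move=> p; apply/orP; exact: le_total.
  + by rewrite /e /A; cts.
  + by rewrite /z /A; cts.
  + by move=> p; rewrite /f => ->.
  + exact: fE.
have mixed p q : 0 <= (set_val p).2 -> (set_val q).2 < 0 -> h (e p) = g (z q) -> False.
  move=> p0 q0 E; have Ie : I (e p).
    by exists (z q); rewrite ?E //= in_itv; exact: zb.
  have nq : ~ (A q = 0 \/ A q = 1) by move=> /A01 q0'; rewrite q0' ltxx in q0.
  have [ec|ed] := gap _ Ie (eb p); apply: nq; [left|right].
    have /(ginj _ _ u01 (zb q)) : g u = g (z q) by rewrite gu -ec E.
    rewrite /z => /eqP; rewrite -subr_eq0 opprD addrA subrr add0r oppr_eq0 mulf_eq0.
    by rewrite subr_eq0 => /orP[/eqP/esym//|/eqP].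
  have /(ginj _ _ v01 (zb q)) : g v = g (z q) by rewrite gv -ed E.
  rewrite /z => E'; have : (v - u) * (1 - A q) = 0.
    by rewrite mulrBr mulr1 {1}E' [u + _]addrC addrK subrr.
  by move=> /eqP; rewrite mulf_eq0 subr_eq0 => /orP[/eqP/esym//|]; rewrite subr_eq0 => /eqP.
move=> p q; rewrite /f.
have [p0|p0] := leP 0 (set_val p).2; have [q0|q0] := leP 0 (set_val q).2.
- have [/andP[c1 d1'] /andP[c2 d2]] := (eb p, eb q).
  move=> /hinj E; apply: AE; last exact: mulr_ge0.
  have : e p = e q by apply: E; lra.
  by move=> /addrI/mulfI; apply; rewrite subr_eq0; apply/eqP; lra.
- by move=> /mixed; case.
- by move=> /esym/mixed; case.
- move=> /(ginj _ _ (zb p) (zb q))/addrI/mulfI E; apply: AE.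
    by apply: E; rewrite subr_eq0; apply/eqP/nesym.
  by rewrite -mulrNN mulr_ge0// oppr_ge0 ltW.
Qed.

End arcs_without_circles.

(** * Minimal subcontinua of plaques *)

Section hausdorff_metric.
Context {R : realType} {D : metricType R}.
Hypothesis cD : compact [set: D].

Lemma compact_metric_bounded (x : D) : exists M : R, forall y, mdist x y < M.
Proof.
have := (compact_near_coveringP [set: D]).1 cD nat \oo (fun n y => mdist x y < n%:R) _.
case.
  move=> y _; have [N yN] : exists N : nat, mdist x y + 1 < N%:R.
    exists (Num.bound (mdist x y + 1)); apply: archi_boundP.
    by rewrite addr_ge0 ?mdist_ge0.
  exists (ball y 1, [set n | (N <= n)%N]).
    by split; [exact: nbhsx_ballx|exists N].
  move=> [z n] [yz Nn]; move: yz; rewrite ballEmdist /= => yz; rewrite /= in Nn.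
  have := metric_triangle x y z; have : N%:R <= n%:R :> R by rewrite ler_nat.
  lra.
move=> N _ /(_ N (leqnn N)) HN; exists N%:R => y; exact: HN.
Qed.

(** The infimum in [hausdorff_dist] gives information only if its set is non-empty, which
    boundedness of the compact space ensures. *)
Lemma hausdorff_cvg_near (A_ : nat -> set D) (A : set D) (e : R) :
  (forall n, A_ n !=set0) -> A !=set0 -> hausdorff_cvg A_ A -> 0 < e ->
  exists N, forall n, (N <= n)%N -> A_ n `<=` near_set e A /\ A `<=` near_set e (A_ n).
Proof.
move=> An0 A0 /cvgr0_norm_lt H e0; have [N _ NP] := H _ e0.
exists N => n /NP /=; rewrite /hausdorff_dist; set S := [set _ | _] => nS.
have [e' [e'0 h1 h2] e'e] : exists2 e', S e' & e' < e.
  apply: inf_lt; last by apply: le_lt_trans nS; exact: ler_norm.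
  have [x _] := A0; have [M MP] := compact_metric_bounded x.
  have xM : 0 < M by apply: le_lt_trans (MP x); exact: mdist_ge0.
  have bnd (y z : D) : ball y (M + M) z.
    rewrite ballEmdist /=; have := metric_triangle y x z; rewrite (metric_sym y x).
    by have := MP y; have := MP z; lra.
  exists (M + M); split; first by rewrite addr_gt0.
    by move=> y _; have [z Az] := A0; exists z.
  by move=> y _; have [z Az] := An0 n; exists z.
have le_near B : near_set e' B `<=` near_set e B.
  by move=> y [b Bb /(le_ball (ltW e'e)) by']; exists b.
by split; [move=> y /h1 /le_near|move=> y /h2 /le_near].
Qed.

End hausdorff_metric.

Section minimal_continua.
Context {R : realType} {D : metricType R} (Q : D -> set D).
Hypothesis cD : compact [set: D].
Hypothesis decQ : decomposition Q.
Hypothesis contQ : continuous_decomposition Q.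
Hypothesis smoothQ : C_smooth Q.

Lemma plaque_refl x : Q x x.
Proof. by have [_ h _ _] := decQ; exact: h. Qed.

Lemma plaque_eq x y : Q x y -> Q x = Q y.
Proof.
have [_ r h _] := decQ; move=> Qxy; have [//|Q0] := h x y.
have : (Q x `&` Q y) y by split => //; exact: r.
by rewrite Q0.
Qed.

Lemma plaque_compact x : compact (Q x).
Proof. by have [h _ _ _] := decQ; have [_ []] := h x. Qed.

Lemma plaque_connected x : connected (Q x).
Proof. by have [h _ _ _] := decQ; have [_ []] := h x. Qed.

Lemma plaque_sym x y : Q x y -> Q y x.
Proof. by move=> /plaque_eq <-; exact: plaque_refl. Qed.

Let hD : hausdorff_space D := @metric_hausdorff _ D.

Definition continua_through (x y : D) : set (set D) :=
  [set L | [/\ compact L, connected L, L `<=` Q x, L x & L y]].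

Definition min_continuum (x y : D) : set D :=
  \bigcap_(L in continua_through x y) L.

(** Two continua through [x] have a connected union, so hereditary unicoherence makes their
    intersection connected: the family is directed, and its intersection is a continuum. *)
Lemma min_continuumP x y : Q x y -> continua_through x y (min_continuum x y).
Proof.
move=> Qxy; have Qthru : continua_through x y (Q x).
  by split => //; [exact: plaque_compact|exact: plaque_connected|exact: plaque_refl].
have [] := @directed_connected_bigcap R D (continua_through x y).
- by exists (Q x).
- by move=> L [].
- move=> A B [cA kA AQ Ax Ay] [cB kB BQ Bx By]; exists (A `&` B) => //; split => //.
  + by apply: compact_closedI => //; exact: compact_closed.
  + have [her _] := smoothQ; apply: (her x (A `|` B)) => //.
    * by split; [exact: compactU|apply: connectedU => //; exists x].
    * by move=> z [/AQ|/BQ].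
  + by move=> z [/AQ].
- move=> cm km; split => //.
  + by move=> z /(_ _ Qthru).
  + by move=> L [].
  + by move=> L [].
Qed.

Lemma min_continuum_least x y L : compact L -> connected L -> L `<=` Q x ->
  L x -> L y -> min_continuum x y `<=` L.
Proof. by move=> ? ? ? ? ? z; apply. Qed.

Lemma min_continuum_sub x y : Q x y -> min_continuum x y `<=` Q x.
Proof. by move=> /min_continuumP[]. Qed.

Lemma min_continuum_in x y z : Q x y -> min_continuum x y z -> Q x z.
Proof. by move=> /min_continuum_sub; exact. Qed.

Lemma min_continuum_closed x y : Q x y -> closed (min_continuum x y).
Proof. by move=> /min_continuumP[/(compact_closed hD)]. Qed.

Lemma min_continuum_neq0 x y : Q x y -> min_continuum x y !=set0.
Proof. by move=> /min_continuumP[_ _ _ ? _]; exists x. Qed.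

Lemma min_continuum_l x y : Q x y -> min_continuum x y x.
Proof. by move=> /min_continuumP[]. Qed.

Lemma min_continuum_r x y : Q x y -> min_continuum x y y.
Proof. by move=> /min_continuumP[]. Qed.

Lemma min_continuum_sym x y : Q x y -> min_continuum x y = min_continuum y x.
Proof.
move=> Qxy; rewrite /min_continuum /continua_through (plaque_eq Qxy).
by congr bigcap; apply/seteqP; split => L [].
Qed.

Lemma min_continuum_mono x y z : Q x y -> min_continuum x y z ->
  min_continuum x z `<=` min_continuum x y.
Proof.
by move=> Qxy mz; have [? ? ? ? ?] := min_continuumP Qxy; apply: min_continuum_least.
Qed.

Lemma min_continuum_join x y z : Q x y -> Q y z ->
  min_continuum x z `<=` min_continuum x y `|` min_continuum y z.
Proof.
move=> Qxy Qyz; have [? ? ? ? ?] := min_continuumP Qxy.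
have [? ? + ? ?] := min_continuumP Qyz; rewrite -(plaque_eq Qxy) => ?.
apply: min_continuum_least.
- exact: compactU.
- by apply: connectedU => //; exists y.
- by rewrite subUset; split.
- by left.
- by right.
Qed.

Lemma min_continuum_refl x : min_continuum x x = [set x].
Proof.
have Qxx := plaque_refl x; apply/seteqP; split.
  by apply: min_continuum_least => //; [exact: compact_set1|exact: connected1|move=> _ ->].
by move=> _ ->; exact: min_continuum_l.
Qed.

Lemma min_continuum_minimal x y : Q x y ->
  minimal_subcontinuum (Q x) x y (min_continuum x y).
Proof.
move=> Qxy; have [? ? ? ? ?] := min_continuumP Qxy; split => //.
move=> L [? ?] Lm Lx Ly; apply/seteqP; split => //.
by apply: min_continuum_least => //; exact: subset_trans Lm _.
Qed.

Let invn (n : nat) : 0 < n.+1%:R^-1 :> R. Proof. by rewrite invr_gt0. Qed.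

Let cvg_invn (x : D) (x_ : nat -> D) :
  (forall n, ball x n.+1%:R^-1 (x_ n)) -> x_ @ \oo --> x.
Proof.
move=> h; apply/cvg_ballP => e e0; have := near_infty_natSinv_lt (PosNum e0).
by apply: filterS => n ne; exact: le_ball (ltW ne) _ (h n).
Qed.

(** Smoothness in epsilon-delta form: failures at every [1 / (n + 1)] would give sequences violating
    it. *)
Lemma min_continuum_near x y (e : R) : Q x y -> 0 < e -> exists2 d : R, 0 < d &
  forall x' y', Q x' y' -> ball x d x' -> ball y d y' ->
  min_continuum x' y' `<=` near_set e (min_continuum x y) /\
  min_continuum x y `<=` near_set e (min_continuum x' y').
Proof.
move=> Qxy e0; apply: contrapT => H.
have /choice[f fP] : forall n : nat, exists p : D * D, [/\ Q p.1 p.2,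
    ball x n.+1%:R^-1 p.1, ball y n.+1%:R^-1 p.2 &
    ~ (min_continuum p.1 p.2 `<=` near_set e (min_continuum x y) /\
       min_continuum x y `<=` near_set e (min_continuum p.1 p.2))].
  move=> n; apply: contrapT => nH; apply: H; exists n.+1%:R^-1; first exact: invn.
  by move=> x' y' Qxy' bx by'; apply: contrapT => nh; apply: nH; exists (x', y').
have [_ smooth] := smoothQ.
have := smooth (fst \o f) (snd \o f) x y (fun n => min_continuum (f n).1 (f n).2)
  (min_continuum x y).
have fx : (fst \o f) @ \oo --> x by apply: cvg_invn => n; have [] := fP n.
have fy : (snd \o f) @ \oo --> y by apply: cvg_invn => n; have [] := fP n.
have fQ n : Q (f n).1 (f n).2 by have [] := fP n.
move=> /(_ fQ Qxy (fun n => min_continuum_minimal (fQ n)) (min_continuum_minimal Qxy) fx fy).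
have fm0 n := min_continuum_neq0 (fQ n); have m0 := min_continuum_neq0 Qxy.
move=> /(hausdorff_cvg_near cD fm0 m0)/(_ e0)[N /(_ N (leqnn N))].
by have [_ _ _] := fP N.
Qed.

Lemma plaque_near x (e : R) : 0 < e -> exists2 d : R, 0 < d &
  forall x', ball x d x' -> Q x' `<=` near_set e (Q x) /\ Q x `<=` near_set e (Q x').
Proof.
move=> e0; apply: contrapT => H.
have /choice[f fP] : forall n : nat, exists p : D, ball x n.+1%:R^-1 p /\
    ~ (Q p `<=` near_set e (Q x) /\ Q x `<=` near_set e (Q p)).
  move=> n; apply: contrapT => nH; apply: H; exists n.+1%:R^-1; first exact: invn.
  by move=> x' bx; apply: contrapT => nh; apply: nH; exists x'.
have fx : f @ \oo --> x by apply: cvg_invn => n; have [] := fP n.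
have Q0 z : Q z !=set0 by exists z; exact: plaque_refl.
have [N /(_ N (leqnn N))] := hausdorff_cvg_near cD (fun n => Q0 (f n)) (Q0 x) (contQ fx) e0.
by have [] := fP N.
Qed.

(** Smoothness leaves a minimal continuum [J] from [p] to [x] only one far end. The part [O] of [J]
    reached before [x] is connected, open in [J], and closed up to the point [x]; so its closure
    contains [x] and is all of [J]. A second far end [y] would lie outside [O] and differ from
    [x]. *)
Lemma min_continuum_cancel p x y : Q p x -> Q p y ->
  min_continuum p x = min_continuum p y -> x = y.
Proof.
move=> Qpx Qpy mE; apply: contrapT => xy.
have px : p <> x.
  move=> E; move: (min_continuum_r Qpy); rewrite -mE -E min_continuum_refl => yp.
  by apply: xy; rewrite -E.
pose J := min_continuum p x; pose O := [set z | J z /\ ~ min_continuum p z x].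
have [cJ kJ JQ Jp Jx] := min_continuumP Qpx.
have clJ := min_continuum_closed Qpx.
have Op : O p by split => //; rewrite min_continuum_refl => E; exact/px/esym.
have nOy : ~ O y by move=> []; rewrite -mE.
have kO : connected O.
  have -> : O = \bigcup_(z in O) min_continuum p z.
    apply/seteqP; split => z.
      by move=> Oz; exists z => //; apply: min_continuum_r; apply: JQ; case: Oz.
    move=> [w [Jw nw] mz]; have Qpw := JQ _ Jw; split.
      exact: min_continuum_mono Jw _ mz.
    by move=> /(min_continuum_mono Qpw mz).
  apply: bigcup_connected; last by move=> z [/JQ/min_continuumP[]].
  by exists p => z [/JQ/min_continuum_l].
(* For [w] in [O] near [z], the continuum from [w] to [z] is close to the point [z] and misses [x];
   so adding it to the continuum from [p] to [w] does not reach [x]. *)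
have clO z : closure O z -> z <> x -> O z.
  move=> Oz zx; have Jz : J z by apply: clJ; apply: closureS Oz => w [].
  split => // mzx; have Qpz := JQ _ Jz.
  have zx0 : 0 < mdist z x by rewrite mdist_gt0; apply/eqP.
  have [d d0 dP] := min_continuum_near (plaque_refl z) zx0.
  have [w [[Jw nw] zw]] := Oz _ (nbhsx_ballx z d d0).
  have Qpw := JQ _ Jw; have Qwz : Q w z by rewrite -(plaque_eq Qpw).
  have [+ _] := dP w z Qwz zw (ballxx _ d0); rewrite min_continuum_refl => near.
  have [//|/near] := min_continuum_join Qpw Qwz mzx.
  by move=> [_ -> ]; rewrite ballEmdist /= ltxx.
have opO z : O z -> closure (J `\` O) z -> False.
  move=> [Jz nz] JOz; have Qpz := JQ _ Jz.
  have /nbhs_ballP[e /= e0 ne] : nbhs x (~` min_continuum p z).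
    by apply: open_nbhs_nbhs; split => //; apply: closed_openC; exact: min_continuum_closed.
  have [d d0 dP] := min_continuum_near Qpz e0.
  have [w [[Jw nOw] zw]] := JOz _ (nbhsx_ballx z d d0).
  have [near _] := dP p w (JQ _ Jw) (ballxx _ d0) zw.
  by apply: nOw; split => // /near[v mv /ball_sym/ne]; exact.
have xO : closure O x.
  apply: contrapT => nx.
  have clO' z : closure O z -> O z.
    by move=> Oz; apply: clO => // E; apply: nx; rewrite -E.
  apply: nx; apply: (@connected_closed_disjoint _ J (closure O) (closure (J `\` O))) => //.
  - exact: closed_closure.
  - exact: closed_closure.
  - by move=> z Jz; have [?|?] := pselect (O z); [left|right]; exact: subset_closure.
  - by move=> z _ /clO'/opO.
  - by exists p; split => //; exact: subset_closure.
have : min_continuum p x `<=` closure O.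
  apply: min_continuum_least.
  - apply: (subclosed_compact _ cJ); first exact: closed_closure.
    by move=> z Oz; apply: clJ; apply: closureS Oz => w [].
  - exact: connected_closure.
  - by move=> z Oz; apply: JQ; apply: clJ; apply: closureS Oz => w [].
  - exact: subset_closure.
  - exact: xO.
have Jy : J y by rewrite /J mE; exact: min_continuum_r.
by move=> /(_ y Jy)/clO/(_ (nesym xy)).
Qed.

(** [e'] lies between [e1] and [e] or between [e] and [e2]. That part then contains the continuum
    from [e] to [e'], which is everything, and cancellation makes [e] an end. *)
Lemma min_continuum_end e1 e2 e e' : Q e1 e2 -> Q e1 e -> Q e1 e' ->
  min_continuum e1 e2 = min_continuum e e' -> e = e1 \/ e = e2.
Proof.
move=> Q12 Q1 Q1' mE; have Qe : Q e e' by rewrite -(plaque_eq Q1).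
have Qe2 : Q e e2 by rewrite -(plaque_eq Q1).
have me : min_continuum e1 e2 e by rewrite mE; exact: min_continuum_l.
have me' : min_continuum e1 e2 e' by rewrite mE; exact: min_continuum_r.
have [h|h] := min_continuum_join Q1 Qe2 me'.
  right; apply: (min_continuum_cancel Q1 Q12); apply/seteqP; split.
    exact: min_continuum_mono.
  rewrite mE (min_continuum_sym Q1); apply: min_continuum_mono.
    exact: plaque_sym.
  by rewrite -(min_continuum_sym Q1).
left; have Q21 := plaque_sym Q12; have Q2 := plaque_sym Qe2.
apply: (min_continuum_cancel Q2 Q21); apply/seteqP; split.
  by apply: min_continuum_mono => //; rewrite -(min_continuum_sym Q12).
rewrite -(min_continuum_sym Q12) mE -(min_continuum_sym Qe2).
exact: min_continuum_mono.
Qed.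

(** If neither initial part contained the other, [x] and [y] would each lie between the other one
    and [e2], and cancellation from [e2] would identify them. This is the linear order of an arc. *)
Lemma min_continuum_nested e1 e2 x y : Q e1 e2 -> min_continuum e1 e2 x ->
  min_continuum e1 e2 y -> min_continuum e1 x `<=` min_continuum e1 y \/
  min_continuum e1 y `<=` min_continuum e1 x.
Proof.
move=> Q12 mx my; have Qx := min_continuum_in Q12 mx; have Qy := min_continuum_in Q12 my.
have Qx2 : Q x e2 by rewrite -(plaque_eq Qx).
have Qy2 : Q y e2 by rewrite -(plaque_eq Qy).
have [h|h] := min_continuum_join Qx Qx2 my; first by right; exact: min_continuum_mono.
have [h'|h'] := min_continuum_join Qy Qy2 mx; first by left; exact: min_continuum_mono.
suff -> : x = y by left.
have [Q2x Q2y] := (plaque_sym Qx2, plaque_sym Qy2).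
apply: (min_continuum_cancel Q2x Q2y); apply/seteqP.
by split; apply: min_continuum_mono => //; rewrite -min_continuum_sym.
Qed.

End minimal_continua.

(** * The disc *)

Section circle.
Context {R : realType}.

(* The second intersection with the circle of the lines through q1 whose
   direction turns from the tangent at q1 to the chord towards q2. *)
Lemma circle_arc (q1 q2 : R * R) : sqn q1 = 1 -> sqn q2 = 1 -> q1 <> q2 ->
  exists c : R -> R * R, [/\ continuous c, c 0 = q1, c 1 = q2 &
    [/\ forall s, sqn (c s) = 1,
        forall s, 0 <= s <= 1 -> 0 <= side q1 q2 (c s),
        forall p, sqn p = 1 -> 0 <= side q1 q2 p -> exists2 s, 0 <= s <= 1 & c s = p &
        forall s t, 0 <= s <= 1 -> 0 <= t <= 1 -> c s = c t -> s = t]].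
Proof.
case: q1 => x y; case: q2 => z w q1 q2 q12; rewrite /sqn /= in q1 q2.
pose dx := z - x; pose dy := w - y.
pose k := - (x * dx + y * dy).
have dk : dx ^+ 2 + dy ^+ 2 = 2 * k by rewrite /k /dx /dy; nra.
have d0 : 0 < dx ^+ 2 + dy ^+ 2.
  rewrite lt_neqAle addr_ge0 ?sqr_ge0// andbT; apply/eqP => /esym/eqP.
  rewrite paddr_eq0 ?sqr_ge0// !sqrf_eq0 !subr_eq0 => /andP[/eqP zx /eqP wy].
  by apply: q12; rewrite zx wy.
have k0 : 0 < k by rewrite dk in d0; lra.
(* The direction turns from the tangent [(- y, x)] at [s = 0] to the chord [(dx, dy)] at [s = 1];
   [m s] below is the non-zero root, for [s] other than 0, of the quadratic equation for the circle
   along it. *)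
pose w1 s := s * dx - (1 - s) * y; pose w2 s := s * dy + (1 - s) * x.
pose N s := w1 s * w1 s + w2 s * w2 s.
have qw s : x * w1 s + y * w2 s = - (s * k) by rewrite /w1 /w2 /k; ring.
have nw s : dy * w1 s - dx * w2 s = (1 - s) * k by rewrite /w1 /w2 /k; ring.
have N0 s : 0 < N s.
  rewrite /N -!expr2 lt_neqAle addr_ge0 ?sqr_ge0// andbT; apply/eqP => /esym/eqP.
  rewrite paddr_eq0 ?sqr_ge0// !sqrf_eq0 => /andP[/eqP h1 /eqP h2].
  have := qw s; have := nw s; rewrite h1 h2 !mulr0 subrr addr0 => e1 e2; have : k = 0 by lra.
  by lra.
have Nn0 s : N s != 0 by rewrite gt_eqF.
pose m s := 2 * s * k / N s.
have mN s : m s * N s = 2 * s * k by rewrite /m divfK.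
pose c s := (x + m s * w1 s, y + m s * w2 s).
have sideE s : side (x, y) (z, w) (c s) = m s * ((1 - s) * k).
  by rewrite -nw /side /c /= /dx /dy; ring.
have cm : continuous m.
  apply: (@contM R R (fun s => 2 * s * k) (fun s => (N s)^-1)).
    by cts.
  have cN : continuous N by rewrite /N /w1 /w2; cts.
  by move=> s; apply: cvgV; [exact: Nn0|exact: cN].
exists c; split.
- by rewrite /c /w1 /w2; cts.
- by rewrite /c /m mulr0 !mul0r !addr0.
- have N1 : N 1 = 2 * k by rewrite /N /w1 /w2 -dk; ring.
  rewrite /c /m N1 mulr1 divff ?gt_eqF ?mulr_gt0// /w1 /w2 /dx /dy.
  by congr (_, _); ring.
split.
- move=> s; have -> : sqn (c s) = x ^+ 2 + y ^+ 2 + 2 * m s * (x * w1 s + y * w2 s) + m s * (m s * N s).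
    by rewrite /sqn /c /N /=; ring.
  by rewrite mN qw q1; ring.
- move=> s s01; rewrite sideE /m !mulr_ge0//; try lra.
  by rewrite invr_ge0 ltW.
- case=> u v /= p1; rewrite /side /= -/dx -/dy => p0.
  have [pq|pq] := eqVneq (u, v) (x, y).
    by exists 0; rewrite ?lexx ?ler01// pq /c /m mulr0 !mul0r !addr0.
  (* By [qw] and [nw] these two pairings of the direction towards the given point are in the ratio
     [s] to [1 - s]; hence [s = a / (a + b)]. *)
  pose a := - (x * (u - x) + y * (v - y)); pose b := (u - x) * dy - (v - y) * dx.
  have aE : (u - x) ^+ 2 + (v - y) ^+ 2 = 2 * a by rewrite /a /sqn /= in p1 *; lra.
  have a0 : 0 < a.
    
    suff : 0 < (u - x) ^+ 2 + (v - y) ^+ 2 by rewrite aE; lra.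
    rewrite lt_neqAle addr_ge0 ?sqr_ge0// andbT; apply: contraNneq pq => /esym/eqP.
    rewrite paddr_eq0 ?sqr_ge0// !sqrf_eq0 !subr_eq0 => /andP[/eqP -> /eqP ->].
    by [].
  have b0 : 0 <= b := p0.
  have ab0 : a + b != 0 by rewrite gt_eqF//; lra.
  exists (a / (a + b)).
    rewrite divr_ge0 ?ler_pdivrMr ?mul1r; [lra..|].
    by lra.
  set s := a / (a + b); have sab : s * (a + b) = a by rewrite /s divfK.
  have k2 : 2 * k = dx ^+ 2 + dy ^+ 2 by rewrite dk.
  have W1 : w1 s * (a + b) = k * (u - x).
    have -> : w1 s * (a + b) = s * (a + b) * dx - (a + b - s * (a + b)) * y.
      by rewrite /w1; ring.
    by rewrite sab /a /b /k; ring.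
  have W2 : w2 s * (a + b) = k * (v - y).
    have -> : w2 s * (a + b) = s * (a + b) * dy + (a + b - s * (a + b)) * x.
      by rewrite /w2; ring.
    by rewrite sab /a /b /k; ring.
  have NE : N s * ((a + b) * (a + b)) = k * k * (2 * a).
    have -> : N s * ((a + b) * (a + b)) =
        (w1 s * (a + b)) ^+ 2 + (w2 s * (a + b)) ^+ 2 by rewrite /N; ring.
    by rewrite W1 W2 -aE; ring.
  have mE U W : W * (a + b) = k * U -> m s * W = U.
    move=> WE; apply: (mulIf (Nn0 s)); apply: (mulIf (mulf_neq0 ab0 ab0)).
    rewrite -[RHS]mulrA NE [m s * W * N s]mulrAC mN.
    have -> : 2 * s * k * W * ((a + b) * (a + b)) =
      2 * k * (s * (a + b)) * (W * (a + b)) by ring.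
    by rewrite sab WE; ring.
  by rewrite /c (mE _ _ W1) (mE _ _ W2) !subrKC.
- move=> s t s01 t01 ct.
  have e1 : m s * w1 s = m t * w1 t by move: ct => [/addrI].
  have e2 : m s * w2 s = m t * w2 t by move: ct => [_ /addrI].
  have E1 r : m r * r * k = - (x * (m r * w1 r) + y * (m r * w2 r)).
    by transitivity (- (m r * (x * w1 r + y * w2 r))); [rewrite qw|]; ring.
  have E2 r : m r * (1 - r) * k = dy * (m r * w1 r) - dx * (m r * w2 r).
    by transitivity (m r * (dy * w1 r - dx * w2 r)); [rewrite nw|]; ring.
  have f1 : m s * s = m t * t.
    by apply: (mulIf (lt0r_neq0 k0)); rewrite !E1 e1 e2.
  have f2 : m s * (1 - s) = m t * (1 - t).
    by apply: (mulIf (lt0r_neq0 k0)); rewrite !E2 e1 e2.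
  have mst : m s = m t by lra.
  have [s0|s0] := eqVneq s 0.
    move: f1; rewrite s0 mulr0 => /esym/eqP; rewrite mulf_eq0 => /orP[|/eqP->//].
    by rewrite /m !mulf_eq0 invr_eq0 (negbTE (Nn0 _)) orbF (gt_eqF k0) orbF pnatr_eq0 => /eqP->.
  move: f1; rewrite -mst => /mulfI; apply.
  by rewrite /m mulf_neq0 ?invr_eq0 ?Nn0// mulf_neq0 ?(gt_eqF k0)// mulf_neq0.
Qed.

End circle.

(** * Paths, separation and retractions in a topological disc *)

Section disc_coordinates.
Context {R : realType}.

Definition disc_chart (D : topologicalType) (psi : D -> R * R)
    (Phi : R * R -> D) : Prop :=
  [/\ continuous psi, continuous Phi, cancel psi Phi,
      forall x, sqn (psi x) <= 1 & forall p, sqn p <= 1 -> psi (Phi p) = p].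

(* The inversion-like retraction p / max(1, |p|^2) extends a chart defined on
   the disc to the whole plane. *)
Lemma disc_chart_exists (D : topologicalType) (phi : unit_disc R -> D) :
  homeomorphism phi -> exists psi Phi, disc_chart psi Phi /\
    disc_boundary phi = [set x | sqn (psi x) = 1].
Proof.
move=> [cphi [g [cg phiK gK]]].
pose t (p : R * R) := (1 + sqn p + `|sqn p - 1|) / 2.
have tE p : (sqn p <= 1 /\ t p = 1) \/ (1 < sqn p /\ t p = sqn p).
  rewrite /t; have [p1|p1] := leP (sqn p) 1; [left|right]; split => //.
    by rewrite ler0_norm; lra.
  by rewrite ger0_norm; lra.
have t1 p : 1 <= t p by case: (tE p) => -[]; lra.
have tn0 p : t p != 0 by rewrite gt_eqF// (lt_le_trans ltr01).
pose r (p : R * R) := (p.1 / t p, p.2 / t p).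
have cs := @continuous_sqn R.
have ct : continuous t by rewrite /t; cts.
have ctV : continuous (fun p => (t p)^-1).
  by move=> p; apply: cvgV; [exact: tn0|exact: ct].
have cr : continuous r.
  apply: cont_pair; apply: contM => //; [exact: (cont_fst cont_id)|exact: (cont_snd cont_id)].
have r1 p : sqn (r p) <= 1.
  have -> : sqn (r p) = sqn p / (t p * t p).
    rewrite /sqn /r /= !exprMn exprVn -mulrDl expr2; congr (_ / _).
  rewrite ler_pdivrMr; last by rewrite mulr_gt0// (lt_le_trans ltr01).
  by case: (tE p) => -[p1 ->]; rewrite mul1r ?mulr1//; nra.
have rE p : sqn p <= 1 -> r p = p.
  case: (tE p) => -[p1 tp] p1'; last by rewrite leNgt p1 in p1'.
  by rewrite /r tp !divr1; exact: plane_eq.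
pose s (p : R * R) : unit_disc R := SigSub (mem_set (r1 p : unit_disc R (r p))).
exists (fun x => set_val (g x)), (fun p => phi (s p)); split; first split.
- apply: cont_comp => //; exact: initial_continuous.
- apply: (cont_comp (f := s) (g := phi)) => //.
  apply: continuous_comp_initial. exact: cr.
- move=> x; rewrite -[RHS]gK; congr phi; apply: val_inj => /=; apply: rE.
  by have := set_valP (g x).
- by move=> x; have := set_valP (g x).
- by move=> p p1; rewrite phiK /=; exact: rE.
rewrite /disc_boundary; apply/seteqP; split => [_ [p p1 <-]|x x1] /=.
  by rewrite phiK.
by exists (g x).
Qed.

Context {D : topologicalType} (psi : D -> R * R) (Phi : R * R -> D).
Hypothesis chart : disc_chart psi Phi.

Let cpsi : continuous psi. Proof. by have [] := chart. Qed.
Let cPhi : continuous Phi. Proof. by have [] := chart. Qed.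
Let psiK : cancel psi Phi. Proof. by have [] := chart. Qed.
Let psi1 x : sqn (psi x) <= 1. Proof. by have [] := chart. Qed.
Let PhiK p : sqn p <= 1 -> psi (Phi p) = p. Proof. by have [_ _ _ _] := chart; apply. Qed.

Lemma chart_inj : injective psi.
Proof. exact: can_inj psiK. Qed.

Lemma chart_compact : compact [set: D].
Proof.
have -> : [set: D] = Phi @` (`[-1, 1]%classic `*` `[-1, 1]%classic).
  apply/seteqP; split => // x _; exists (psi x); last exact: psiK.
  by have [? ? ? ?] := sqn_le1 (psi1 x); split; rewrite /= in_itv /=; apply/andP.
apply: continuous_image_compact => //.
by apply: compact_setX; exact: segment_compact.
Qed.

Lemma chart_joined_local (U : set D) z : open U -> U z ->
  \forall z' \near z, joined (R := R) U z z'.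
Proof.
move=> oU Uz.
have /nbhs_ballP[e /= e0 eU] : nbhs (psi z) (Phi @^-1` U).
  by apply: cPhi; rewrite psiK; exact: open_nbhs_nbhs.
have : nbhs z (psi @^-1` ball (psi z) e) by apply: cpsi; exact: nbhsx_ballx.
apply: filterS => z' [/= z1 z2].
pose l (s : R) : R * R := ((psi z).1 + s * ((psi z').1 - (psi z).1),
  (psi z).2 + s * ((psi z').2 - (psi z).2)).
exists (fun s => Phi (l s)); split.
- by rewrite /l; cts.
- by rewrite /l !mul0r !addr0 -surjective_pairing psiK.
- by rewrite /l !mul1r !subrKC -surjective_pairing psiK.
- move=> s /andP[s0 s1]; apply: eU.
  have H (a b : R) : ball a e b -> ball a e (a + s * (b - a)).
    rewrite /ball /= opprD addrA subrr add0r normrN normrM ger0_norm// distrC.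
    by apply: le_lt_trans; rewrite ler_piMl.
  by split; exact: H.
Qed.

Lemma chart_joined_connected (U K : set D) x y : open U -> connected K ->
  K `<=` U -> K x -> K y -> joined (R := R) U x y.
Proof. by move=> oU; apply: joined_connected => z; exact: chart_joined_local. Qed.

Lemma chart_joined_open (U : set D) x : open U -> open [set y | joined (R := R) U x y].
Proof.
move=> oU; rewrite openE => y /= xy.
apply: filterS (chart_joined_local oU (joined_mem xy).2) => z; exact: joined_trans.
Qed.

Lemma chart_joined_setT x y : joined (R := R) [set: D] x y.
Proof.
have h z : joined (R := R) [set: D] z (Phi (0, 0)).
  exists (fun s => Phi ((1 - s) * (psi z).1, (1 - s) * (psi z).2)); split => //.
  - by cts.
  - by rewrite subr0 !mul1r -surjective_pairing psiK.
  - by rewrite subrr !mul0r.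
by apply: joined_trans (h x) _; exact: joined_sym.
Qed.

(** A radial segment leaves the circle at once, so the detour through the centre avoids [A]. *)
Lemma chart_star (A : set D) x y : A `<=` [set z | sqn (psi z) = 1] ->
  ~ A x -> ~ A y -> joined (R := R) (~` A) x y.
Proof.
move=> Ab; suff h z : ~ A z -> joined (R := R) (~` A) z (Phi (0, 0)).
  by move=> /h xo /h yo; apply: joined_trans xo _; exact: joined_sym.
move=> nAz; exists (fun s => Phi ((1 - s) * (psi z).1, (1 - s) * (psi z).2)); split.
- by cts.
- by rewrite subr0 !mul1r -surjective_pairing psiK.
- by rewrite subrr !mul0r.
move=> s s01; have [->|s0] := eqVneq s 0.
  by rewrite subr0 !mul1r -surjective_pairing psiK.
have sE : sqn ((1 - s) * (psi z).1, (1 - s) * (psi z).2) = (1 - s) ^+ 2 * sqn (psi z).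
  by rewrite /sqn /=; ring.
have [z0 z1] := (sqn_ge0 (psi z), psi1 z).
have s0' : 0 < s by rewrite lt_neqAle eq_sym s0; case/andP: s01.
have lt1 : (1 - s) ^+ 2 * sqn (psi z) < 1.
  have : (1 - s) ^+ 2 < 1 by rewrite expr2; nra.
  have := sqr_ge0 (1 - s); move: (_ ^+ 2) (sqn _) z0 z1 => a b; nra.
move=> /Ab /=; rewrite PhiK sE; first by move=> E; rewrite E ltxx in lt1.
exact: ltW.
Qed.

(** [K] need not contain a path, but it lies in the open complement of the compact image of [d],
    where [k1] and [k2] can be joined by a path. [disc_crossing] applies to that path. *)
Lemma chart_crossing (K : set D) k1 k2 x1 x2 : connected K -> K k1 -> K k2 ->
  sqn (psi k1) = 1 -> sqn (psi k2) = 1 -> sqn (psi x1) = 1 -> sqn (psi x2) = 1 ->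
  0 < side (psi x1) (psi x2) (psi k1) -> side (psi x1) (psi x2) (psi k2) < 0 ->
  joined (R := R) (~` K) x1 x2 -> hausdorff_space D -> False.
Proof.
move=> kK K1 K2 k11 k21 x11 x21 s1 s2 [d [cd d0 d1 dK]] hD.
pose U := ~` (d @` `[0, 1]%classic).
have oU : open U.
  apply: closed_openC; apply: compact_closed => //.
  by apply: continuous_image_compact => //; exact: segment_compact.
have [g [cg g0 g1 gU]] : joined (R := R) U k1 k2.
  apply: (chart_joined_connected oU kK) => // z Kz [s].
  by rewrite /= in_itv /= => s01 dz; apply: (dK s s01); rewrite dz.
have [||||||||||s [t [s01 t01 gd]]] := @disc_crossing R (psi \o g) (psi \o d).
- exact: cont_comp.
- exact: cont_comp.
- by move=> s _; exact: psi1.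
- by move=> s _; exact: psi1.
- by rewrite /= g0.
- by rewrite /= g1.
- by rewrite /= d0.
- by rewrite /= d1.
- by rewrite /= d0 d1 g0.
- by rewrite /= d0 d1 g1.
apply: (gU s s01); exists t; first by rewrite /= in_itv.
by apply/esym/chart_inj.
Qed.

Lemma chart_no_retraction (f : D -> D) : continuous f ->
  (forall x, sqn (psi x) = 1 -> f x = x) -> forall y, exists x, f x = y.
Proof.
move=> cf fid y.
have [||p p1 pE] := @disc_no_retraction R (fun p => psi (f (Phi p))) _ _ (psi y) (psi1 y).
- by cts.
- by move=> p p1; rewrite fid PhiK// p1.
by exists (Phi p); exact: chart_inj.
Qed.

End disc_coordinates.

(** * The projection onto the space of plaques *)

Section arc_gluing.
Context {R : realType} {T : topologicalType}.

Lemma injective_path_join (f g : R -> T) : continuous f -> continuous g ->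
  f 1 = g 0 ->
  (forall x y, 0 <= x <= 1 -> 0 <= y <= 1 -> f x = f y -> x = y) ->
  (forall x y, 0 <= x <= 1 -> 0 <= y <= 1 -> g x = g y -> x = y) ->
  (forall x y, 0 <= x <= 1 -> 0 <= y <= 1 -> f x = g y -> x = 1) ->
  exists h : R -> T, [/\ continuous h, h 0 = f 0, h 1 = g 1, h 2^-1 = f 1 &
    forall x y, 0 <= x <= 1 -> 0 <= y <= 1 -> h x = h y -> x = y].
Proof.
move=> cf cg fg finj ginj fginj.
exists (fun s => if s <= 2^-1 then f (0 + s * 2) else g (-1 + s * 2)).
have fgE x y : 0 <= x <= 1 -> 0 <= y <= 1 -> x <= 2^-1 -> 2^-1 < y ->
    f (0 + x * 2) = g (-1 + y * 2) -> False.
  move=> x01 y01 x2 y2 E; have : 0 + x * 2 = 1 by apply: fginj E; lra.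
  move=> xE; move: E; rewrite xE fg => /ginj E; have : 0 = -1 + y * 2 by apply: E; lra.
  by lra.
split.
- refine (@continuous_paste R T [set s | s <= 2^-1] [set s | s >= 2^-1] _
    (fun s => f (0 + s * 2)) (fun s => g (-1 + s * 2)) _ _ _ _ _ _ _).
  + exact: closed_le.
  + exact: closed_ge.
  + by move=> s; apply/orP; exact: le_total.
  + by cts.
  + by cts.
  + by move=> s /= ->.
  + move=> s /= s2; case: ifPn => // s2'; have -> : s = 2^-1 by lra.
    by rewrite add0r mulVf// addNr.
- by rewrite ifT ?mul0r ?addr0//; lra.
- by rewrite ifF ?mul1r; [congr g|apply/negbTE]; lra.
- by rewrite lexx add0r mulVf.
move=> x y x01 y01; have [x2|x2] := leP x 2^-1; have [y2|y2] := leP y 2^-1.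
- by move=> /finj E; have := E ltac:(lra) ltac:(lra); lra.
- by move=> /(fgE _ _ x01 y01 x2 y2).
- by move=> /esym/(fgE _ _ y01 x01 y2 x2).
- by move=> /ginj E; have := E ltac:(lra) ltac:(lra); lra.
Qed.

Lemma closed_equalizer {U V : topologicalType} (f g : U -> V) : hausdorff_space V ->
  continuous f -> continuous g -> closed [set x | f x = g x].
Proof.
move=> hV cf cg x xfg; apply: hV => A B Af Bg.
have nf : nbhs x (f @^-1` A) := cf x A Af.
have ng : nbhs x (g @^-1` B) := cg x B Bg.
have [z [/= E [Az Bz]]] := xfg _ (filterI nf ng).
by exists (f z); split => //; rewrite E.
Qed.

Lemma hausdorff_pair {U V : topologicalType} : hausdorff_space U ->
  hausdorff_space V -> hausdorff_space (U * V)%type.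
Proof.
move=> hU hV [a b] [c d] cl; congr (_, _).
- apply: hU => A B Aa Bc.
  have [[u v] [[? _] [? _]]] := cl (A `*` setT) (B `*` setT)
    (ex_intro2 _ _ (A, setT) (conj Aa filterT) (@subset_refl _ _))
    (ex_intro2 _ _ (B, setT) (conj Bc filterT) (@subset_refl _ _)).
  by exists u.
- apply: hV => A B Aa Bc.
  have [[u v] [[_ ?] [_ ?]]] := cl (setT `*` A) (setT `*` B)
    (ex_intro2 _ _ (setT, A) (conj filterT Aa) (@subset_refl _ _))
    (ex_intro2 _ _ (setT, B) (conj filterT Bc) (@subset_refl _ _)).
  by exists v.
Qed.

End arc_gluing.

Section plaque_projection.
Context {R : realType} {D M : metricType R} (Q : D -> set D) (pi : D -> M).
Hypothesis cD : compact [set: D].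
Hypothesis decQ : decomposition Q.
Hypothesis contQ : continuous_decomposition Q.
Hypothesis cpi : continuous pi.
Hypothesis pi_surj : forall m, exists x, pi x = m.
Hypothesis piE : forall x y, pi x = pi y <-> Q x y.

Let hM : hausdorff_space M := @metric_hausdorff _ M.

(** Hausdorff continuity brings nearby plaques close to every point of a plaque, so the saturation
    [S] of an open set is open; its complement has a closed image. *)
Lemma projection_open (V : set D) x : open V -> V x -> nbhs (pi x) (pi @` V).
Proof.
move=> oV Vx; pose S := [set y | exists2 z, Q y z & V z].
have oS : open S.
  rewrite openE => y [z Qyz Vz].
  have /nbhs_ballP[e /= e0 eV] : nbhs z V by exact: open_nbhs_nbhs.
  have [d d0 dP] := plaque_near cD decQ contQ y e0.
  apply/nbhs_ballP; exists d => //= w /dP[_ /(_ z Qyz)[v Qwv vz]].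
  by exists v => //; apply: eV; exact/ball_sym.
have cl : closed (pi @` (~` S)).
  by apply: compact_space_closed_map => //; exact: open_closedC.
apply: (@filterS _ _ _ (~` (pi @` (~` S)))).
  move=> m nm; have [y ym] := pi_surj m.
  have [z Qyz Vz] : S y by apply: contrapT => nS; apply: nm; exists y.
  by exists z => //; rewrite -ym; apply/esym/piE.
apply: open_nbhs_nbhs; split; first exact: closed_openC.
by move=> [y nS /piE Qyx]; apply: nS; exists x.
Qed.

(** The fibres are connected, so each lies in one piece of a splitting of the preimage; the closed
    images of the pieces would then split [L]. *)
Lemma projection_preimage_connected (L : set M) : closed L -> connected L ->
  connected (pi @^-1` L).
Proof.
move=> clL kL; have clp : closed (pi @^-1` L) by exact: (continuous_closedP _).1 cpi _ clL.
apply: contrapT => /(disconnected_closed clp)[A [B [clA clB [x Ax] [y By] [LE AB0]]]].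
have Lx : L (pi x) by have : (pi @^-1` L) x by [rewrite LE; left].
have Ly : L (pi y) by have : (pi @^-1` L) y by [rewrite LE; right].
have disj u v : A u -> B v -> pi u = pi v -> False.
  move=> Au Bv uv; have Luv w : Q u w -> L (pi w).
    move=> /piE <-; have : (pi @^-1` L) u by rewrite LE; left.
    by [].
  have : Q u `<=` A.
    apply: (@connected_closed_disjoint _ (Q u) A B) => //.
    - exact: plaque_connected.
    - by move=> w /Luv Lw; rewrite -LE.
    - by move=> w _ Aw Bw; have : (A `&` B) w by []; rewrite AB0.
    - by exists u; split => //; exact: plaque_refl.
  move=> /(_ v ((piE _ _).1 uv)) Av; have : (A `&` B) v by [].
  by rewrite AB0.
have : L `<=` pi @` A.
  apply: (@connected_closed_disjoint _ L (pi @` A) (pi @` B)) => //.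
  - exact: compact_space_closed_map.
  - exact: compact_space_closed_map.
  - move=> m Lm; have [z zm] := pi_surj m.
    have : (pi @^-1` L) z by rewrite /= zm.
    by rewrite LE => -[Az|Bz]; [left|right]; exists z.
  - by move=> m _ [u Au <-] [v Bv] /esym; exact: disj.
  - by exists (pi x); split => //; exists x.
by move=> /(_ _ Ly)[u Au]; exact: disj.
Qed.

End plaque_projection.

(** On the line [q1 + l (q2 - q1)] the equation of the circle becomes [l (l - 1) = 0]. *)
Lemma side_eq0 {R : realType} (p q1 q2 : R * R) : sqn p = 1 -> sqn q1 = 1 ->
  sqn q2 = 1 -> q1 <> q2 -> side q1 q2 p = 0 -> p = q1 \/ p = q2.
Proof.
case: p q1 q2 => [px py] [x y] [z w]; rewrite /sqn /side /= => p1 q1 q2 q12 s0.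
pose dx := z - x; pose dy := w - y; pose ux := px - x; pose uy := py - y.
have dd : dx ^+ 2 + dy ^+ 2 != 0.
  apply/eqP => /eqP; rewrite paddr_eq0 ?sqr_ge0// !sqrf_eq0 !subr_eq0.
  by move=> /andP[/eqP zx /eqP wy]; apply: q12; rewrite zx wy.
have su : ux * dy = uy * dx by apply/eqP; rewrite -subr_eq0; apply/eqP.
have [l lE] : exists l, l * (dx ^+ 2 + dy ^+ 2) = ux * dx + uy * dy.
  by exists ((ux * dx + uy * dy) / (dx ^+ 2 + dy ^+ 2)); rewrite divfK.
have uxE : ux = l * dx.
  apply: (mulIf dd); rewrite mulrAC lE.
  have -> : (ux * dx + uy * dy) * dx = ux * dx * dx + (uy * dx) * dy by ring.
  by rewrite -su; ring.
have uyE : uy = l * dy.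
  apply: (mulIf dd); rewrite mulrAC lE.
  have -> : (ux * dx + uy * dy) * dy = (ux * dy) * dx + uy * dy * dy by ring.
  by rewrite su; ring.
have pE : px = x + l * dx by rewrite -uxE /ux subrKC.
have pE' : py = y + l * dy by rewrite -uyE /uy subrKC.
have : l * (l - 1) * (dx ^+ 2 + dy ^+ 2) = 0.
  have d2 : dx ^+ 2 + dy ^+ 2 = - 2 * (x * dx + y * dy).
    by rewrite /dx /dy; clear -q1 q2; lra.
  have : l * (l * (dx ^+ 2 + dy ^+ 2) + 2 * (x * dx + y * dy)) = 0.
    have -> : l * (l * (dx ^+ 2 + dy ^+ 2) + 2 * (x * dx + y * dy)) =
      (x + l * dx) ^+ 2 + (y + l * dy) ^+ 2 - (x ^+ 2 + y ^+ 2) by ring.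
    by rewrite -pE -pE' p1 q1 subrr.
  by move=> <-; rewrite d2; ring.
move/eqP; rewrite !mulf_eq0 (negbTE dd) orbF subr_eq0 => /orP[]/eqP lv; [left|right].
  by rewrite pE pE' lv !mul0r !addr0.
by rewrite pE pE' lv !mul1r /dx /dy !subrKC.
Qed.

Lemma sideC {R : realType} (q1 q2 p : R * R) : side q2 q1 p = - side q1 q2 p.
Proof. by rewrite /side; ring. Qed.

(** * Plaques over interior points of an arc *)

Section crossing_plaques.
Context {R : realType} {D M : metricType R} (Q : D -> set D) (pi : D -> M).
Context (psi : D -> R * R) (Phi : R * R -> D) (xs : nat -> M).
Hypothesis chart : disc_chart psi Phi.
Hypothesis decQ : decomposition Q.
Hypothesis contQ : continuous_decomposition Q.
Hypothesis smoothQ : C_smooth Q.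
Hypothesis cpi : continuous pi.
Hypothesis pi_surj : forall m, exists x, pi x = m.
Hypothesis piE : forall x y, pi x = pi y <-> Q x y.
Hypothesis dxs : dense_seq xs.
Hypothesis no_circle : forall f : unit_circle R -> M,
  continuous f -> injective f -> False.

Let cD : compact [set: D] := chart_compact chart.
Let hD : hausdorff_space D := @metric_hausdorff _ D.
Let hM : hausdorff_space M := @metric_hausdorff _ M.
Let cPhi : continuous Phi. Proof. by have [] := chart. Qed.
Let psiK : cancel psi Phi. Proof. by have [] := chart. Qed.
Let PhiK p : sqn p <= 1 -> psi (Phi p) = p. Proof. by have [_ _ _ _] := chart; apply. Qed.
Let closedQ x : closed (Q x). Proof. exact/(compact_closed hD)/plaque_compact. Qed.

Definition injective_arc (h : R -> M) := continuous h /\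
  forall x y, 0 <= x <= 1 -> 0 <= y <= 1 -> h x = h y -> x = y.

Definition arc_between (a b : D) (h : R -> M) :=
  [/\ injective_arc h, h 0 = pi a & h 1 = pi b].

Lemma arc_between_rev a b h : arc_between a b h ->
  arc_between b a (fun s => h (1 + s * -1)).
Proof.
move=> [[ch hinj] h0 h1]; split; last 2 first.
- by rewrite mul0r addr0.
- by rewrite mul1r subrr.
split; first by cts.
by move=> x y x01 y01 /hinj E; have := E ltac:(lra) ltac:(lra); lra.
Qed.

Lemma plaque_separates a b h t p : arc_between a b h -> 0 < t < 1 ->
  pi p = h t -> ~ joined (R := R) (~` Q p) a b.
Proof.
move=> [[ch hinj] h0 h1] t01 pt jab.
apply: (arc_separates dxs no_circle ch hinj t01); rewrite h0 h1.
apply: joined_image jab => // z nz /= E; apply: nz; apply/piE.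
by rewrite pt E.
Qed.

Definition boundary_pair a b := [/\ sqn (psi a) = 1, sqn (psi b) = 1 & ~ Q a b].

Lemma boundary_pairC a b : boundary_pair a b -> boundary_pair b a.
Proof. by move=> [a1 b1 nab]; split => // /(plaque_sym decQ). Qed.

(** The arcs C1 and C2 of the overview are [boundary_arc a b] and [boundary_arc b a], by [sideC]. *)
Definition boundary_arc a b : set D :=
  [set x | sqn (psi x) = 1 /\ 0 <= side (psi a) (psi b) (psi x)].

Lemma boundary_arcC a b x : sqn (psi x) = 1 -> boundary_arc a b x \/ boundary_arc b a x.
Proof.
move=> x1; rewrite /boundary_arc /= (sideC (psi a)).
by have [s|/ltW s] := leP 0 (side (psi a) (psi b) (psi x)); [left|right]; rewrite ?oppr_ge0.
Qed.

Section interior_plaque.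
Variables (a b : D) (h : R -> M) (t : R) (p : D).
Hypothesis ab : boundary_pair a b.
Hypothesis hab : arc_between a b h.
Hypothesis t01 : 0 < t < 1.
Hypothesis pt : pi p = h t.

Lemma interior_plaque_avoids : ~ Q p a /\ ~ Q p b.
Proof.
have [[_ hinj] h0 h1] := hab; have /andP[t0 t1] := t01.
split => /piE; rewrite pt -?h0 -?h1 => /hinj E.
  have : t = 0 by apply: E; lra.
  by lra.
have : t = 1 by apply: E; lra.
by lra.
Qed.

Let oK : open (~` Q p). Proof. exact: closed_openC. Qed.

(** Since [pi] is open, [V] has points over [h s] for some [s] just before [t]. The preimage of the
    arc up to [s] is connected, contains [a] and avoids [Q p]. *)
Lemma interior_plaque_access (V : set D) x : open V -> Q p x -> V x ->
  exists2 y, V y & joined (R := R) (~` Q p) a y.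
Proof.
move=> oV /piE px Vx; have [[ch hinj] h0 h1] := hab; have /andP[t0 t1] := t01.
have nV : nbhs (h t) (pi @` V) by rewrite -pt px; exact: (projection_open cD decQ contQ cpi pi_surj piE oV Vx).
have /nbhs_ballP[e /= e0 eV] : nbhs t (h @^-1` (pi @` V)) by exact: ch.
pose s := t - Num.min (e / 2) t.
have [m0 me mt] : [/\ 0 < Num.min (e / 2) t, Num.min (e / 2) t <= e / 2 & Num.min (e / 2) t <= t].
  by split; rewrite ?lt_min ?ge_min ?lexx ?orbT//; apply/andP; split; lra.
have [y Vy ys] : (pi @` V) (h s).
  by apply: eV; rewrite /ball /= /s opprB addrCA subrr addr0 ger0_norm; lra.
exists y => //; pose L := h @` `[0, s]%classic.
have clL : closed L.
  by apply: compact_closed => //; apply: continuous_image_compact => //; exact: segment_compact.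
have kL : connected L by apply: continuous_image_connected => //; exact: segment_connected.
apply: (chart_joined_connected chart oK
  (projection_preimage_connected cD decQ cpi pi_surj piE clL kL)).
- move=> z [u + uz] /piE; rewrite /= in_itv /= pt -uz => u01 /hinj E.
  have : t = u by apply: E; rewrite /s in u01; lra.
  by rewrite /s in u01; lra.
- by exists 0; rewrite //= in_itv /= lexx /s; lra.
- by exists s; rewrite //= in_itv /= lexx /s; lra.
Qed.

(* A point of [Q p] outside a subcontinuum crossing from one boundary arc to the
   other could be used to join a to b in the complement of the latter. *)
Lemma interior_plaque_irreducible (L : set D) k1 k2 :
  (forall (V : set D) x, open V -> Q p x -> V x ->
    exists2 y, V y & joined (R := R) (~` Q p) b y) ->
  compact L -> connected L -> L `<=` Q p -> L k1 -> L k2 ->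
  boundary_arc a b k1 -> boundary_arc b a k2 -> Q p `<=` L.
Proof.
move=> access_b cL kL LQ L1 L2 [k11 s1] [k21]; rewrite sideC oppr_ge0 => s2 x Kx.
have [na nb] := interior_plaque_avoids; have [a1 b1 nab] := ab.
have npab : psi a <> psi b.
  by move=> /(chart_inj chart) E; apply: nab; rewrite E; exact: plaque_refl.
have s0 (k : D) : Q p k -> sqn (psi k) = 1 -> side (psi a) (psi b) (psi k) != 0.
  move=> Kk kb; apply/eqP => /(side_eq0 kb a1 b1 npab).
  by move=> [] /(chart_inj chart) E; [apply: na|apply: nb]; rewrite -E.
have s1' : 0 < side (psi a) (psi b) (psi k1) by rewrite lt_neqAle s1 eq_sym s0//; exact: LQ.
have s2' : side (psi a) (psi b) (psi k2) < 0 by rewrite lt_neqAle s2 s0//; exact: LQ.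
apply: contrapT => nLx.
have oL : open (~` L) by apply: closed_openC; exact: compact_closed.
have oV := chart_joined_open chart x oL.
have Vx : [set y | joined (R := R) (~` L) x y] x by exact: joined_refl.
have sub : ~` Q p `<=` ~` L by move=> z nz /LQ.
have [y1 xy1 ay1] := interior_plaque_access oV Kx Vx.
have [y2 xy2 by2] := access_b _ _ oV Kx Vx.
apply: (chart_crossing chart kL L1 L2 k11 k21 a1 b1 s1' s2') => //.
apply: joined_trans (joined_sub sub ay1) _.
apply: joined_trans (joined_sym xy1) _.
by apply: joined_trans xy2 _; apply: joined_sym; exact: joined_sub by2.
Qed.

Let arc_path : exists c : R -> D, [/\ continuous c, c 0 = a, c 1 = b &
  [/\ forall s, sqn (psi (c s)) = 1, forall s, 0 <= s <= 1 -> boundary_arc a b (c s),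
    forall x, boundary_arc a b x -> exists2 s, 0 <= s <= 1 & c s = x &
    forall s t, 0 <= s <= 1 -> 0 <= t <= 1 -> c s = c t -> s = t]].
Proof.
have [a1 b1 nab] := ab.
have npab : psi a <> psi b.
  by move=> /(chart_inj chart) E; apply: nab; rewrite E; exact: plaque_refl.
have [c [cc c0 c1 [cs1 cs cx cinj]]] := circle_arc a1 b1 npab.
have cK s : psi (Phi (c s)) = c s by rewrite PhiK// cs1.
exists (fun s => Phi (c s)); split.
- by cts.
- by rewrite c0.
- by rewrite c1.
split.
- by move=> s; rewrite cK.
- by move=> s s01; rewrite /boundary_arc /= cK; split => //; exact: cs.
- by move=> x [x1 /(cx _ x1)[s s01 sx]]; exists s => //; rewrite sx.
- by move=> s s' s01 s01' E; apply: cinj => //; rewrite -cK E cK.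
Qed.

Lemma interior_plaque_meets : exists2 k, Q p k & boundary_arc a b k.
Proof.
have [c [cc c0 c1 [_ cs _ _]]] := arc_path.
apply: contrapT => nk; apply: (plaque_separates hab t01 pt).
by exists c; split => // s s01 Kc; apply: nk; exists (c s) => //; exact: cs.
Qed.

(** A single point of [Q p] cuts the boundary arc into two pieces, along which [z] is reached from
    [a] or from [b]. *)
Lemma interior_plaque_boundary : (forall k k', Q p k -> Q p k' ->
    boundary_arc a b k -> boundary_arc a b k' -> k = k') ->
  forall z, ~ Q p z -> boundary_arc a b z ->
  joined (R := R) (~` Q p) a z \/ joined (R := R) (~` Q p) b z.
Proof.
move=> uniq z nz bz; have [c [cc c0 c1 [_ cs cx cinj]]] := arc_path.
have [k Kk bk] := interior_plaque_meets.
have [s1 s101 cs1] := cx k bk; have [s2 s201 cs2] := cx z bz.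
have only s : 0 <= s <= 1 -> Q p (c s) -> s = s1.
  move=> s01 Ks; apply: cinj => //; rewrite cs1; apply: uniq => //; exact: cs.
have ne : s2 != s1 by apply/eqP => E; apply: nz; rewrite -cs2 E cs1.
case: (ltgtP s2 s1) ne => // s12 _; [left|right].
  exists (fun u => c (u * s2)); split.
  - by cts.
  - by rewrite mul0r.
  - by rewrite mul1r.
  - move=> u /andP[u0 u1] /only E; have /andP[s20 s21] := s201.
    have us : u * s2 <= s2 by rewrite ler_piMl.
    have : u * s2 = s1 by apply: E; rewrite mulr_ge0//= (le_trans us).
    by move=> E'; move: s12; rewrite -E' ltNge us.
exists (fun u => c (1 + u * (s2 - 1))); split.
- by cts.
- by rewrite mul0r addr0.
- by rewrite mul1r subrKC.
- move=> u /andP[u0 u1] /only E; have /andP[s20 s21] := s201.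
  have us : s2 <= 1 + u * (s2 - 1).
    by rewrite -lerBlDl -lerN2 -mulrN ler_piMl// oppr_ge0 subr_le0.
  have : 1 + u * (s2 - 1) = s1.
    by apply: E; rewrite (le_trans s20 us) gerDl mulr_ge0_le0// subr_le0.
  by move=> E'; move: s12; rewrite -E' ltNge us.
Qed.

End interior_plaque.

(** The reverse inclusion is automatic ([crossingE]); in this form the relation passes to limits
    ([closed_crossing]). *)
Definition crossing a b x e1 e2 := [/\ Q x e1, Q x e2, boundary_arc a b e1,
  boundary_arc b a e2 & Q x `<=` min_continuum Q e1 e2].

Lemma crossingE a b x e1 e2 : crossing a b x e1 e2 -> Q x = min_continuum Q e1 e2.
Proof.
move=> [Q1 Q2 _ _ QE]; apply/seteqP; split => //.
rewrite (plaque_eq decQ Q1); apply: min_continuum_sub => //.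
by rewrite -(plaque_eq decQ Q1).
Qed.

Section interior_plaque_both_sides.
Variables (a b : D) (h : R -> M) (t : R) (p : D).
Hypothesis ab : boundary_pair a b.
Hypothesis hab : arc_between a b h.
Hypothesis t01 : 0 < t < 1.
Hypothesis pt : pi p = h t.

Let ba := boundary_pairC ab.
Let hba := arc_between_rev hab.
Let t01' : 0 < 1 - t < 1. Proof. by have /andP[? ?] := t01; apply/andP; split; lra. Qed.
Let pt' : pi p = h (1 + (1 - t) * -1). Proof. by rewrite pt; congr h; lra. Qed.

Lemma interior_crossing e1 e2 : Q p e1 -> Q p e2 -> boundary_arc a b e1 ->
  boundary_arc b a e2 -> crossing a b p e1 e2.
Proof.
move=> Q1 Q2 b1 b2; split => //.
have Q12 : Q e1 e2 by rewrite -(plaque_eq decQ Q1).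
have [? ? + ? ?] := min_continuumP decQ smoothQ Q12.
rewrite -(plaque_eq decQ Q1) => ?.
apply: (interior_plaque_irreducible ab hab t01 pt _ _ _ _ _ _ b1 b2) => //.
(* Access from [b] is access from the start of the reversed arc. *)
exact: interior_plaque_access hba t01' pt'.
Qed.

Lemma interior_crossing_exists : exists e1 e2, crossing a b p e1 e2.
Proof.
have [e1 Q1 b1] := interior_plaque_meets ab hab t01 pt.
have [e2 Q2 b2] := interior_plaque_meets ba hba t01' pt'.
by exists e1, e2; exact: interior_crossing.
Qed.

(** [Q p] is the minimal continuum between any of its points on one arc and any on the other, so by
    cancellation it meets each arc only once. *)
Lemma interior_plaque_sides z : ~ Q p z -> sqn (psi z) = 1 ->
  joined (R := R) (~` Q p) a z \/ joined (R := R) (~` Q p) b z.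
Proof.
move=> nz z1; have [e1 [e2 cr]] := interior_crossing_exists.
have [Q1 Q2 b1 b2 _] := cr.
have [bz|bz] := boundary_arcC a b z1.
  apply: (interior_plaque_boundary ab hab t01 pt) => // k k' Qk Qk' bk bk'.
  have Q2k : Q e2 k by rewrite -(plaque_eq decQ Q2).
  have Q2k' : Q e2 k' by rewrite -(plaque_eq decQ Q2).
  apply: (min_continuum_cancel cD decQ smoothQ Q2k Q2k').
  rewrite (min_continuum_sym decQ Q2k) (min_continuum_sym decQ Q2k').
  by rewrite -(crossingE (interior_crossing Qk Q2 bk b2)) (crossingE (interior_crossing Qk' Q2 bk' b2)).
apply/or_comm; apply: (interior_plaque_boundary ba hba t01' pt') => // k k' Qk Qk' bk bk'.
have Q1k : Q e1 k by rewrite -(plaque_eq decQ Q1).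
have Q1k' : Q e1 k' by rewrite -(plaque_eq decQ Q1).
apply: (min_continuum_cancel cD decQ smoothQ Q1k Q1k').
by rewrite -(crossingE (interior_crossing Q1 Qk b1 bk)) (crossingE (interior_crossing Q1 Qk' b1 bk')).
Qed.

End interior_plaque_both_sides.

End crossing_plaques.

(** * The product structure *)

Section plaque_parametrization.
Context {R : realType} {D : metricType R} (Q : D -> set D) (xs : nat -> D).
Hypothesis cD : compact [set: D].
Hypothesis decQ : decomposition Q.
Hypothesis smoothQ : C_smooth Q.
Hypothesis dxs : dense_seq xs.

Definition arc_size (x y : D) : R := set_size xs (min_continuum Q x y).

Lemma arc_size_near x y (e : R) : Q x y -> 0 < e -> exists2 d : R, 0 < d &
  forall x' y', Q x' y' -> ball x d x' -> ball y d y' ->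
  `|arc_size x y - arc_size x' y'| < e.
Proof.
move=> Qxy e0; have e20 : 0 < e / 2 by rewrite divr_gt0.
have [d d0 dP] := min_continuum_near cD decQ smoothQ Qxy e20.
exists d => // x' y' Qxy' bx /(dP _ _ Qxy' bx)[h1 h2].
have m0 := min_continuum_neq0 decQ smoothQ Qxy.
have m0' := min_continuum_neq0 decQ smoothQ Qxy'.
have := set_size_near xs e20 m0 m0' h2; have := set_size_near xs e20 m0' m0 h1.
rewrite -!/(arc_size _ _) ltr_norml; move: (arc_size x y) (arc_size x' y') => u v.
by move=> ? ?; apply/andP; split; lra.
Qed.

Lemma arc_size_continuous (T : topologicalType) (u v : T -> D) : continuous u ->
  continuous v -> (forall x, Q (u x) (v x)) -> continuous (fun x => arc_size (u x) (v x)).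
Proof.
move=> cu cv Quv x; apply/cvg_ballP => e e0.
have [d d0 dP] := arc_size_near (Quv x) e0.
have nu : nbhs x (u @^-1` ball (u x) d) by apply: cu; exact: nbhsx_ballx.
have nv : nbhs x (v @^-1` ball (v x) d) by apply: cv; exact: nbhsx_ballx.
by apply: filterS (filterI nu nv) => y [/= bu bv]; apply: dP.
Qed.

Lemma arc_size_le p x y : Q p x -> Q p y ->
  min_continuum Q p x `<=` min_continuum Q p y -> arc_size p x <= arc_size p y.
Proof. by move=> Qx Qy; apply: set_size_le; exact: min_continuum_neq0. Qed.

Lemma arc_size_inj e1 e2 x y : Q e1 e2 -> min_continuum Q e1 e2 x ->
  min_continuum Q e1 e2 y -> arc_size e1 x = arc_size e1 y -> x = y.
Proof.
move=> Q12 mx my sE.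
have [Qx Qy] := (min_continuum_in decQ smoothQ Q12 mx, min_continuum_in decQ smoothQ Q12 my).
apply: (min_continuum_cancel cD decQ smoothQ Qx Qy).
have eqP u v : Q e1 u -> Q e1 v -> arc_size e1 u = arc_size e1 v ->
    min_continuum Q e1 u `<=` min_continuum Q e1 v ->
    min_continuum Q e1 u = min_continuum Q e1 v.
  move=> Qu Qv uv sub; apply/seteqP; split => //; apply: contrapT => nsub.
  have := set_size_lt dxs (min_continuum_neq0 decQ smoothQ Qu)
    (min_continuum_closed decQ smoothQ Qu) sub nsub.
  by rewrite -!/(arc_size _ _) uv ltxx.
have [h|h] := min_continuum_nested cD decQ smoothQ Q12 mx my; first exact: eqP.
by apply/esym; exact: eqP.
Qed.

Lemma arc_size_ends e1 e2 x : Q e1 e2 -> min_continuum Q e1 e2 x ->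
  arc_size e1 e1 <= arc_size e1 x <= arc_size e1 e2.
Proof.
move=> Q12 mx; have Qx := min_continuum_in decQ smoothQ Q12 mx.
have Q11 := plaque_refl decQ e1.
rewrite !arc_size_le//; first exact: min_continuum_mono.
by rewrite min_continuum_refl// => _ ->; exact: min_continuum_l.
Qed.

Lemma arc_size_surj e1 e2 s : Q e1 e2 -> arc_size e1 e1 <= s <= arc_size e1 e2 ->
  exists2 x, min_continuum Q e1 e2 x & arc_size e1 x = s.
Proof.
move=> Q12 s12; have [cK kK KQ K1 K2] := min_continuumP decQ smoothQ Q12.
have : connected (arc_size e1 @` min_continuum Q e1 e2).
  apply: connected_continuous_connected => //.
  apply/subspace_continuousP => x Kx; apply/cvg_ballP => e e0.
  have [d d0 dP] := arc_size_near (KQ _ Kx) e0.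
  apply/nbhs_ballP; exists d => //= y xy Ky; apply: dP => //; first exact: KQ.
  exact: ballxx.
move=> /connected_intervalP /(_ (arc_size e1 e1) (arc_size e1 e2)).
move=> /(_ (imageP _ K1) (imageP _ K2) s s12)[x Kx xs'].
by exists x.
Qed.

(** [arc_size e1] identifies the arc with an interval. Its Tietze extension, clamped to that
    interval, is pulled back to the arc. *)
Lemma plaque_retraction e1 e2 : Q e1 e2 -> e1 <> e2 ->
  exists r : D -> D, [/\ continuous r, forall x, min_continuum Q e1 e2 (r x) &
    forall x, min_continuum Q e1 e2 x -> r x = x].
Proof.
move=> Q12 e12; pose K := min_continuum Q e1 e2.
have [cK kK KQ K1 K2] := min_continuumP decQ smoothQ Q12.
pose f := arc_size e1; pose m0 := f e1; pose m1 := f e2.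
have fb x : K x -> m0 <= f x <= m1 by exact: arc_size_ends.
have m01 : m0 < m1.
  have /andP[_] := fb _ K1; rewrite le_eqVlt => /orP[/eqP E|//].
  by exfalso; apply: e12; exact: (arc_size_inj Q12 K1 K2 E).
have cf : {within K, continuous f}.
  apply/subspace_continuousP => x Kx; apply/cvg_ballP => e e0.
  have [d d0 dP] := arc_size_near (KQ _ Kx) e0.
  apply/nbhs_ballP; exists d => //= y xy Ky; apply: dP => //; first exact: KQ.
  exact: ballxx.
have clK : closed K by exact: min_continuum_closed.
pose B := `|m0| + `|m1| + 1.
have B0 : 0 < B by rewrite ltr_wpDl.
have fB x : K x -> `|f x| <= B.
  move=> /fb/andP[h1 h2]; rewrite /B ler_norml.
  have := ler_norm m1; have := ler_norm (- m0); rewrite normrN.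
  have := normr_ge0 m0; have := normr_ge0 m1.
  by move: `|m0| `|m1| => u v *; apply/andP; split; lra.
have [g [fg cg _]] := @continuous_bounded_extension D R pseudometric_normal K clK f B B0 cf fB.
have {}fg x : K x -> g x = f x by move=> Kx; apply/esym/fg; rewrite inE.
have m10 : m1 - m0 != 0 by rewrite subr_eq0 gt_eqF.
pose th x := m0 + (m1 - m0) * clamp ((g x - m0) / (m1 - m0)).
have thb x : m0 <= th x <= m1.
  have /andP[c0 c1] := clamp_in ((g x - m0) / (m1 - m0)).
  rewrite /th lerDl mulr_ge0 ?subr_ge0 ?(ltW m01)//= -lerBrDl.
  by rewrite ler_piMr// subr_ge0 ltW.
have thE x : K x -> th x = f x.
  move=> Kx; rewrite /th fg//.
  have /andP[h1 h2] := fb _ Kx.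
  have /andP[q0 q1] : 0 <= (f x - m0) / (m1 - m0) <= 1.
    rewrite divr_ge0 ?subr_ge0 ?(ltW m01)//= ler_pdivrMr ?subr_gt0// mul1r.
    by rewrite lerD2r.
  have -> : clamp ((f x - m0) / (m1 - m0)) = (f x - m0) / (m1 - m0).
    case: (clampP ((f x - m0) / (m1 - m0))) => [[q _]|[_ ->]|[q _]] //.
      by rewrite ltNge q0 in q.
    by rewrite ltNge q1 in q.
  by rewrite mulrC divfK// subrKC.
have /choice[r rP] : forall x, exists y, K y /\ f y = th x.
  by move=> x; have [y Ky yx] := arc_size_surj Q12 (thb x); exists y.
have rE x y : K y -> f y = th x -> r x = y.
  move=> Ky yx; have [Kr rx] := rP x; apply: (arc_size_inj Q12) => //.
  by rewrite -/f rx.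
exists r; split.
- apply: (@continuous_factor D R D D K g id th) => //.
  + exact: cont_id.
  + have cc := @continuous_clamp R; rewrite /th; cts.
  + by move=> x; have [Kr rx] := rP x; exists (r x) => //; rewrite fg.
  + by move=> y x Ky; rewrite fg//; exact: rE.
- by move=> x; have [] := rP x.
- by move=> x Kx; apply: rE => //; rewrite thE.
Qed.

End plaque_parametrization.

Lemma segment01_convex {R : realFieldType} (s t v : R) : 0 <= s <= 1 ->
  0 <= t <= 1 -> 0 <= v <= 1 -> 0 <= s + v * (t - s) <= 1.
Proof.
move=> /andP[s0 s1] /andP[t0 t1] /andP[v0 v1].
have -> : s + v * (t - s) = (1 - v) * s + v * t by ring.
apply/andP; split; first by rewrite addr_ge0 ?mulr_ge0 ?subr_ge0.
have : (1 - v) * s <= 1 - v by rewrite ler_piMr// subr_ge0.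
have : v * t <= v by rewrite ler_piMr.
lra.
Qed.

(** * Every plaque lies over the arc *)

Section arc_of_plaques.
Context {R : realType} {D M : metricType R} (Q : D -> set D) (pi : D -> M).
Context (psi : D -> R * R) (Phi : R * R -> D) (xs : nat -> M) (ys : nat -> D).
Hypothesis chart : disc_chart psi Phi.
Hypothesis decQ : decomposition Q.
Hypothesis contQ : continuous_decomposition Q.
Hypothesis smoothQ : C_smooth Q.
Hypothesis cpi : continuous pi.
Hypothesis pi_surj : forall m, exists x, pi x = m.
Hypothesis piE : forall x y, pi x = pi y <-> Q x y.
Hypothesis dxs : dense_seq xs.
Hypothesis dys : dense_seq ys.
Hypothesis no_circle : forall f : unit_circle R -> M,
  continuous f -> injective f -> False.

Let cD : compact [set: D] := chart_compact chart.
Let hD : hausdorff_space D := @metric_hausdorff _ D.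
Let hM : hausdorff_space M := @metric_hausdorff _ M.

Lemma boundary_arcs_meet a b x : boundary_pair Q psi a b -> boundary_arc psi a b x ->
  boundary_arc psi b a x -> x = a \/ x = b.
Proof.
move=> [a1 b1 nab] [x1 s1] [_]; rewrite sideC oppr_ge0 => s2.
have npab : psi a <> psi b.
  by move=> /(chart_inj chart) E; apply: nab; rewrite E; exact: plaque_refl.
have s0 : side (psi a) (psi b) (psi x) = 0 by apply/le_anti; rewrite s1 s2.
by have [/(chart_inj chart)|/(chart_inj chart)] := side_eq0 x1 a1 b1 npab s0; [left|right].
Qed.

(* Collapsing a complementary component W of an arc K that misses the boundary
   onto K would retract the disc off a point of W. *)
Lemma no_interior_component e1 e2 x : Q e1 e2 -> e1 <> e2 -> Q e1 = min_continuum Q e1 e2 ->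
  ~ Q e1 x -> (forall z, sqn (psi z) = 1 -> ~ joined (R := R) (~` Q e1) x z) -> False.
Proof.
move=> Q12 e12 QE nx nW.
have [r [cr rK rE]] := plaque_retraction cD decQ smoothQ dys Q12 e12.
rewrite -QE in rK rE.
pose W := [set z | joined (R := R) (~` Q e1) x z].
have oU : open (~` Q e1) by apply: closed_openC; apply: compact_closed => //; exact: plaque_compact.
have oW : open W by exact: (chart_joined_open chart x oU).
pose f z := if z \in W then r z else z.
have fW z : W z -> f z = r z by move=> Wz; rewrite /f mem_set.
have fnW z : ~ W z -> f z = z by move=> nWz; rewrite /f memNset.
have cf : continuous f.
  apply: (@continuous_paste D D (closure W) (~` W) f r id) => //.
  - exact: closed_closure.
  - exact: open_closedC.
  - move=> z; have [Wz|] := pselect (W z); last by right.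
    by left; exact: subset_closure.
  - exact: cont_id.
  (* A limit point of [W] outside [W] lies on [Q e1], where [r] is the identity, since off [Q e1] a
     short path would put it into [W]. *)
  move=> z clz; have [Wz|nWz] := pselect (W z); first exact: fW.
  rewrite fnW// rE//; apply: contrapT => nz; apply: nWz.
  have [w [Ww zw]] := clz _ (chart_joined_local chart oU nz).
  by apply: joined_trans Ww _; exact: joined_sym.
have [z fz] := chart_no_retraction chart cf (fun z z1 => fnW z (nW z z1)) x.
have [Wz|nWz] := pselect (W z).
  by apply: nx; rewrite -fz fW//; exact: rK.
have E : z = x by rewrite -fz fnW.
by apply: nWz; rewrite E; exact: joined_refl.
Qed.

(** A path from [x] first meets a plaque of the arc at [y], and [Q y] separates [x] from all other
    plaques of the arc. If [Q y] is an end plaque, it lies on the circle and cannot do so. Otherwise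
    each boundary point off [Q y] is joined to [a] or [b], so the component of [x] misses the
    circle. *)
Lemma arc_covers a b h : boundary_pair Q psi a b ->
  Q a `<=` [set z | sqn (psi z) = 1] -> Q b `<=` [set z | sqn (psi z) = 1] ->
  arc_between pi a b h -> forall x, exists2 t, 0 <= t <= 1 & pi x = h t.
Proof.
move=> ab Aa Bb hab x; have [[ch hinj] h0 h1] := hab.
apply: contrapT => nx.
have [g [cg g0 g1 _]] := chart_joined_setT chart x a.
pose E := (fun s => pi (g s)) @^-1` (h @` `[0, 1]%classic).
have cpg : continuous (fun s => pi (g s)) by cts.
have clE : closed E.
  apply: (continuous_closedP _).1 cpg _ _; apply: compact_closed => //.
  by apply: continuous_image_compact => //; exact: segment_compact.
have E1 : E 1 by exists 0; rewrite /= ?in_itv /= ?lexx ?ler01// g1.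
have nE0 : ~ E 0.
  by move=> [t]; rewrite /= in_itv /= g0 => t01 pt; apply: nx; exists t.
have [m [[t]]] := closed_min clE E1 ler01.
rewrite /= in_itv /= => t01 tm m0 mmin.
have m1 : m <= 1 by apply: mmin => //; exact: ler01.
have m0' : 0 < m.
  rewrite lt_neqAle m0 andbT; apply/eqP => m0'; apply: nE0; rewrite m0'.
  by exists t.
pose y := g m.
have pxy : pi x <> h t by move=> pt; apply: nx; exists t.
have [N [cN N0 N1 Nimg Ninj]] : exists N : R -> M, [/\ continuous N,
    N 0 = pi (g (0 * m)), N 1 = pi (g (1 * m)),
    (forall u, 0 <= u <= 1 -> exists2 w, 0 <= w <= 1 & N u = pi (g (w * m))) &
    (forall u v, 0 <= u <= 1 -> 0 <= v <= 1 -> N u = N v -> u = v)].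
  apply: (injective_path dxs (g := fun u => pi (g (u * m)))).
    by cts.
  by rewrite mul0r mul1r g0 -tm.
rewrite mul0r mul1r g0 -tm in N0 N1.
(* [N] uses only values from before the first meeting, so [N] followed by the part of [h] from [t]
   to [t1] is again an arc, with [pi y] in its interior. *)
have sep t1 z : 0 <= t1 <= 1 -> t1 != t -> pi z = h t1 ->
    ~ joined (R := R) (~` Q y) x z.
  move=> t101 t1t zt.
  have c01 v : 0 <= v <= 1 -> 0 <= t + v * (t1 - t) <= 1.
    exact: segment01_convex.
  have [||||||k [ck k0 k1 k2 kinj]] := @injective_path_join R M N (fun v => h (t + v * (t1 - t))).
  - by [].
  - by cts.
  - by rewrite mul0r addr0.
  - exact: Ninj.
  - move=> u v u01 v01 /hinj Euv; have := Euv (c01 _ u01) (c01 _ v01).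
    by move=> /addrI/mulIf; apply; rewrite subr_eq0.
  - move=> u v u01 v01 Nu; have [w w01 Nw] := Nimg u u01.
    have mw : m <= w * m.
      apply: mmin; last by rewrite mulr_ge0//; case/andP: w01.
      by exists (t + v * (t1 - t)); rewrite /= ?in_itv /= ?c01// -Nu Nw.
    have w1 : w = 1.
      apply/le_anti; case/andP: w01 => _ -> /=; rewrite -(@ler_pM2r _ m)// mul1r.
      by [].
    by apply: Ninj => //; [rewrite lexx ler01|rewrite Nw w1 mul1r N1].
  have xz : arc_between pi x z k.
    by split; rewrite ?k0 ?k1 ?mul1r ?subrKC.
  apply: (plaque_separates cpi piE dxs no_circle xz (t := 2^-1)); first by lra.
  by rewrite k2 N1 tm.
have [a1 b1 nab] := ab.
have nyx : ~ Q y x by move=> /piE; rewrite -tm => /esym.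
have [t0|tn0] := eqVneq t 0.
  have QE : Q y = Q a by apply: plaque_eq => //; apply/piE; rewrite -tm t0.
  apply: (@sep 1 b) => //; first by rewrite lexx ler01.
    by rewrite t0 oner_neq0.
  by rewrite QE in nyx *; exact: (chart_star chart Aa nyx nab).
have [t1|tn1] := eqVneq t 1.
  have QE : Q y = Q b by apply: plaque_eq => //; apply/piE; rewrite -tm t1.
  apply: (@sep 0 a) => //; first by rewrite lexx ler01.
    by rewrite t1 eq_sym oner_neq0.
  rewrite QE in nyx *; apply: (chart_star chart Bb nyx).
  by move=> /(plaque_sym decQ).
have t01' : 0 < t < 1 by rewrite !lt_neqAle tn1 eq_sym tn0.
have pt : pi y = h t by rewrite -tm.
have [e1 [e2 cr]] := interior_crossing_exists chart decQ contQ smoothQ cpi pi_surj piE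
  dxs no_circle ab hab t01' pt.
have QE := crossingE decQ smoothQ cr; have [Q1 Q2 B1 B2 _] := cr.
have QE1 := plaque_eq decQ Q1.
have [na nb] := interior_plaque_avoids piE hab t01' pt.
apply: (@no_interior_component e1 e2 x).
- by rewrite -QE1.
- move=> e12; rewrite -e12 in B2.
  by have [Ea|Eb] := boundary_arcs_meet ab B1 B2; [apply: na; rewrite -Ea|apply: nb; rewrite -Eb].
- by rewrite -QE1.
- by rewrite -QE1.
rewrite -QE1 => z z1 xz; have nz := (joined_mem xz).2.
have [az|bz] := interior_plaque_sides chart decQ contQ smoothQ cpi pi_surj piE
  dxs no_circle ab hab t01' pt nz z1.
  apply: (@sep 0 a) => //; [by rewrite lexx ler01|by rewrite eq_sym|].
  by apply: joined_trans xz _; exact: joined_sym.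
apply: (@sep 1 b) => //; [by rewrite lexx ler01|by rewrite eq_sym|].
by apply: joined_trans xz _; exact: joined_sym.
Qed.

End arc_of_plaques.

(** * Endpoints of plaques and the product coordinates *)

Section product.
Context {R : realType} {D M : metricType R} (Q : D -> set D) (pi : D -> M).
Context (psi : D -> R * R) (Phi : R * R -> D) (xs : nat -> M) (ys : nat -> D).
Hypothesis chart : disc_chart psi Phi.
Hypothesis decQ : decomposition Q.
Hypothesis contQ : continuous_decomposition Q.
Hypothesis smoothQ : C_smooth Q.
Hypothesis cpi : continuous pi.
Hypothesis pi_surj : forall m, exists x, pi x = m.
Hypothesis piE : forall x y, pi x = pi y <-> Q x y.
Hypothesis dxs : dense_seq xs.
Hypothesis dys : dense_seq ys.
Hypothesis no_circle : forall f : unit_circle R -> M,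
  continuous f -> injective f -> False.

Let cD : compact [set: D] := chart_compact chart.
Let hD : hausdorff_space D := @metric_hausdorff _ D.
Let hM : hausdorff_space M := @metric_hausdorff _ M.
Let cpsi : continuous psi. Proof. by have [] := chart. Qed.

Lemma closed_boundary_arc a b : closed (boundary_arc psi a b).
Proof.
have -> : boundary_arc psi a b = [set x | sqn (psi x) = 1] `&`
    (fun x => side (psi a) (psi b) (psi x)) @^-1` [set s | 0 <= s] by [].
have cs := @continuous_sqn R; have cd := @continuous_side R (psi a) (psi b).
apply: closedI.
  apply: (closed_equalizer (f := fun x => sqn (psi x)) (g := fun=> 1)).
  - exact: Rhausdorff.
  - by cts.
  - exact: cont_cst.
by apply: (continuous_closedP _).1; [cts|exact: closed_ge].
Qed.

(** Continuity of [Q] moves a point of [Q x] into nearby plaques, and smoothness keeps their minimal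
    continua close to the limiting one; each accounts for [e / 2]. *)
Lemma closed_crossing a b :
  closed [set p : D * (D * D) | crossing Q psi a b p.1 p.2.1 p.2.2].
Proof.
set G := [set p | _] => -[x [e1 e2]] clG.
have closedP (A : set (D * (D * D))) : closed A -> G `<=` A -> A (x, (e1, e2)).
  by move=> clA GA; apply: clA; exact: closureS clG.
have cfst : continuous (fun p : D * (D * D) => p.1) by apply: cont_fst; exact: cont_id.
have csnd : continuous (fun p : D * (D * D) => p.2) by apply: cont_snd; exact: cont_id.
have c1 : continuous (fun p : D * (D * D) => p.2.1) by exact: cont_fst.
have c2 : continuous (fun p : D * (D * D) => p.2.2) by exact: cont_snd.
have Q1 : Q x e1.
  apply/piE; apply: (closedP [set p | pi p.1 = pi p.2.1]).
    by apply: closed_equalizer => //; exact: cont_comp cpi.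
  by move=> p [/piE].
have Q2 : Q x e2.
  apply/piE; apply: (closedP [set p | pi p.1 = pi p.2.2]).
    by apply: closed_equalizer => //; exact: cont_comp cpi.
  by move=> p [_ /piE].
split => //.
- apply: (closedP [set p | boundary_arc psi a b p.2.1]); last by move=> p [].
  exact: ((continuous_closedP _).1 c1 _ (@closed_boundary_arc a b)).
- apply: (closedP [set p | boundary_arc psi b a p.2.2]); last by move=> p [].
  exact: ((continuous_closedP _).1 c2 _ (@closed_boundary_arc b a)).
have Q12 : Q e1 e2 by rewrite -(plaque_eq decQ Q1).
move=> z Qz; apply: contrapT => nz.
have /nbhs_ballP[e /= e0 ez] : nbhs z (~` min_continuum Q e1 e2).
  apply: open_nbhs_nbhs; split => //; apply: closed_openC; exact: min_continuum_closed.
have e20 : 0 < e / 2 by rewrite divr_gt0.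
have [d d0 dP] := min_continuum_near cD decQ smoothQ Q12 e20.
have [c c0 cP] := plaque_near cD decQ contQ x e20.
have nb : nbhs (x, (e1, e2)) (ball x c `*` (ball e1 d `*` ball e2 d)).
  exists (ball x c, ball e1 d `*` ball e2 d) => //; split; first exact: nbhsx_ballx.
  by exists (ball e1 d, ball e2 d) => //; split; exact: nbhsx_ballx.
have [[x' [e1' e2']] [[/= Q1' Q2' _ _ QE'] [/= bx [be1 be2]]]] := clG _ nb.
have Q12' : Q e1' e2' by rewrite -(plaque_eq decQ Q1').
have [_ /(_ z Qz)[w Qw wz]] := cP x' bx.
have [/(_ w (QE' w Qw))[v mv vw] _] := dP _ _ Q12' be1 be2.
apply: (ez v) => //; apply/ball_sym.
by have -> : e = e / 2 + e / 2; [lra|exact: ball_triangle vw wz].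
Qed.

Variables (a b : D) (h : R -> M).
Hypothesis ab : boundary_pair Q psi a b.
Hypothesis Aa : Q a `<=` [set z | sqn (psi z) = 1].
Hypothesis Bb : Q b `<=` [set z | sqn (psi z) = 1].
Hypothesis nta : nontrivial_plaque Q a.
Hypothesis ntb : nontrivial_plaque Q b.
Hypothesis hab : arc_between pi a b h.

(** The points with a crossing form the projection of a compact set, hence a closed set; it is dense
    because [pi] is open and []0, 1[] is dense in [[0, 1]]. *)
Lemma crossing_exists x : exists e1 e2, crossing Q psi a b x e1 e2.
Proof.
pose G := [set p : D * (D * D) | crossing Q psi a b p.1 p.2.1 p.2.2].
have cG : compact G.
  apply: (@subclosed_compact _ G setT); [exact: closed_crossing| |by []].
  by rewrite -setXTT; apply: compact_setX => //; rewrite -setXTT; exact: compact_setX.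
have clG : closed (fst @` G).
  apply: compact_closed => //; apply: continuous_image_compact => //.
  by apply: cont_fst; exact: cont_id.
suff [[y [e1 e2]] /= cr <-] : (fst @` G) x by exists e1, e2.
apply: clG => V Vx; have [[ch hinj] h0 h1] := hab.
have [t t01 xt] := arc_covers chart decQ contQ smoothQ cpi pi_surj piE dxs dys no_circle
  ab Aa Bb hab x.
have [U [oU Ux UV]] : exists U, [/\ open U, U x & U `<=` V].
  by exists (V°); split; [exact: open_interior|exact: Vx|exact: interior_subset].
have := projection_open cD decQ contQ cpi pi_surj piE oU Ux; rewrite xt => nU.
have /nbhs_ballP[e /= e0 eU] : nbhs t (h @^-1` (pi @` U)) by exact: ch.
have [s [s01 st]] : exists s, 0 < s < 1 /\ `|t - s| < e.
  (* A shift towards the middle by at most [1 / 4] stays strictly inside the interval. *)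
  pose m := Num.min (e / 2) (1 / 4).
  have [m0 me m1] : [/\ 0 < m, m <= e / 2 & m <= 1 / 4].
    by split; rewrite /m ?lt_min ?ge_min ?lexx ?orbT//; apply/andP; split; lra.
  have [t2|t2] := leP t 2^-1.
    by exists (t + m); rewrite ltr_norml; split; lra.
  by exists (t - m); rewrite ltr_norml; split; lra.
have [y Uy ys'] : (pi @` U) (h s) by apply: eU.
have [e1 [e2 cr]] := interior_crossing_exists chart decQ contQ smoothQ cpi pi_surj piE
  dxs no_circle ab hab s01 ys'.
by exists y; split; [exists (y, (e1, e2))|exact: UV].
Qed.

(** Equal endpoints reduce the plaque to a point common to both arcs, that is, to [a] or [b], whose
    plaques are non-trivial. *)
Lemma crossing_neq x e1 e2 : crossing Q psi a b x e1 e2 -> e1 <> e2.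
Proof.
move=> cr E; have := crossingE decQ smoothQ cr; rewrite -E min_continuum_refl// => QE.
have [Q1 _ B1 B2 _] := cr; rewrite -E in B2.
have triv y : e1 = y -> ~ nontrivial_plaque Q y.
  move=> <- [u [v []]]; rewrite -(plaque_eq decQ Q1) QE => -> ->.
  by apply.
by have [/triv|/triv] := boundary_arcs_meet chart decQ ab B1 B2.
Qed.

(** By [min_continuum_end] the endpoints are determined up to exchange. An exchange would put both
    on both arcs, so that they would be [a] and [b], which lie on different plaques. *)
Lemma crossing_uniq x e1 e2 e1' e2' : crossing Q psi a b x e1 e2 ->
  crossing Q psi a b x e1' e2' -> e1 = e1' /\ e2 = e2'.
Proof.
move=> cr cr'; have QE := crossingE decQ smoothQ cr; have QE' := crossingE decQ smoothQ cr'.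
have [Q1 Q2 B1 B2 _] := cr; have [Q1' Q2' B1' B2' _] := cr'.
have ne := crossing_neq cr; have ne' := crossing_neq cr'.
have E1 := plaque_eq decQ Q1; have E1' := plaque_eq decQ Q1'.
have Q12 : Q e1 e2 by rewrite -E1.
have Q12' : Q e1' e2' by rewrite -E1'.
have Q11 : Q e1 e1' by rewrite -E1.
have Q11' : Q e1 e2' by rewrite -E1.
have mE : min_continuum Q e1 e2 = min_continuum Q e1' e2' by rewrite -QE -QE'.
have mE' : min_continuum Q e1 e2 = min_continuum Q e2' e1'.
  by rewrite mE (min_continuum_sym decQ Q12').
have both : e1' = e2 -> e2' = e1 -> False.
  move=> F1 F2; rewrite F1 in B1'; rewrite F2 in B2'; have [_ _ nab] := ab.
  have H1 := boundary_arcs_meet chart decQ ab B1 B2'.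
  have H2 := boundary_arcs_meet chart decQ ab B1' B2.
  have Q21 : Q e2 e1 by exact: (plaque_sym decQ).
  case: H1 => F3; case: H2 => F4; try (by apply: ne; rewrite F3 F4).
    by apply: nab; rewrite -F3 -F4.
  by apply: nab; rewrite -F3 -F4.
have [F1|F1] := min_continuum_end cD decQ smoothQ Q12 Q11 Q11' mE;
have [F2|F2] := min_continuum_end cD decQ smoothQ Q12 Q11' Q11 mE'.
- by exfalso; apply: ne'; rewrite F1 F2.
- by [].
- by exfalso; exact: both.
- by exfalso; apply: ne'; rewrite F1 F2.
Qed.

Lemma plaques_product : exists g : D -> M * M, homeomorphism g /\
  forall x, g @` Q x = [set: M] `*` [set (g x).2].
Proof.
have [[ch hinj] h0 h1] := hab.
have /choice[e eP] : forall x, exists p : D * D, crossing Q psi a b x p.1 p.2.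
  by move=> x; have [e1 [e2 cr]] := crossing_exists x; exists (e1, e2).
pose G := [set p : D * (D * D) | crossing Q psi a b p.1 p.2.1 p.2.2].
have cG : compact G.
  apply: (@subclosed_compact _ G setT); [exact: closed_crossing| |by []].
  by rewrite -setXTT; apply: compact_setX => //; rewrite -setXTT; exact: compact_setX.
(* The graph of [e] is the compact set [G], by uniqueness of the endpoints. *)
have ce : continuous e.
  apply: (@continuous_factor (D * (D * D))%type D (D * D)%type D G fst snd id) => //.
  - by apply: cont_fst; exact: cont_id.
  - by apply: cont_snd; exact: cont_id.
  - exact: cont_id.
  - by move=> x; exists (x, e x) => //; exact: eP.
  - move=> [y [u v]] x /= cr yx; rewrite yx in cr.
    by have [u1 u2] := crossing_uniq (eP x) cr; rewrite [LHS]surjective_pairing u1 u2.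
pose e1 x := (e x).1; pose e2 x := (e x).2.
have ce1 : continuous e1 by exact: cont_fst.
have ce2 : continuous e2 by exact: cont_snd.
have QE x : Q x = min_continuum Q (e1 x) (e2 x) := crossingE decQ smoothQ (eP x).
have Q1 x : Q x (e1 x) by have [] := eP x.
have Q2 x : Q x (e2 x) by have [] := eP x.
have Q1E x : Q x = Q (e1 x) := plaque_eq decQ (Q1 x).
have Q1x x : Q (e1 x) x by rewrite -Q1E; exact: plaque_refl.
have Q12 x : Q (e1 x) (e2 x) by rewrite -Q1E.
have eE x y : Q x y -> e x = e y.
  move=> Qxy; have Exy := plaque_eq decQ Qxy.
  have cr : crossing Q psi a b x (e y).1 (e y).2.
    by have [] := eP y; split; rewrite ?Exy.
  have [u1 u2] := crossing_uniq (eP x) cr.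
  by rewrite [LHS]surjective_pairing u1 u2 -surjective_pairing.
pose s := arc_size Q ys.
pose m0 x := s (e1 x) (e1 x); pose m1 x := s (e1 x) (e2 x).
have cs0 : continuous m0 by apply: arc_size_continuous => // x; exact: plaque_refl.
have cs1 : continuous m1 by apply: arc_size_continuous.
have csx : continuous (fun x => s (e1 x) x).
  by apply: arc_size_continuous => //; exact: cont_id.
have mb x y : Q x y -> m0 x <= s (e1 x) y <= m1 x.
  by move=> Qxy; apply: arc_size_ends => //; rewrite -QE.
have m01 x : m0 x < m1 x.
  have /andP[_] := mb x (e1 x) (Q1 x); rewrite le_eqVlt => /orP[/eqP E|//].
  exfalso; apply: (crossing_neq (eP x)).
  apply: (arc_size_inj cD decQ smoothQ dys (Q12 x)) => //; first exact: min_continuum_l.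
  exact: min_continuum_r.
have m10 x : m1 x - m0 x != 0 by rewrite subr_eq0 gt_eqF.
(* [m0 x] is the size of the single point [e1 x]; it varies with the point and need not vanish, so
   it is subtracted. *)
pose f x := (s (e1 x) x - m0 x) * (m1 x - m0 x)^-1.
have cf : continuous f.
  have cV : continuous (fun x => (m1 x - m0 x)^-1).
    move=> x; apply: cvgV => //; have : continuous (fun x => m1 x - m0 x) by cts.
    exact.
  by rewrite /f; apply: contM => //; cts.
have f01 x : 0 <= f x <= 1.
  have /andP[b0 b1] := mb x x (plaque_refl decQ x).
  rewrite /f divr_ge0 ?subr_ge0 ?(ltW (m01 x))//= ler_pdivrMr ?subr_gt0// mul1r.
  by rewrite lerD2r.
have f_inj x y : Q x y -> f x = f y -> x = y.
  move=> Qxy; rewrite /f /m0 /m1 /e1 /e2 -(eE _ _ Qxy) -/(e1 x) -/(e2 x).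
  move=> /(mulIf (invr_neq0 (m10 x)))/addIr E.
  apply: (arc_size_inj cD decQ smoothQ dys (Q12 x)) E; rewrite -QE//.
  exact: plaque_refl.
have f_surj x t : 0 <= t <= 1 -> exists2 y, Q x y & f y = t.
  move=> /andP[t0 t1]; have tb : m0 x <= m0 x + t * (m1 x - m0 x) <= m1 x.
    rewrite lerDl mulr_ge0 ?subr_ge0 ?(ltW (m01 x))//= -lerBrDl ler_piMl//.
    by rewrite subr_ge0 ltW.
  have [y my yE] := arc_size_surj cD decQ smoothQ (Q12 x) tb.
  have Qxy : Q x y by rewrite QE.
  exists y => //; rewrite /f /m0 /m1 /e1 /e2 -(eE _ _ Qxy) -/(e1 x) -/(e2 x).
  by rewrite /s yE -/s -/(m0 x) -/(m1 x) [m0 x + _]addrC addrK mulfK.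
pose g x := (h (f x), pi x).
have cg : continuous g by apply: cont_pair => //; exact: cont_comp.
have g_inj x y : g x = g y -> x = y.
  move=> [/hinj hf /piE Qxy]; apply: f_inj => //; exact: hf.
have g_surj m : exists x, g x = m.
  case: m => m n; have [x xn] := pi_surj n; have [z zm] := pi_surj m.
  have [t t01 zt] := arc_covers chart decQ contQ smoothQ cpi pi_surj piE dxs dys no_circle
    ab Aa Bb hab z.
  have [y Qxy yt] := f_surj x t t01.
  exists y; rewrite /g yt -zt zm; congr (_, _).
  by rewrite -xn; apply/esym/piE.
exists g; split.
  split => //; have /choice[k kP] := g_surj.
  exists k; split => //; last by move=> x; apply: g_inj; rewrite kP.
  apply: (@continuous_factor D (M * M)%type D (M * M)%type setT g id id) => //.
  - exact: hausdorff_pair.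
  - exact: cont_id.
  - exact: cont_id.
  - by move=> y; have [x xy] := g_surj y; exists x.
  - by move=> x y _ xy; apply: g_inj; rewrite kP.
move=> x; apply/seteqP; split => [_ [y /piE Qxy <-]|[m n] /= [_ ->]].
  by split => //=.
have [z zm] := g_surj (m, pi x); exists z => //.
by apply/piE; move: zm => [_ ->].
Qed.

End product.

(** * The circle, the space of plaques and the conclusion *)

Section circle_space.
Context {R : realType}.

Lemma unit_circle_compact : compact [set: unit_circle R].
Proof.
pose q1 : R * R := (1, 0); pose q2 : R * R := (-1, 0).
have q11 : sqn q1 = 1 by rewrite /sqn /=; ring.
have q21 : sqn q2 = 1 by rewrite /sqn /=; ring.
have q12 : q1 <> q2 by move=> [E]; lra.
have arc u v : sqn u = 1 -> sqn v = 1 -> u <> v ->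
    compact [set p : unit_circle R | 0 <= side u v (set_val p)].
  move=> u1 v1 uv; have [c [cc _ _ [c1 cs cx _]]] := circle_arc u1 v1 uv.
  pose k s : unit_circle R := SigSub (mem_set (c1 s : unit_circle R (c s))).
  have ck : continuous k by apply: continuous_comp_initial; exact: cc.
  have -> : [set p : unit_circle R | 0 <= side u v (set_val p)] = k @` `[0, 1]%classic.
    apply/seteqP; split => [p p0|_ [s s01 <-]] /=; last by apply: cs; move: s01; rewrite /= in_itv.
    have [s s01 sp] := cx _ (set_valP p) p0.
    by exists s; [rewrite /= in_itv|apply: val_inj].
  by apply: continuous_image_compact => //; exact: segment_compact.
have -> : [set: unit_circle R] = [set p | 0 <= side q1 q2 (set_val p)] `|`
    [set p | 0 <= side q2 q1 (set_val p)].
  apply/seteqP; split => // p _ /=; rewrite (sideC q1 q2) oppr_ge0.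
  by apply/orP; exact: le_total.
by apply: compactU; apply: arc => //; exact/nesym.
Qed.

(** Compactness makes a continuous injection of the circle an embedding, so a space without simple
    closed curves admits none. *)
Lemma circle_embedding (T : topologicalType) (f : unit_circle R -> T) :
  hausdorff_space T -> continuous f -> injective f ->
  exists S : set T, simple_closed_curve R S.
Proof.
move=> hT cf finj; exists (range f).
have rf u : range f (f u) by exists u.
exists (fun u => SigSub (mem_set (rf u))); split.
  by apply: continuous_comp_initial; exact: cf.
have /choice[g gP] : forall s : range f, exists u, f u = set_val s.
  by move=> s; have [u _ us] := set_valP s; exists u.
exists g; split.
- apply: (@continuous_factor (unit_circle R) T (unit_circle R) (range f) setT f id
    (fun s => set_val s)) => //.
  + exact: unit_circle_compact.
  + exact: cont_id.
  + exact: initial_continuous.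
  + by move=> s; have := gP s; exists (g s).
  + by move=> u s _ us; apply: finj; rewrite gP us.
- by move=> u; apply: finj; rewrite gP.
- by move=> s; apply: val_inj => /=; rewrite gP.
Qed.

End circle_space.

Lemma hausdorff_homeomorphism (T U : topologicalType) (f : T -> U) :
  homeomorphism f -> hausdorff_space U -> hausdorff_space T.
Proof.
move=> [cf [g [cg fK gK]]] hU x y xy; apply: (can_inj fK); apply: hU => A B Ax By.
by have [z [Az Bz]] := xy _ _ (cf x A Ax) (cf y B By); exists (f z).
Qed.

Section plaque_space.
Context {R : realType} {D : metricType R} (Q : D -> set D).
Hypothesis decQ : decomposition Q.

Definition plaque_proj (x : D) : plaque_space Q := \pi x.

Lemma plaque_projE x y : plaque_proj x = plaque_proj y <-> Q x y.
Proof.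
rewrite /plaque_proj; split.
  move=> /eqmodP /asboolP ->; exact: plaque_refl.
by move=> Qxy; apply/eqmodP/asboolP; exact: plaque_eq.
Qed.

Lemma plaque_proj_surj m : exists x, plaque_proj x = m.
Proof. by exists (repr m); exact: reprK. Qed.

Lemma continuous_plaque_proj : continuous plaque_proj.
Proof. exact: pi_continuous. Qed.

End plaque_space.

Theorem theorem6p4p5 (R : realType) (D : metricType R)
    (phi : unit_disc R -> D) (hphi : homeomorphism phi)
    (Q : D -> set D)
    (hcw : cw_decomposition Q)
    (hcont : continuous_decomposition Q)
    (hsmooth : C_smooth Q)
    (hbd : exists a b : D,
      [/\ nontrivial_plaque Q a, nontrivial_plaque Q b, Q a <> Q b,
          Q a `<=` disc_boundary phi & Q b `<=` disc_boundary phi]) :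
  product_structure Q.
Proof.
have [psi [Phi [chart bdE]]] := disc_chart_exists hphi.
have [decQ [[M [f hf]] [_ kT] _ no_scc] _] := hcw.
have [cf [g [cg fK gK]]] := hf.
have [a [b [nta ntb nab Aa Bb]]] := hbd; rewrite bdE in Aa Bb.
have hM := @metric_hausdorff R M.
(* Working in the metric model [M] of the quotient makes set sizes and dense sequences available
   there. *)
pose pi x := f (plaque_proj Q x).
have cpi : continuous pi by exact: cont_comp (@continuous_plaque_proj _ _ Q) cf.
have pi_surj m : exists x, pi x = m.
  by have [x xm] := plaque_proj_surj (g m); exists x; rewrite /pi xm gK.
have piE x y : pi x = pi y <-> Q x y.
  rewrite -(plaque_projE decQ); split => [/(can_inj fK)//|E]; by rewrite /pi E.
have [_ cPhi psiK _ _] := chart.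
have cpP : continuous (fun p => pi (Phi p)) by exact: cont_comp.
have [ys dys] : exists ys : nat -> D, dense_seq ys.
  by apply: (dense_seq_image cPhi) => x; exists (psi x).
have [xs dxs] : exists xs : nat -> M, dense_seq xs.
  apply: (dense_seq_image cpP) => m; have [x xm] := pi_surj m.
  by exists (psi x); rewrite psiK.
have no_circle (k : unit_circle R -> M) : continuous k -> injective k -> False.
  move=> ck kinj; have [|||S] := @circle_embedding R (plaque_space Q) (g \o k).
  - exact: hausdorff_homeomorphism hf hM.
  - exact: cont_comp.
  - exact: inj_comp (can_inj gK) kinj.
  - exact: no_scc.
have nQab : ~ Q a b by move=> /(plaque_eq decQ).
have ab : boundary_pair Q psi a b.
  by split => //; [apply: Aa|apply: Bb]; exact: plaque_refl.
have [c [cc c0 c1 _]] := chart_joined_setT chart a b.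
have cpc : continuous (fun s => pi (c s)) by exact: cont_comp.
have [|h [ch h0 h1 _ hinj]] := injective_path dxs cpc; first by rewrite c0 c1 => /piE.
have hab : arc_between pi a b h by split; rewrite ?h0 ?h1 ?c0 ?c1.
have [k [hk kQ]] := plaques_product chart decQ hcont hsmooth cpi pi_surj piE dxs dys
  no_circle ab Aa Bb nta ntb hab.
have piT : [set: M] = f @` [set: plaque_space Q].
  by apply/seteqP; split => // m _; exists (g m) => //; rewrite gK.
have cM : compact [set: M].
  have -> : [set: M] = pi @` [set: D].
    by apply/seteqP; split => // m _; have [x xm] := pi_surj m; exists x.
  by apply: continuous_image_compact => //; exact: chart_compact chart.
exists M, M, k; split => //; split => //.
by rewrite piT; apply: continuous_image_connected => //; case: kT.
Qed.
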